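(* Let $\phi$ be a Bernstein function such that $\phi(0)=0$ and $\mathbf{a}_\phi<0$. Suppose that $$\limsup_{x\to\infty}\frac{\phi'(x)}{\phi'(2x)}<\infty,\qquad \lim_{x\to\infty}x^2\phi'(x)=\infty,\qquad \phi(\infty):=\lim_{x\to\infty}\phi(x)=\infty.$$ Then, for every $l\in\mathbb{Z}$ with $-1+\mathbf{a}_\phi<l<0$ and every $t>0$, $$\mathbb{E}\left[I_\phi^l(t)\right]=\phi'(0)\frac{\prod_{j=1}^{-l-1}\left(-\phi(j+l)\right)}{(-l-1)!}+\sum_{k\ge1}\frac{\prod_{j=1}^{-l-1}\left(\phi(k)-\phi(j+l)\right)}{(-l-1)!}\phi'(k)e^{-\phi(k)t}=\sum_{k\ge0}\frac{\prod_{j=1}^{-l-1}\left(\phi(k)-\phi(j+l)\right)}{(-l-1)!}\phi'(k)e^{-\phi(k)t},$$ where $\phi'(0)$ exists because $\mathbf{a}_\phi<0$.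
   Context: A Bernstein function is $\phi(z)=\phi(0)+dz+\int_0^\infty(1-e^{-zy})\mu(dy)$, $\mathrm{Re}(z)\ge0$, with $\phi(0),d\ge0$ and $\mu$ a sigma-finite measure on $(0,\infty)$ with $\int_0^\infty\min\{y,1\}\mu(dy)<\infty$. It corresponds to a subordinator $\xi$ via $\phi(z)=-\log\mathbb{E}[e^{-z\xi_1}]$; when $\phi(0)=0$ the subordinator is not killed. $I_\phi(t)=\int_0^te^{-\xi_s}ds$ and $I_\phi^l(t)=(I_\phi(t))^l$. $\mathbf{a}_\phi=\inf\{u<0:\ \phi \text{ extends holomorphically to } \{\mathrm{Re}(z)>u\}\}\in[-\infty,0]$, with $\inf\emptyset=0$; $\phi$ also denotes its extension. Empty products equal $1$. *)

(* Defs.v *)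
From HB Require Import structures.
From mathcomp Require Export all_boot all_order all_algebra.
From mathcomp Require Export all_classical all_reals all_analysis.
From mathcomp Require Export complex.
Set Implicit Arguments.
Unset Strict Implicit.
Unset Printing Implicit Defensive.
Import Order.TTheory GRing.Theory Num.Theory.
Import numFieldNormedType.Exports.

Local Open Scope classical_set_scope.
Local Open Scope ring_scope.
Local Open Scope complex_scope.

Section Complex.
Variable R : realType.
Implicit Types (f : R[i] -> R[i]) (z : R[i]) (u : \bar R).

Definition cexp z : R[i] :=
  (expR (complex.Re z))%:C * (cos (complex.Im z) +i* sin (complex.Im z)).

Definition cintegral d (T : measurableType d) (mu : {measure set T -> \bar R})
    (D : set T) (g : T -> R[i]) : R[i] :=
  Rintegral mu D (fun x => complex.Re (g x)) +i*
  Rintegral mu D (fun x => complex.Im (g x)).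

(* R[i]^o is R[i] as a normed space over itself, so derivability in the
   direction 1 is complex differentiability. *)
Definition cderivable f z : Prop :=
  derivable (f : R[i]^o -> R[i]^o) z 1.

Definition cderive f z : R[i] := 'D_1 (f : R[i]^o -> R[i]^o) z.

Definition holomorphic_right_of u f : Prop :=
  forall z, (u < (complex.Re z)%:E)%E -> cderivable f z.

End Complex.

Section Bernstein.
Variable R : realType.
Implicit Types phi : R[i] -> R[i].

(* Only the values of phi on Re z >= 0 matter.  The order of R[i] makes
   0 <= phi 0 say that phi 0 is real and nonnegative.  The measure is on the
   whole line, but only its restriction to ]0, +oo[ is used. *)
Definition bernstein phi : Prop :=
  0 <= phi 0 /\
  exists (dr : R) (mu : {measure set (measurableTypeR R) -> \bar R}),
    [/\ 0 <= dr,
        sigma_finite (`]0, +oo[ : set (measurableTypeR R)) mu,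
        (\int[mu]_(y in `]0%R, +oo[) (Num.min y 1)%:E < +oo)%E &
        forall z : R[i], 0 <= complex.Re z ->
          phi z = phi 0 + dr%:C * z +
                  cintegral mu `]0, +oo[ (fun y : R => 1 - cexp (- (z * y%:C)))].

Definition extends_right_of phi (u : \bar R) : Prop :=
  exists F : R[i] -> R[i], holomorphic_right_of u F /\
    forall z, 0 <= complex.Re z -> F z = phi z.

(* Adjoining 0 to a set of negative reals leaves its infimum unchanged, except
   that the empty set gets infimum 0. *)
Definition a_ phi : \bar R :=
  ereal_inf ([set u%:E | u in [set u : R | u < 0 /\ extends_right_of phi u%:E]]
             `|` [set 0%E]).

End Bernstein.

Section Subordinator.
Context {R : realType} {d : measure_display} {Om : measurableType d}.
Variable P : probability Om R.
Implicit Types xi : R -> Om -> R.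

Definition independent_increments xi : Prop :=
  forall (n : nat) (t : nat -> R) (B : nat -> set (measurableTypeR R)),
    0 <= t 0%N -> (forall i, t i <= t i.+1) -> (forall i, measurable (B i)) ->
    P (\bigcap_(i in `I_n) [set w | B i (xi (t i.+1) w - xi (t i) w)]) =
    (\prod_(i < n) P [set w | B i (xi (t i.+1) w - xi (t i) w)%R])%E.

Definition stationary_increments xi : Prop :=
  forall (s h : R) (B : set (measurableTypeR R)),
    0 <= s -> 0 <= h -> measurable B ->
    P [set w | B (xi (s + h) w - xi s w)] = P [set w | B (xi h w)].

(* An unkilled subordinator; only times s >= 0 matter.  The existence of left
   limits follows from monotonicity. *)
Definition subordinator xi : Prop :=
  [/\ forall s, 0 <= s ->
        measurable_fun [set: Om] (xi s : Om -> measurableTypeR R),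
      {ae P, forall w,
        [/\ xi 0 w = 0,
            forall s s', 0 <= s -> s <= s' -> xi s w <= xi s' w &
            forall s, 0 <= s -> xi r w @[r --> s^'+] --> xi s w]},
      independent_increments xi &
      stationary_increments xi].

(* phi(z) = - log E[exp(- z xi_1)], written without the branch of log. *)
Definition laplace_exponent xi (phi : R[i] -> R[i]) : Prop :=
  forall z : R[i], 0 <= complex.Re z ->
    cintegral P [set: Om] (fun w => cexp (- (z * (xi 1 w)%:C))) =
    cexp (- phi z).

Definition expfun xi (t : R) (w : Om) : R :=
  Rintegral (@lebesgue_measure R) `[0, t] (fun s => expR (- xi s w)).

End Subordinator.

Section Terms.
Variable R : realType.

(* For l < 0, `|l| is -l, so that the product ranges over 1 <= j <= -l-1. *)
Definition bterm (phi : R[i] -> R[i]) (l : int) (t : R) (k : nat) : R[i] :=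
  (\prod_(1 <= j < `|l|%N) (phi k%:R - phi (j%:Z + l)%:~R)) / (`|l|.-1)`!%:R
  * cderive phi k%:R * cexp (- (phi k%:R * t%:C)).

End Terms.

(* Main.v *)
(* Write I_t for the exponential functional and a for a_phi.  For l = -1, the
   increments of xi over a grid of [0, t] can be cyclically permuted without
   changing their law; averaging 1 / I_t over these permutations gives
     t E[1 / I_t] = E[xi_t / (1 - e^{- xi_t})] = sum_k E[xi_t e^{- k xi_t}],
   and E[xi_t e^{- k xi_t}] = t phi'(k) e^{- t phi(k)}.  The other exponents
   follow by induction: I_{T+h} = I_h + e^{- xi_h} W, where W is independent of
   xi_h and distributed as I_T, and comparing E[(e^{- xi_h} W)^{-m}] with
   E[I_{T+h}^{-m}] as h tends to 0 yields
     m E[I_T^{-m-1}] = - phi(-m) E[I_T^{-m}] - d/dT E[I_T^{-m}],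
   which multiplies the k-th coefficient of the series by (phi(k) - phi(-m)) / m.
   This uses E[e^{u xi_1}] = e^{- phi(-u)} for 0 < u < - a.  Cauchy's formula on
   a disc centred at 1 expands e^{- phi} in a power series at 1 of radius
   1 - a; on [0, 1] it agrees with the series with nonnegative coefficients
   E[xi_1^n e^{- xi_1}] / n!, so the coefficients are the same, and Tonelli's
   theorem sums the latter at every point of ]a, 1]. *)

From HB Require Import structures.
From mathcomp Require Import fingroup perm.
Require Import Defs.
From mathcomp Require Import measurable_realfun ring lra zify.
Set Implicit Arguments.
Unset Strict Implicit.
Unset Printing Implicit Defensive.
Import Order.TTheory GRing.Theory Num.Theory.
Import numFieldNormedType.Exports.
Local Open Scope classical_set_scope.
Local Open Scope ring_scope.
Local Open Scope complex_scope.
Import Normc.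

(** * Laws of tuples of independent variables *)

(** For l = -1, a cyclic shift by j turns the left sum S_N of e^{-xi} into e^{a_j} y_j, where y_j =
    S_N - (1 - q) S_j and q = e^{-xi_t}; the averaged reciprocals are then a Riemann sum for a
    logarithm. The sum over k of x e^{-kx} misses x / (1 - e^{-x}) only at x = 0, and phi(oo) = oo
    removes the atom of xi_t there. In the recursion E[I_T^{-m-1}] is not known to be finite
    beforehand, so two one-sided inequalities are used. Convexity of x^{-m} with Fatou's lemma gives
    one, and finiteness with it. The reverse one must control large values of xi_h, which costs a
    moment of order m + eta; the strict inequality l > -1 + a leaves room for it. Since phi(k) >= 0
    >= phi(-j), all coefficients are nonnegative: series and expectations live in [0, +oo], and
    difference quotients of the series are bounded termwise. The continuation yields a real
    e^{-phi}, hence only Im phi in pi Z; continuity and phi(0) = 0 then make phi real on ]a, oo[. *)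

Section TupleLaw.
Context {R : realType} {d : measure_display} {Om : measurableType d}.
Local Notation TR := (measurableTypeR R).

(** Boxes are stable under intersection and generate the product sigma-algebra, so agreement on them
    suffices once the total mass is finite. *)
Lemma tuple_measure_unique (n : nat)
    (m1 m2 : {measure set (n.-tuple TR) -> \bar R}) :
  (m1 [set: n.-tuple TR] < +oo)%E ->
  (forall B : 'I_n -> set TR, (forall i, measurable (B i)) ->
    m1 [set x | forall i, B i (tnth x i)] =
    m2 [set x | forall i, B i (tnth x i)]) ->
  forall A, measurable A -> m1 A = m2 A.
Proof.
move=> m1oo m12.
pose G := [set [set x : n.-tuple TR | forall i, B i (tnth x i)] |
  B in [set B : 'I_n -> set TR | forall i, measurable (B i)]].
apply: (@measure_unique _ _ _ G (fun=> setT)).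
- rewrite eqEsubset; split.
  + apply: smallest_sub; first exact: smallest_sigma_algebra.
    elim/big_ind : _ => //; first by move=> A B sA sB C [/sA|/sB].
    move=> i _ _ [A mA <-]; apply: sub_sigma_algebra.
    exists (fun j => if j == i then A else setT); first by move=> j; case: ifP.
    rewrite setTI; apply/seteqP; split => x /=.
      by move/(_ i); rewrite eqxx.
    by move=> Ax j; case: eqP => // ->.
  + apply: smallest_sub; first exact: sigma_algebra_measurable.
    move=> _ [B mB <-]; rewrite [X in measurable X](_ : _ =
      \bigcap_(i in [set: 'I_n]) ((fun x : n.-tuple TR => tnth x i) @^-1` B i)).
      apply: fin_bigcap_measurable => // i _.
      by rewrite -[X in measurable X]setTI; apply: measurable_tnth.
    by apply/seteqP; split => x /=; [move=> h i _; exact: h|move=> h i; exact: h].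
- move=> _ _ [B mB <-] [C mC <-]; exists (fun i => B i `&` C i).
    by move=> i; apply: measurableI; [exact: mB|exact: mC].
  by apply/seteqP; split => x /=; [move=> h; split=> i; case: (h i)|case=> h k i; split].
- by move=> _; exists (fun=> setT) => //; apply/seteqP; split.
- by rewrite bigcup_const.
- by move=> _ [B mB <-]; exact: m12.
- by [].
Qed.

End TupleLaw.

Section IndepLaw.
Context {R : realType} {d : measure_display} {Om : measurableType d}.
Local Notation TR := (measurableTypeR R).
Variable P : probability Om R.

(** The product formula is required for the full index set only; subfamilies follow by taking some
    [B i] equal to [setT]. *)
Definition mutually_independent (n : nat) (X : 'I_n -> Om -> TR) : Prop :=
  forall B : 'I_n -> set TR, (forall i, measurable (B i)) ->
    P [set w | forall i, B i (X i w)] = (\prod_(i < n) P (X i @^-1` B i))%E.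

Definition random_tuple (n : nat) (X : 'I_n -> Om -> TR) (w : Om) : n.-tuple TR :=
  [tuple X i w | i < n].

Lemma measurable_random_tuple (n : nat) (X : 'I_n -> Om -> TR) :
  (forall i, measurable_fun [set: Om] (X i)) ->
  measurable_fun [set: Om] (random_tuple X).
Proof.
move=> mX; apply/measurable_fun_tnthP => i.
by apply: eq_measurable_fun (mX i) => w _ /=; rewrite tnth_mktuple.
Qed.

Lemma RV_of_measurable d' (T : measurableType d') (f : Om -> T) :
  measurable_fun [set: Om] f -> exists X : {RV P >-> T}, X = f :> (Om -> T).
Proof.
move=> mf; pose X : {RV P >-> T} := HB.pack f (isMeasurableFun.Build _ _ _ _ f mf).
by exists X.
Qed.

(** Independence and equal marginals give equal probabilities of boxes, hence equal laws of the two
    tuples. *)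
Lemma independent_eq_integral (n : nat) (X Y : 'I_n -> Om -> TR)
    (F : n.-tuple TR -> \bar R) :
  (forall i, measurable_fun [set: Om] (X i)) ->
  (forall i, measurable_fun [set: Om] (Y i)) ->
  mutually_independent X -> mutually_independent Y ->
  (forall i B, measurable B -> P (X i @^-1` B) = P (Y i @^-1` B)) ->
  measurable_fun setT F -> (forall x, 0 <= F x)%E ->
  (\int[P]_w F (random_tuple X w) = \int[P]_w F (random_tuple Y w))%E.
Proof.
move=> mX mY iX iY XY mF F0.
have [tX tXE] := RV_of_measurable (measurable_random_tuple mX).
have [tY tYE] := RV_of_measurable (measurable_random_tuple mY).
rewrite -tXE -tYE -!(@ge0_integral_distribution _ _ _ _ R P _ F) //.
apply: eq_measure_integral => A mA _.
apply: tuple_measure_unique mA => [|B mB].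
  exact: le_lt_trans (probability_le1 _ _) (ltry _).
have rect (Z : 'I_n -> Om -> TR) : random_tuple Z @^-1` [set x | forall i, B i (tnth x i)] =
    [set w | forall i, B i (Z i w)].
  by apply/seteqP; split => w /= + i => /(_ i); rewrite tnth_mktuple.
rewrite /= /distribution /pushforward tXE tYE !rect iX // iY //.
by apply: eq_bigr => i _; exact: XY.
Qed.

(** The joint law of the head and the tail of the family is a product measure; Tonelli's theorem
    then factors the integral. *)
Lemma independent_split (n : nat) (X : 'I_n.+1 -> Om -> TR)
    (g : TR -> \bar R) (F : n.-tuple TR -> \bar R) :
  (forall i, measurable_fun [set: Om] (X i)) ->
  mutually_independent X ->
  measurable_fun [set: TR] g -> (forall x, 0 <= g x)%E ->
  measurable_fun setT F -> (forall x, 0 <= F x)%E ->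
  (\int[P]_w (g (X ord0 w) * F (random_tuple (fun i => X (lift ord0 i)) w)) =
   \int[P]_w g (X ord0 w) *
   \int[P]_w F (random_tuple (fun i => X (lift ord0 i)) w))%E.
Proof.
move=> mX iX mg g0 mF F0.
set X' := fun i => X (lift ord0 i).
have mX' : measurable_fun [set: Om] (random_tuple X').
  by apply: measurable_random_tuple => i; exact: mX.
have mXX : measurable_fun [set: Om] (fun w => (X ord0 w, random_tuple X' w)).
  by apply/measurable_fun_pairP; split; [exact: mX|exact: mX'].
have [x0 x0E] := RV_of_measurable (mX ord0).
have [x' x'E] := RV_of_measurable mX'.
have [xx xxE] := RV_of_measurable mXX.
pose h (z : TR * n.-tuple TR) := (g z.1 * F z.2)%E.
have mh : measurable_fun setT h.
  by apply: emeasurable_funM; [apply: (measurableT_comp mg)|apply: (measurableT_comp mF)].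
have h0 z : (0 <= h z)%E by rewrite mule_ge0.
transitivity (\int[P]_w (h \o xx) w)%E; first by rewrite xxE.
rewrite -x0E -x'E -ge0_integral_distribution //.
rewrite -[X in (X * _)%E]ge0_integral_distribution //.
rewrite -[X in (_ * X)%E]ge0_integral_distribution //.
rewrite (@eq_measure_integral _ _ _ _ (distribution P x0 \x distribution P x')%E); last first.
  move=> A mA _; apply/esym; apply: product_measure_unique => // B C mB mC.
  rewrite /= /distribution /pushforward x0E x'E xxE /=.
  have mB0 : measurable (X ord0 @^-1` B) by rewrite -[_ @^-1` _]setTI; exact: mX.
  have pB : (0 <= fine (P (X ord0 @^-1` B))) by rewrite fine_ge0.
  (* For a fixed [B], both sides are finite measures in [C], so they need only be compared on
     boxes. *)
  pose m1 := measure_function_pushforward__canonical__measure_function_Measure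
    (mrestr P mB0) mX'.
  have pBE : ((NngNum pB)%:num)%:E = P (X ord0 @^-1` B).
    by rewrite /= fineK // fin_num_measure.
  have m12 : m1 C = mscale (NngNum pB) (distribution P x') C.
    apply: tuple_measure_unique => // [|D mD].
      by rewrite /= /pushforward /mrestr preimage_setT setTI -ge0_fin_numE // fin_num_measure.
    rewrite /= /mscale /= /distribution /pushforward /mrestr x'E pBE.
    (* [D' Z] is the box for the whole family with side [Z] at the head and sides [D] on the tail;
       it is used with [Z = B] and with [Z = setT]. *)
    pose D' Z i := if unlift ord0 i is Some j then D j else Z.
    have mD' Z : measurable Z -> forall i, measurable (D' Z i).
      by move=> mZ i; rewrite /D'; case: unliftP.
    have pre Z : random_tuple X' @^-1` [set x | forall i, D i (tnth x i)] `&` X ord0 @^-1` Z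
        = [set w | forall i, D' Z i (X i w)].
      apply/seteqP; split => w /=.
        move=> [hD Zw] i; rewrite /D'; case: unliftP => [j ->|-> //].
        by have := hD j; rewrite tnth_mktuple.
      move=> hD; split => [i|]; last by have := hD ord0; rewrite /D' unlift_none.
      by rewrite tnth_mktuple; have := hD (lift ord0 i); rewrite /D' liftK.
    rewrite pre -[X in (_ * P X)%E]setIT -(preimage_setT (X ord0)) pre.
    rewrite iX ?iX; [|exact: mD'|exact: mD'].
    rewrite !big_ord_recl /D' !unlift_none preimage_setT probability_setT mul1e.
    by congr (_ * _)%E; apply: eq_bigr => i _; rewrite !liftK.
  have -> : (fun w => (X ord0 w, random_tuple X' w)) @^-1` (B `*` C) =
    random_tuple X' @^-1` C `&` X ord0 @^-1` B by rewrite setIC.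
  by move: m12; rewrite /mscale /m1 /= /pushforward /mrestr pBE /distribution x'E.
rewrite fubini_tonelli1 // /fubini_F /h /=.
rewrite -ge0_integralZr //; last by apply: integral_ge0.
by apply: eq_integral => x _; rewrite ge0_integralZl.
Qed.

End IndepLaw.

(** * Riemann sums and regular paths *)

Section RiemannSums.
Context {R : realType}.
Local Notation mu := (@lebesgue_measure R).
Implicit Types f : R -> R.

Lemma nonincreasing_integrable f (i : interval R) (a b : R) :
  {homo f : x y /~ x <= y} -> [set` i] `<=` `[a, b] ->
  mu.-integrable [set` i] (EFin \o f).
Proof.
move=> fd iab; apply: measurable_bounded_integrable => //.
- apply: (@le_lt_trans _ _ (mu `[a, b]%classic)).
    by apply: le_measure => //; rewrite inE.
  by rewrite lebesgue_measure_itv; case: ifP => _; rewrite ?ltry.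
- by apply: nonincreasing_measurable => // x y; exact: fd.
- exists (Num.max `|f a| `|f b|); split; first exact: num_real.
  move=> M ltM x /= /iab /=; rewrite in_itv /= => /andP[ax xb].
  apply: le_trans (ltW ltM).
  have fba : f b <= f x <= f a by rewrite !fd.
  rewrite le_max; have := ler_norm (f a); have := ler_norm (- f b); rewrite normrN.
  move=> fbn fan; apply/orP; have [fx|/ltW fx] := leP 0 (f x); [left|right].
    by rewrite ger0_norm //; lra.
  by rewrite ler0_norm //; lra.
Qed.

Definition left_sum f (a dx : R) (n : nat) : R := dx * \sum_(i < n) f (a + i%:R * dx).

(** On each cell a nonincreasing function lies between its endpoint values, and the gaps between the
    two cell bounds telescope. *)
Lemma Rintegral_left_sum f (a dx : R) (n : nat) : 0 <= dx ->
  {homo f : x y /~ x <= y} ->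
  left_sum f a dx n - dx * (f a - f (a + n%:R * dx)) <=
    Rintegral mu `[a, a + n%:R * dx] f <= left_sum f a dx n.
Proof.
move=> dx0 fd; elim: n => [|n /andP[IH1 IH2]].
  by rewrite /left_sum big_ord0 mul0r addr0 set_itv1 Rintegral_set1; apply/andP; split; lra.
have nS : (a + n.+1%:R * dx) = a + n%:R * dx + dx by rewrite -natr1; ring.
have an : a <= a + n%:R * dx by rewrite lerDl mulr_ge0.
have intS : mu.-integrable `[a, a + n.+1%:R * dx] (EFin \o f).
  exact: nonincreasing_integrable fd (@subset_refl _ _).
have := @Rintegral_itvB R f _ _ (a + n%:R * dx) intS.
rewrite !bnd_simp nS an lerDl dx0 => /(_ isT isT) /eqP.
rewrite subr_eq => /eqP ->.
rewrite /left_sum big_ord_recr /= mulrDr.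
set b := a + n%:R * dx in IH1 IH2 an *.
have intb : mu.-integrable `]b, b + dx] (EFin \o f).
  by apply: (nonincreasing_integrable (a := b) (b := b + dx)) => //; exact: subset_itv_oc_cc.
have mes : fine (mu `]b, (b + dx)]%classic) = dx.
  rewrite lebesgue_measure_itv /= lte_fin ltrDl; case: ltP => [_|]; last by move=> /= ?; lra.
  by rewrite /= addrAC subrr add0r.
have cstP c : Rintegral mu `]b, b + dx] (fun=> c) = c * dx.
  by rewrite Rintegral_cst // mes.
have intc c : mu.-integrable `]b, b + dx] (EFin \o (fun=> c)).
  by apply: (nonincreasing_integrable (a := b) (b := b + dx)) => //; exact: subset_itv_oc_cc.
have h1 : Rintegral mu `]b, b + dx] f <= f b * dx.
  rewrite -cstP; apply: le_Rintegral => // x /=; rewrite in_itv /= => /andP[bx _].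
  by rewrite fd // ltW.
have h2 : f (b + dx) * dx <= Rintegral mu `]b, b + dx] f.
  rewrite -cstP; apply: le_Rintegral => // x /=; rewrite in_itv /= => /andP[_ xb].
  by rewrite fd.
move: h1 h2 IH1 IH2; rewrite /left_sum; clear.
move: (\sum_(i < n) _) (Rintegral _ _ _) (Rintegral _ _ _) (f a) (f b) (f (b + dx)).
by move=> s I J fa fb fc *; apply/andP; split; nra.
Qed.

Lemma left_sum_cvg f (a T : R) : 0 <= T -> {homo f : x y /~ x <= y} ->
  left_sum f a (T / n.+1%:R) n.+1 @[n --> \oo] --> Rintegral mu `[a, a + T] f.
Proof.
move=> T0 fd.
have le n : left_sum f a (T / n.+1%:R) n.+1 - (T / n.+1%:R) * (f a - f (a + T)) <=
    Rintegral mu `[a, a + T] f <= left_sum f a (T / n.+1%:R) n.+1.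
  have := @Rintegral_left_sum f a (T / n.+1%:R) n.+1.
  by rewrite (mulrC n.+1%:R) divfK ?pnatr_eq0 //; apply=> //; rewrite divr_ge0.
apply: (@squeeze_cvgr _ _ _ _ (fun=> Rintegral mu `[a, a + T] f)
  (fun n => Rintegral mu `[a, a + T] f + T * (f a - f (a + T)) * n.+1%:R^-1)).
- by near=> n; have /andP[] := le n; rewrite lerBlDr (mulrAC T) => -> ->.
- exact: cvg_cst.
- rewrite -[X in _ --> X]addr0; apply: cvgD; first exact: cvg_cst.
  rewrite -[X in _ --> X](mulr0 (T * (f a - f (a + T)))); apply: cvgM; first exact: cvg_cst.
  exact: cvg_harmonic.
Unshelve. all: by end_near. Qed.

(** By monotonicity both integrals are limits of left sums, and these are the same sums. *)
Lemma Rintegral_shift f (a T : R) : 0 <= T -> {homo f : x y /~ x <= y} ->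
  Rintegral mu `[a, a + T] f = Rintegral mu `[0, T] (fun x => f (a + x)).
Proof.
move=> T0 fd; rewrite -(cvg_lim (@Rhausdorff R) (left_sum_cvg (a := a) T0 fd)).
apply: (cvg_lim (@Rhausdorff R)).
have gd : {homo (fun x => f (a + x)) : x y /~ x <= y} by move=> x y xy; rewrite fd // lerD2l.
have := left_sum_cvg (a := 0) T0 gd; rewrite add0r.
rewrite (_ : (fun n => _) = (fun n => left_sum f a (T / n.+1%:R) n.+1)) //.
by apply/funext => n; rewrite /left_sum; congr (_ * _); under eq_bigr do rewrite add0r.
Qed.

End RiemannSums.

Section Regularization.
Context {R : realType} {d : measure_display} {Om : measurableType d}.
Local Notation TR := (measurableTypeR R).
Variable P : probability Om R.
Implicit Types xi : R -> Om -> R.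

(* Negative times are included so that every path is monotone on the whole
   line; the version constructed in [regularize] is 0 there. *)
Record regular_subordinator xi : Prop := RegularSubordinator {
  rs_measurable : forall s, measurable_fun [set: Om] (xi s : Om -> TR);
  rs_at0 : forall w, xi 0 w = 0;
  rs_mono : forall w, {homo xi^~ w : s t / s <= t};
  rs_right_cvg : forall w, xi r w @[r --> 0^'+] --> (0 : R);
  rs_independent : independent_increments P xi;
  rs_stationary : stationary_increments P xi }.

Lemma eq_probability_off_null (N A B : set Om) :
  measurable N -> measurable A -> measurable B -> P N = 0%E ->
  (forall w, ~ N w -> A w <-> B w) -> P A = P B.
Proof.
move=> mN mA mB PN0 AB.
have PD C : measurable C -> P C = P (C `\` N).
  move=> mC; have CN : P (C `&` N) = 0%E.
    apply/eqP; rewrite eq_le measure_ge0 andbT -[X in (_ <= X)%E]PN0.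
    by apply: le_measure; rewrite ?inE //; exact: measurableI.
  rewrite measureD //; last by rewrite -ge0_fin_numE ?fin_num_measure.
  by rewrite [X in (_ - X)%E](_ : _ = 0%E) ?sube0.
rewrite PD // (PD B) //; congr (P _); apply/seteqP.
by split=> w /= [Cw Nw]; split=> //; apply/(AB w Nw).
Qed.

(** Paths that fail the almost sure properties are replaced by 0, and so are all values at negative
    times. The laws of increments are unaffected because the two processes agree off [N]. *)
Lemma regularize xi : subordinator P xi -> exists (xi' : R -> Om -> R) (N : set Om),
  [/\ regular_subordinator xi', measurable N, P N = 0%E &
      forall w, ~ N w -> forall s, 0 <= s -> xi' s w = xi s w].
Proof.
move=> [mxi [N [mN PN0 sN]] ind stat].
(* The exceptional set comes inside a measurable null set [N], so the modification is measurable
   without completing [P]. *)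
pose xi' s w := (if s < 0 then 0 else xi s w) * \1_(~` N) w.
exists xi', N; split=> //; last first.
  move=> w Nw s s0; rewrite /xi' ltNge s0 /= indicE mem_set ?mulr1 //.
have xiE w s : ~ N w -> 0 <= s -> xi' s w = xi s w.
  by move=> Nw s0; rewrite /xi' ltNge s0 /= indicE mem_set ?mulr1.
have xi'N w s : N w -> xi' s w = 0.
  by move=> Nw; rewrite /xi' indicE memNset ?mulr0 // => /(_ Nw).
have good w : ~ N w -> [/\ xi 0 w = 0,
            forall s s', 0 <= s -> s <= s' -> xi s w <= xi s' w &
            forall s, 0 <= s -> xi r w @[r --> s^'+] --> xi s w].
  by move=> Nw; apply: contrapT => h; apply: Nw; exact: sN.
have mxi' s : measurable_fun [set: Om] (xi' s : Om -> TR).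
  apply: measurable_funM; last by apply: measurable_indic; exact: measurableC.
  by case: ltP => // s0; exact: mxi.
have mB (f : Om -> TR) B : measurable_fun setT f -> measurable B -> measurable [set w | B (f w)].
  by move=> mf mB; rewrite -[X in measurable X]setTI; exact: mf.
have mBB (f g : Om -> TR) (B : set TR) : measurable_fun setT f -> measurable_fun setT g ->
    measurable B -> measurable [set w | B (f w - g w)].
  by move=> mf mg; move=> mBm; apply: (mB (fun w => f w - g w)) => //; exact: measurable_funB.
split=> //.
- move=> w; have [Nw|Nw] := pselect (N w); first exact: xi'N.
  by rewrite xiE //; case: (good w Nw).
- move=> w s t st; have [Nw|Nw] := pselect (N w); first by rewrite !xi'N.
  have [xi0 mono _] := good w Nw.
  have [s0|s0] := leP 0 s; first by rewrite !xiE //; [exact: mono|exact: le_trans st].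
  rewrite [X in X <= _](_ : _ = 0); last by rewrite /xi' s0 mul0r.
  have [t0|t0] := leP 0 t; last by rewrite /xi' t0 mul0r.
  by rewrite xiE // -xi0 mono.
- move=> w; have [Nw|Nw] := pselect (N w).
    rewrite (_ : xi'^~ w = cst 0); first exact: cvg_cst.
    by apply/funext => s; exact: xi'N.
  have [xi0 _ rc] := good w Nw; rewrite -[X in _ --> X]xi0.
  apply: cvg_trans (rc 0 (lexx _)); apply: near_eq_cvg; near=> r.
  by rewrite xiE //; near: r; exact: nbhs_right_ge.
- move=> n t B t0 tS mBi.
  have tge i : 0 <= t i by elim: i => // i IH; exact: le_trans (tS i).
  have E i : P [set w | B i (xi' (t i.+1) w - xi' (t i) w)] =
             P [set w | B i (xi (t i.+1) w - xi (t i) w)].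
    apply: (eq_probability_off_null mN) => //.
    + by apply: mBB.
    + by apply: mBB => //; exact: mxi.
    + by move=> w Nw /=; rewrite !xiE.
  transitivity (P (\bigcap_(i in `I_n) [set w | B i (xi (t i.+1) w - xi (t i) w)])).
    apply: (eq_probability_off_null mN) => //.
    + by apply: bigcap_measurableType => // i _; apply: mBB.
    + by apply: bigcap_measurableType => // i _; apply: mBB => //; exact: mxi.
    + by move=> w Nw; split=> h i In; have := h i In; rewrite /= !xiE.
  by rewrite ind //; apply: eq_bigr => i _; rewrite E.
- move=> s h B s0 h0 mBs.
  transitivity (P [set w | B (xi (s + h) w - xi s w)]).
    apply: (eq_probability_off_null mN) => //.
    + by apply: mBB.
    + by apply: mBB => //; apply: mxi => //; rewrite addr_ge0.
    + by move=> w Nw /=; rewrite !xiE // addr_ge0.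
  rewrite stat //; apply: (eq_probability_off_null mN) => //.
  + by apply: mB => //; exact: mxi.
  + exact: mB.
  + by move=> w Nw /=; rewrite xiE.
Unshelve. all: by end_near. Qed.

End Regularization.

Section IntegralLimits.
Context {R : realType} {d : measure_display} {Om : measurableType d}.
Variable mu : {measure set Om -> \bar R}.

(** Fatou's lemma bounds the lower limit, and [f_ n <= f] the upper one. The integral of [f] may be
    infinite, a case out of reach of dominated convergence. *)
Lemma cvg_integral_below (f_ : nat -> Om -> \bar R) (f : Om -> \bar R) :
  (forall n, measurable_fun [set: Om] (f_ n)) -> measurable_fun [set: Om] f ->
  (forall n w, 0 <= f_ n w <= f w)%E ->
  (forall w, f_ n w @[n --> \oo] --> f w) ->
  (\int[mu]_w f_ n w)%E @[n --> \oo] --> (\int[mu]_w f w)%E.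
Proof.
move=> mf_ mf f_f f_cvg.
have f_ge0 n w : (0 <= f_ n w)%E by case/andP: (f_f n w).
have f_lef n w : (f_ n w <= f w)%E by case/andP: (f_f n w).
have lef n : (\int[mu]_w f_ n w <= \int[mu]_w f w)%E by apply: ge0_le_integral.
have := @fatou _ _ _ mu _ measurableT _ mf_ (fun n w _ => f_ge0 n w).
have -> : (\int[mu]_x limn_einf (f_^~ x) = \int[mu]_x f x)%E.
  apply: eq_integral => x _; rewrite is_cvg_limn_einfE; last exact: cvgP (f_cvg x).
  exact: cvg_lim (f_cvg x).
move=> fle; rewrite -(oppeK (\int[mu]_w f w)%E) (_ : (fun n => _) = (-%E \o (-%E \o (fun n => \int[mu]_w f_ n w)))%E).
  apply: cvgeN; apply: limn_esup_le_cvg; first by rewrite limn_esupN leeN2.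
  by move=> n /=; rewrite leeN2.
by apply/funext => n /=; rewrite oppeK.
Qed.

End IntegralLimits.

Lemma eq_cvg_ereal {R : realType} (u v : nat -> \bar R) (a b : \bar R) :
  u @ \oo --> a -> v @ \oo --> b -> u =1 v -> a = b.
Proof.
move=> ua vb /funext uv; move: ua vb; rewrite uv => ua vb.
by rewrite -(cvg_lim _ ua) // -(cvg_lim _ vb).
Qed.

Section NegativePowers.
Context {R : realType}.
Implicit Types x y q : R.

Lemma powRN_le q x y : 0 <= q -> 0 < x -> x <= y -> y `^ (- q) <= x `^ (- q).
Proof.
move=> q0 x0 xy; have y0 := lt_le_trans x0 xy.
rewrite !powRN lef_pV2 ?posrE ?powR_gt0 //.
by rewrite ge0_ler_powR // nnegrE ltW.
Qed.

Lemma powR_cvg (u : nat -> R) q x : 0 < x -> u n @[n --> \oo] --> x ->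
  u n `^ q @[n --> \oo] --> x `^ q.
Proof.
move=> x0 ux; apply: (@cvg_comp _ _ _ u (fun y => y `^ q)); first exact: ux.
have /derivable1_diffP/differentiable_continuous : derivable (fun y : R => y `^ q) x 1.
  by apply: derivable_powR; rewrite in_itv /= andbT.
exact.
Qed.

End NegativePowers.

Section RegularSubordinator.
Context {R : realType} {d : measure_display} {Om : measurableType d}.
Local Notation TR := (measurableTypeR R).
Local Notation mu := (@lebesgue_measure R).
Variables (P : probability Om R) (xi : R -> Om -> R).
Hypothesis rs : regular_subordinator P xi.

Let mxi s : measurable_fun [set: Om] (xi s : Om -> TR).
Proof. exact: rs_measurable rs s. Qed.

Lemma rs_ge0 s w : 0 <= s -> 0 <= xi s w.
Proof. by move=> s0; rewrite -(rs_at0 rs w); exact: (rs_mono rs). Qed.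

Definition increment (t : nat -> R) (n : nat) (i : 'I_n) (w : Om) : TR :=
  xi (t i.+1) w - xi (t i) w.

Lemma measurable_increment (t : nat -> R) (n : nat) (i : 'I_n) :
  measurable_fun [set: Om] (increment t i).
Proof. by apply: (@measurable_funB _ _ R _ (xi (t i.+1)) (xi (t i))); exact: mxi. Qed.

Lemma increment_independent (t : nat -> R) (n : nat) :
  0 <= t 0%N -> (forall i, t i <= t i.+1) ->
  mutually_independent P (fun i : 'I_n => increment t i).
Proof.
move=> t0 tS B mB.
(* [independent_increments] takes sets indexed by all of [nat]; the family is padded with [setT]. *)
pose B' k := if @insub nat (fun k => k < n)%N 'I_n k is Some i then B i else setT.
have B'E (i : 'I_n) : B' i = B i by rewrite /B' valK.
have := rs_independent rs n (B := B') t0 tS.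
have mB' i : measurable (B' i) by rewrite /B'; case: insubP.
move=> /(_ mB').
rewrite (_ : \bigcap_(i in `I_n) _ = [set w | forall i : 'I_n, B i (increment t i w)]).
  by move=> ->; apply: eq_bigr => i _; rewrite B'E.
apply/seteqP; split => w /=.
  by move=> h i; rewrite -B'E; exact: (h i (ltn_ord i)).
by move=> h i /= In; have := h (Ordinal In); rewrite -B'E.
Qed.

Lemma increment_law (t : nat -> R) (n : nat) (i : 'I_n) (B : set TR) :
  0 <= t i -> t i <= t i.+1 -> measurable B ->
  P (increment t i @^-1` B) = P [set w | B (xi (t i.+1 - t i) w)].
Proof.
move=> ti0 tS mB; rewrite -(rs_stationary rs ti0 _ mB) ?subr_ge0 //.
by rewrite /increment subrKC.
Qed.

(** By stationarity the law of the increments depends on the mesh sizes only, not on the starting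
    point of the grid. *)
Lemma increments_eq_integral (s t : nat -> R) (n : nat)
    (F : n.-tuple TR -> \bar R) :
  0 <= s 0%N -> (forall i, s i <= s i.+1) ->
  0 <= t 0%N -> (forall i, t i <= t i.+1) ->
  (forall i, s i.+1 - s i = t i.+1 - t i) ->
  measurable_fun setT F -> (forall x, 0 <= F x)%E ->
  (\int[P]_w F (random_tuple (fun i : 'I_n => increment s i) w) =
   \int[P]_w F (random_tuple (fun i : 'I_n => increment t i) w))%E.
Proof.
move=> s0 sS t0 tS st mF F0.
have ge0 (u : nat -> R) : 0 <= u 0%N -> (forall i, u i <= u i.+1) -> forall i, 0 <= u i.
  by move=> u0 uS; elim=> // i; move/le_trans; apply.
apply: (@independent_eq_integral _ _ _ P) => //.
- by move=> i; exact: measurable_increment.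
- by move=> i; exact: measurable_increment.
- exact: increment_independent.
- exact: increment_independent.
- by move=> i B mB; rewrite !increment_law ?st //; exact: ge0.
Qed.

(* The left Riemann sum of exp(- xi) with step dx, as a function of the
   increments. *)
Definition exp_sum (dx : R) (n : nat) (x : n.-tuple TR) : R :=
  dx * \sum_(i < n) expR (- \sum_(k < n | (k < i)%N) (tnth x k : R)).

Lemma measurable_exp_sum (dx : R) (n : nat) :
  measurable_fun setT (@exp_sum dx n : n.-tuple TR -> TR).
Proof.
apply: measurable_funM => //; apply: measurable_sum => i.
apply: measurableT_comp => //; apply: measurableT_comp => //.
rewrite (_ : (fun x : n.-tuple TR => \sum_(k < n | (k < i)%N) (tnth x k : R)) =
   (fun x => \sum_(k < n) if (k < i)%N then (tnth x k : R) else 0)).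
  have mk (k : 'I_n) : measurable_fun setT
      (fun x : n.-tuple TR => if (k < i)%N then (tnth x k : R) else 0).
    by case: (k < i)%N => //; exact: measurable_tnth.
  exact: measurable_sum.
by apply/funext => x; rewrite big_mkcond.
Qed.

Lemma exp_sumE (dx : R) (t : nat -> R) (n : nat) (w : Om) :
  exp_sum dx (random_tuple (fun i : 'I_n => increment t i) w) =
  dx * \sum_(i < n) expR (- (xi (t i) w - xi (t 0%N) w)).
Proof.
congr (_ * _); apply: eq_bigr => i _; congr (expR (- _)).
under eq_bigr do rewrite tnth_mktuple /increment.
rewrite -(big_mkord (fun k => (k < i)%N) (fun k => xi (t k.+1) w - xi (t k) w)).
by rewrite -(@big_nat_widen _ _ _ 0 i n xpredT) ?telescope_sumr // ltnW.
Qed.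

End RegularSubordinator.

(** * The exponential functional of a monotone path *)

Section MonotonePaths.
Context {R : realType} {d : measure_display} {Om : measurableType d}.
Local Notation mu := (@lebesgue_measure R).
(** [zeta] stands both for [xi] and for the process restarted at a time h. *)
Variable zeta : R -> Om -> R.
Hypothesis zeta0 : forall w, zeta 0 w = 0.
Hypothesis zeta_mono : forall w, {homo zeta^~ w : s t / s <= t}.

Local Notation path w := (fun s => expR (- zeta s w)).

Lemma exp_path_nonincreasing w : {homo path w : x y /~ x <= y}.
Proof. by move=> x y xy /=; rewrite ler_expR lerN2 zeta_mono. Qed.

Lemma expfun_bounds (t : R) (w : Om) : 0 <= t ->
  t * expR (- zeta t w) <= expfun zeta t w <= t.
Proof.
move=> t0; have := @Rintegral_left_sum R _ 0 t 1 t0 (@exp_path_nonincreasing w).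
rewrite /left_sum big_ord1 !add0r !mul0r !mul1r zeta0 oppr0 expR0 mulr1 /expfun.
by rewrite mulrBr mulr1 subKr.
Qed.

Lemma expfun_ge0 (t : R) (w : Om) : 0 <= t -> 0 <= expfun zeta t w.
Proof.
by move=> t0; case/andP: (@expfun_bounds t w t0) => + _; apply: le_trans; rewrite mulr_ge0 ?expR_ge0.
Qed.

Lemma expfun_gt0 (t : R) (w : Om) : 0 < t -> 0 < expfun zeta t w.
Proof.
move=> t0; case/andP: (@expfun_bounds t w (ltW t0)) => + _; apply: lt_le_trans.
by rewrite mulr_gt0 ?expR_gt0.
Qed.

Lemma expfunD (h t : R) (w : Om) : 0 <= h -> 0 <= t ->
  expfun zeta (h + t) w = expfun zeta h w +
  expR (- zeta h w) * expfun (fun s w => zeta (h + s) w - zeta h w) t w.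
Proof.
move=> h0 t0; have dec := @exp_path_nonincreasing w.
have int (a b : R) : mu.-integrable `[a, b] (EFin \o path w).
  exact: nonincreasing_integrable (@subset_refl _ _).
have := @Rintegral_itvB R (path w) (BLeft 0) (BRight (h + t)) h (int _ _).
rewrite !bnd_simp h0 lerDl t0 => /(_ isT isT) /eqP.
rewrite subr_eq => /eqP; rewrite /expfun => ->; rewrite addrC; congr (_ + _).
have intd (T : R) : mu.-integrable `[0, T] (EFin \o (fun s => expR (- (zeta (h + s) w - zeta h w)))).
  apply: nonincreasing_integrable (@subset_refl _ _) => x y xy.
  by rewrite ler_expR lerN2 lerD2r zeta_mono // lerD2l.
rewrite -RintegralZl // Rintegral_itv_obnd_cbnd; last first.
  by apply: (nonincreasing_integrable (a := h) (b := h + t)) => //; exact: subset_itv_oc_cc.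
rewrite Rintegral_shift //; apply: eq_Rintegral => s _.
by rewrite -expRD; congr expR; ring.
Qed.

Lemma expfun_le (s t : R) (w : Om) : 0 <= s -> s <= t ->
  expfun zeta s w <= expfun zeta t w.
Proof.
move=> s0 st; rewrite -(subrKC s t) expfunD ?subr_ge0 // lerDl mulr_ge0 ?expR_ge0 //.
by apply: Rintegral_ge0 => x _; rewrite expR_ge0.
Qed.

Definition expfun_sum (t : R) (n : nat) (w : Om) : R :=
  left_sum (path w) 0 (t / n.+1%:R) n.+1.

Lemma expfun_sum_cvg (t : R) (w : Om) : 0 <= t ->
  expfun_sum t n w @[n --> \oo] --> expfun zeta t w.
Proof.
move=> t0; rewrite /expfun -[X in `[_, X]]add0r.
exact: left_sum_cvg (@exp_path_nonincreasing w).
Qed.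

Lemma le_expfun_sum (t : R) (n : nat) (w : Om) : 0 <= t ->
  expfun zeta t w <= expfun_sum t n w.
Proof.
move=> t0; have tn : 0 <= t / n.+1%:R by rewrite divr_ge0.
have /andP[_] := Rintegral_left_sum 0 n.+1 tn (@exp_path_nonincreasing w).
by rewrite add0r (mulrC n.+1%:R) divfK ?pnatr_eq0.
Qed.

Hypothesis zeta_meas : forall s, measurable_fun [set: Om] (zeta s).

Lemma measurable_expfun_sum (t : R) (n : nat) :
  measurable_fun [set: Om] (expfun_sum t n).
Proof.
apply: measurable_funM => //; apply: measurable_sum => i.
by apply: measurableT_comp => //; apply: measurableT_comp.
Qed.

Lemma measurable_expfun (t : R) : 0 <= t ->
  measurable_fun [set: Om] (expfun zeta t).
Proof.
move=> t0; apply: (@measurable_fun_cvg _ _ _ _ (expfun_sum t)).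
  by move=> n; exact: measurable_expfun_sum.
by move=> w _; exact: expfun_sum_cvg.
Qed.

Lemma measurable_mul_powR (g f : Om -> R) (q : R) :
  measurable_fun setT g -> measurable_fun setT f ->
  measurable_fun setT (fun w => (g w * f w `^ q)%:E).
Proof.
move=> mg mf; apply/measurable_EFinP; apply: measurable_funM => //.
exact: (measurableT_comp (measurable_powR _)).
Qed.

(** Left sums overestimate the functional, so their negative powers stay below the limit and
    [cvg_integral_below] applies even if the limit is not integrable. *)
Lemma expfun_sum_powRN_cvg (mu : {measure set Om -> \bar R}) (g : Om -> R) (t q : R) :
  0 < t -> 0 <= q -> measurable_fun setT g -> (forall w, 0 <= g w) ->
  (\int[mu]_w (g w * expfun_sum t n w `^ (- q))%:E)%E @[n --> \oo] -->
  (\int[mu]_w (g w * expfun zeta t w `^ (- q))%:E)%E.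
Proof.
move=> t0 q0 mg g0; have I0 w := @expfun_gt0 t w t0.
apply: cvg_integral_below.
- by move=> n; apply: measurable_mul_powR => //; exact: measurable_expfun_sum.
- by apply: measurable_mul_powR => //; apply: measurable_expfun; exact: ltW.
- move=> n w; rewrite !lee_fin mulr_ge0 ?powR_ge0 //= ler_wpM2l //.
  by rewrite powRN_le // le_expfun_sum // ltW.
- move=> w; apply: cvg_EFin; first exact: nearW.
  apply: cvgM; first exact: cvg_cst.
  by apply: powR_cvg => //; apply: expfun_sum_cvg; exact: ltW.
Qed.

End MonotonePaths.

(** * Splitting off the increment up to time h *)

Section Factorization.
Context {R : realType} {d : measure_display} {Om : measurableType d}.
Local Notation TR := (measurableTypeR R).
Variables (P : probability Om R) (xi : R -> Om -> R).
Hypothesis rs : regular_subordinator P xi.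

Definition shifted (h s : R) (w : Om) : R := xi (h + s) w - xi h w.

Lemma shifted_mono h w : {homo (shifted h)^~ w : s t / s <= t}.
Proof. by move=> s t st; rewrite lerD2r (rs_mono rs) // lerD2l. Qed.

Lemma shifted0 h w : shifted h 0 w = 0.
Proof. by rewrite /shifted addr0 subrr. Qed.

Lemma measurable_shifted h s : measurable_fun setT (shifted h s).
Proof. by apply: (@measurable_funB _ _ R _ (xi (h + s)) (xi h)); exact: (rs_measurable rs). Qed.

Lemma expfun_shiftedD (h t : R) (w : Om) : 0 <= h -> 0 <= t ->
  expfun xi (h + t) w = expfun xi h w + expR (- xi h w) * expfun (shifted h) t w.
Proof. exact: expfunD (rs_mono rs) _ _ _. Qed.

(** The left sum of the restarted process is a function of the increments after h, which are
    independent of [xi h] and distributed as those after 0. The factorization thus holds for every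
    left sum and passes to the limit; finiteness of E[g(xi_h)] makes multiplication by it continuous
    in [\bar R]. *)
Lemma integral_split_powRN (h t q : R) (g : R -> R) :
  0 <= h -> 0 < t -> 0 <= q -> measurable_fun [set: TR] (g : TR -> TR) ->
  (forall x, 0 <= g x) -> (\int[P]_w (g (xi h w))%:E < +oo)%E ->
  (\int[P]_w (g (xi h w) * expfun (shifted h) t w `^ (- q))%:E =
   \int[P]_w (g (xi h w))%:E * \int[P]_w (expfun xi t w `^ (- q))%:E)%E.
Proof.
move=> h0 t0 q0 mg g0 goo.
have mgx : measurable_fun setT (g \o xi h).
  by apply: (measurableT_comp mg); exact: (rs_measurable rs).
have L := expfun_sum_powRN_cvg (mu := P) (shifted0 h) (@shifted_mono h) (measurable_shifted h)
  t0 q0 mgx (fun w => g0 _).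
have Rt := expfun_sum_powRN_cvg (mu := P) (rs_at0 rs) (rs_mono rs) (rs_measurable rs)
  t0 q0 (@measurable_cst _ _ _ _ _ (1 : R)) (fun w => ler01).
have {Rt} := cvgeZl (y := (\int[P]_w (g (xi h w))%:E)%E) _ Rt.
rewrite ge0_fin_numE; last by apply: integral_ge0 => w _; rewrite lee_fin.
move=> /(_ goo) Rt.
have E1 (f : Om -> R) : (\int[P]_w (cst 1 w * f w)%:E = \int[P]_w (f w)%:E)%E.
  by apply: eq_integral => w _; rewrite mul1r.
rewrite -(E1 (fun w => expfun xi t w `^ (- q))).
apply: (eq_cvg_ereal L Rt) => n; rewrite E1.
(* The grid 0, h, h + dt, h + 2 dt, ..., whose first increment is [xi h]. *)
pose tt k := if k is k'.+1 then h + k'%:R * (t / n.+1%:R) else 0.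
pose ss k := k%:R * (t / n.+1%:R).
have dt0 : 0 <= t / n.+1%:R by rewrite divr_ge0 // ltW.
have ssS i : ss i <= ss i.+1 by rewrite /ss ler_wpM2r // ler_nat.
have tt1 : 0 <= tt 1%N by rewrite /tt mul0r addr0.
have ss0 : 0 <= ss 0%N by rewrite /ss mul0r.
have ttss i : tt i.+2 - tt i.+1 = ss i.+1 - ss i by rewrite /tt /ss -natr1; ring.
have ttS i : tt i <= tt i.+1.
  by case: i => [|i] /=; rewrite ?mul0r ?addr0 // lerD2l ler_wpM2r // ler_nat.
have [F FE] : exists F : n.+1.-tuple TR -> \bar R,
    F = (fun x => ((exp_sum (t / n.+1%:R) x) `^ (- q))%:E) by eexists.
have mF : measurable_fun setT F.
  rewrite FE.
  apply/measurable_EFinP; apply: (measurableT_comp (measurable_powR _)).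
  exact: measurable_exp_sum.
have F0 x : (0 <= F x)%E by rewrite FE lee_fin powR_ge0.
have tt0 : 0 <= tt 0%N by [].
have mgE : measurable_fun [set: TR] (fun x => (g x)%:E) by apply/measurable_EFinP.
have spl := @independent_split _ _ _ P n.+1 (fun i => increment xi tt i) (fun x => (g x)%:E) F
  (measurable_increment rs tt (n:=_)) (increment_independent rs tt0 ttS)
  mgE (fun x => g0 x) mF F0.
have inc0 w : increment xi tt (@ord0 n.+1) w = xi h w.
  by rewrite /increment /= mul0r addr0 (rs_at0 rs) subr0.
have incS w : random_tuple (fun i : 'I_n.+1 => increment xi tt (lift ord0 i)) w =
    random_tuple (fun i : 'I_n.+1 => increment xi (fun k => tt k.+1) i) w.
  by apply: eq_from_tnth => i; rewrite !tnth_mktuple.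
have incE := @increments_eq_integral _ _ _ P xi rs (fun k => tt k.+1) ss n.+1 F.
transitivity (\int[P]_w ((g (xi h w))%:E *
    F (random_tuple (fun i : 'I_n.+1 => increment xi (fun k => tt k.+1) i) w)))%E.
  apply: eq_integral => w _; rewrite FE exp_sumE -EFinM /= mul0r addr0.
  congr ((_ * _ `^ _)%:E); rewrite /expfun_sum /left_sum; congr (_ * _).
  by apply: eq_bigr => i _; rewrite add0r.
transitivity (\int[P]_w (g (xi h w))%:E *
    \int[P]_w F (random_tuple (fun i : 'I_n.+1 => increment xi (fun k => tt k.+1) i) w))%E.
  move: spl; under eq_integral do rewrite inc0 incS.
  move=> ->; congr (_ * _)%E; first by apply: eq_integral => w _; rewrite inc0.
rewrite {}incE; [|exact: tt1|by move=> i; exact: ttS|exact: ss0|exact: ssS|exact: ttss|exact: mF|exact: F0].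
have ssE w : F (random_tuple (fun i : 'I_n.+1 => increment xi ss i) w) =
    (expfun_sum xi t n w `^ (- q))%:E.
  rewrite FE exp_sumE /ss mul0r (rs_at0 rs) /expfun_sum /left_sum.
  by under eq_bigr do rewrite subr0 -[_ * _]add0r.
have intE : (\int[P]_w F (random_tuple (fun i : 'I_n.+1 => increment xi ss i) w) =
    \int[P]_w (expfun_sum xi t n w `^ (- q))%:E)%E.
  by apply: eq_integral => w _; exact: ssE.
rewrite intE; exact: erefl.
Qed.

End Factorization.

(** * Exponential moments as functions of time *)

Section ExponentialMoments.
Context {R : realType} {d : measure_display} {Om : measurableType d}.
Local Notation TR := (measurableTypeR R).
Variables (P : probability Om R) (xi : R -> Om -> R).
Hypothesis rs : regular_subordinator P xi.

Definition exp_moment (u t : R) : \bar R := (\int[P]_w (expR (u * xi t w))%:E)%E.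

Lemma measurable_exp_moment (u t : R) :
  measurable_fun setT (fun w => (expR (u * xi t w))%:E).
Proof.
apply/measurable_EFinP; apply: measurableT_comp => //.
by apply: measurable_funM => //; exact: (rs_measurable rs).
Qed.

Lemma exp_moment_ge0 u t : (0 <= exp_moment u t)%E.
Proof. by apply: integral_ge0 => w _; rewrite lee_fin expR_ge0. Qed.

Lemma exp_momentD u s t : 0 <= s -> 0 <= t ->
  exp_moment u (s + t) = (exp_moment u s * exp_moment u t)%E.
Proof.
move=> s0 t0.
pose tt k := if k is k'.+1 then s + k'%:R * t else 0.
pose ss k := k%:R * t.
have ssS i : ss i <= ss i.+1 by rewrite /ss ler_wpM2r // ler_nat.
have ss0 : 0 <= ss 0%N by rewrite /ss mul0r.
have ttss i : tt i.+2 - tt i.+1 = ss i.+1 - ss i by rewrite /tt /ss -natr1; ring.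
have ttS i : tt i <= tt i.+1.
  by case: i => [|i] /=; rewrite ?mul0r ?addr0 // lerD2l ler_wpM2r // ler_nat.
have tt0 : 0 <= tt 0%N by [].
have tt1 : 0 <= tt 1%N by rewrite /tt mul0r addr0.
have [g gE] : exists g : TR -> \bar R, g = (fun x => (expR (u * x))%:E) by eexists.
have mg : measurable_fun setT g.
  by rewrite gE; apply/measurable_EFinP; apply: measurableT_comp => //; exact: measurable_funM.
have g0 x : (0 <= g x)%E by rewrite gE lee_fin expR_ge0.
pose F (x : 1.-tuple TR) := g (tnth x ord0).
have mF : measurable_fun setT F by apply: (measurableT_comp mg); exact: measurable_tnth.
have F0 x : (0 <= F x)%E by exact: g0.
have spl := @independent_split _ _ _ P 1 (fun i => increment xi tt i) g F
  (measurable_increment rs tt (n:=_)) (increment_independent rs tt0 ttS) mg g0 mF F0.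
have incE := @increments_eq_integral _ _ _ P xi rs (fun k => tt k.+1) ss 1 F
  tt1 (fun i => ttS i.+1) ss0 ssS ttss mF F0.
have E0 w : increment xi tt (@ord0 1) w = xi s w.
  by rewrite /increment /= mul0r addr0 (rs_at0 rs) subr0.
have E1 w : F (random_tuple (fun i : 'I_1 => increment xi (fun k => tt k.+1) i) w) =
    g (xi (s + t) w - xi s w).
  by rewrite /F tnth_mktuple /increment /= mul1r mul0r addr0.
have E1' w : F (random_tuple (fun i : 'I_1 => increment xi tt (lift ord0 i)) w) =
    g (xi (s + t) w - xi s w).
  by rewrite /F tnth_mktuple /increment /= mul1r mul0r addr0.
have E2 w : F (random_tuple (fun i : 'I_1 => increment xi ss i) w) = g (xi t w).
  by rewrite /F tnth_mktuple /increment /ss /= mul1r mul0r (rs_at0 rs) subr0.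
transitivity (\int[P]_w (g (xi s w) * g (xi (s + t) w - xi s w)%R))%E.
  by apply: eq_integral => w _; rewrite gE -EFinM -expRD -mulrDr subrKC.
have <- : (\int[P]_w g (xi s w) = exp_moment u s)%E.
  by apply: eq_integral => w _; rewrite gE.
have <- : (\int[P]_w g (xi t w) = exp_moment u t)%E.
  by apply: eq_integral => w _; rewrite gE.
rewrite -(eq_integral _ _ (fun w _ => E2 w)) -incE (eq_integral _ _ (fun w _ => E1 w)).
rewrite -(eq_integral _ _ (fun w _ => E1' w)).
transitivity (\int[P]_w (g (increment xi tt (@ord0 1) w) *
    F (random_tuple (fun i : 'I_1 => increment xi tt (lift ord0 i)) w)))%E.
  by apply: eq_integral => w _; rewrite E1' E0.
by rewrite spl; congr (_ * _)%E; apply: eq_integral => w _; rewrite E0.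
Qed.

Lemma exp_moment0 u : exp_moment u 0 = 1%E.
Proof.
rewrite /exp_moment; under eq_integral do rewrite (rs_at0 rs) mulr0 expR0.
apply: (etrans (@integral_cst _ _ _ P _ measurableT 1)); rewrite mul1e.
exact: probability_setT.
Qed.

Lemma exp_momentMn u t n : 0 <= t -> exp_moment u (n%:R * t) = (exp_moment u t ^+ n)%E.
Proof.
move=> t0; elim: n => [|n IH]; first by rewrite mul0r exp_moment0.
by rewrite -natr1 mulrDl mul1r exp_momentD ?mulr_ge0 // IH expeS muleC.
Qed.

Lemma exp_moment_mono u s t : 0 <= u -> s <= t -> (exp_moment u s <= exp_moment u t)%E.
Proof.
move=> u0 st; apply: ge0_le_integral => //; try exact: measurable_exp_moment.
by move=> w _; rewrite lee_fin ler_expR ler_wpM2l // (rs_mono rs).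
Qed.

Lemma exp_moment_anti u s t : u <= 0 -> s <= t -> (exp_moment u t <= exp_moment u s)%E.
Proof.
move=> u0 st; apply: ge0_le_integral => //; try exact: measurable_exp_moment.
by move=> w _; rewrite lee_fin ler_expR ler_wnM2l // (rs_mono rs).
Qed.

(** For u >= 0, t is at most some integer p, and the moment at p is the p-th power of the moment at
    1; for u < 0 the moment is at most 1. *)
Lemma exp_moment_fin u t : 0 <= t -> (exp_moment u 1 < +oo)%E ->
  exp_moment u t \is a fin_num.
Proof.
move=> t0 u1; rewrite ge0_fin_numE ?exp_moment_ge0 //.
have [u0|u0] := leP 0 u; last first.
  by apply: le_lt_trans (exp_moment_anti (ltW u0) t0) _; rewrite exp_moment0 ltry.
apply: le_lt_trans (exp_moment_mono u0 (ltW (truncnS_gt t))) _.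
rewrite -[X in exp_moment _ X]mulr1 exp_momentMn //.
have : exp_moment u 1 \is a fin_num by rewrite ge0_fin_numE ?exp_moment_ge0.
by move=> fu; rewrite -ge0_fin_numE ?expe_ge0 ?exp_moment_ge0 // fin_numX.
Qed.

Lemma exp_moment_gt0 u t : 0 <= t -> (0 < exp_moment u t)%E.
Proof.
move=> t0; rewrite lt_neqAle exp_moment_ge0 andbT; apply/eqP => /esym E0.
have /(ae_eq_integral_abs P measurableT (measurable_exp_moment u t)) [N [mN PN sN]] :
    (\int[P]_w `|(expR (u * xi t w))%:E| = 0)%E.
  by rewrite -[RHS]E0; apply: eq_integral => w _; rewrite gee0_abs // lee_fin expR_ge0.
have NT : N = setT.
  apply/seteqP; split=> // w _; apply: sN => /= /(_ I) [] /eqP.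
  by rewrite expR_eq0.
have PT : (P setT = 1)%E := probability_setT P.
by move: PN; rewrite NT => P0; move/eqP: PT; rewrite [X in X == _]P0 eq_sym onee_eq0.
Qed.

(** The logarithm of the moment is additive and monotone in t, hence linear. *)
Lemma exp_momentE u t : 0 <= t -> (exp_moment u 1 < +oo)%E ->
  exp_moment u t = (expR (t * ln (fine (exp_moment u 1))))%:E.
Proof.
move=> t0 u1.
have fin s : 0 <= s -> exp_moment u s \is a fin_num by move=> s0; exact: exp_moment_fin.
have pos s : 0 <= s -> 0 < fine (exp_moment u s).
  by move=> s0; rewrite fine_gt0 // exp_moment_gt0 // -ge0_fin_numE ?exp_moment_ge0 // fin.
pose a := ln (fine (exp_moment u 1)).
pose b := ln (fine (exp_moment u t)).
suff <- : b = t * a by rewrite lnK ?posrE ?pos // fineK // fin.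
have lnn s n : 0 <= s -> ln (fine (exp_moment u (n%:R * s))) = n%:R * ln (fine (exp_moment u s)).
  move=> s0; rewrite exp_momentMn // -(fineK (fin s s0)) -EFin_expe /=.
  by rewrite lnXn ?pos // mulr_natl.
(* With p the integer part of n t, both n b and n t a lie within |a| of p a. The resulting bound
   does not grow with n, which forces b = t a. *)
have bound n : `|n%:R * (b - t * a)| <= 2 * `|a|.
  have nt0 : 0 <= n%:R * t by rewrite mulr_ge0.
  have /andP[p1 p2] := truncn_itv nt0; set p := Num.truncn (n%:R * t) in p1 p2.
  have h : `|n%:R * b - p%:R * a| <= `|a|.
    pose L s := ln (fine (exp_moment u s)).
    have Lnt : L (n%:R * t) = n%:R * b by exact: lnn.
    have Ln k : L k%:R = k%:R * a by rewrite -[in LHS](mulr1 k%:R); exact: lnn.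
    have Lle r s : 0 <= r -> 0 <= s -> (exp_moment u r <= exp_moment u s)%E -> L r <= L s.
      by move=> r0 s0 rs_; rewrite ler_ln ?posrE ?pos // fine_le // fin.
    have Sp : p.+1%:R * a = p%:R * a + a by rewrite -natr1 mulrDl mul1r.
    have [u0|/ltW u0] := leP 0 u.
      have m1 := Lle _ _ (ler0n _ p) nt0 (exp_moment_mono u0 p1).
      have m2 := Lle _ _ nt0 (ler0n _ p.+1) (exp_moment_mono u0 (ltW p2)).
      have m0 := Lle _ _ (lexx _) (ler0n _ 1) (exp_moment_mono u0 (@ler01 R)).
      move: m0 m1 m2; rewrite (Ln 0) !Ln Lnt Sp mul0r mul1r => a0 m1 m2.
      by rewrite (ger0_norm a0) ler_norml; apply/andP; split; lra.
    have m1 := Lle _ _ nt0 (ler0n _ p) (exp_moment_anti u0 p1).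
    have m2 := Lle _ _ (ler0n _ p.+1) nt0 (exp_moment_anti u0 (ltW p2)).
    have m0 := Lle _ _ (ler0n _ 1) (lexx _) (exp_moment_anti u0 (@ler01 R)).
    move: m0 m1 m2; rewrite (Ln 0) !Ln Lnt Sp mul0r mul1r => a0 m1 m2.
    by rewrite (ler0_norm a0) ler_norml; apply/andP; split; lra.
  have h2 : `|p%:R * a - n%:R * t * a| <= `|a|.
    rewrite -mulrBl normrM -[leRHS]mul1r ler_wpM2r // ler_norml.
    by move: p1 p2; rewrite -natr1; lra.
  have -> : n%:R * (b - t * a) = (n%:R * b - p%:R * a) + (p%:R * a - n%:R * t * a) by ring.
  by apply: le_trans (ler_normD _ _) _; rewrite (_ : 2 * `|a| = `|a| + `|a|) ?lerD //; ring.
apply/eqP; rewrite -subr_eq0; apply/negPn/negP => /eqP ba.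
have ba0 : 0 < `|b - t * a| by rewrite normr_gt0; apply/eqP.
have := bound (Num.truncn (2 * `|a| / `|b - t * a|)).+1.
rewrite normrM ger0_norm // -ler_pdivlMr // leNgt truncnS_gt.
by [].
Qed.

End ExponentialMoments.

(** * The first inverse moment *)

Section CyclicSums.
Context {R : realType}.

(** Started at index j, the path runs through a_j, ..., a_N and then again through a_0, ..., a_j
    raised by a_N; the second stretch carries the factor e^{-a_N}. *)
Lemma cyclic_exp_sum (a : nat -> R) (N j : nat) : a 0%N = 0 -> (j < N)%N ->
  \sum_(i < N) expR (- \sum_(k < N | (k < i)%N)
     (a ((k + j) %% N).+1 - a ((k + j) %% N)%N)) =
  expR (a j) * (\sum_(i < N) expR (- a i) -
                (1 - expR (- a N)) * \sum_(i < j) expR (- a i)).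
Proof.
move=> a0 jN.
(* [b] continues [a] past N by repeating its increments; the two formulas agree at the junction
   because [a 0 = 0]. *)
pose b m := if (m <= N)%N then a m else a N + a (m - N)%N.
have bS m : (m < N + N)%N -> a (m %% N).+1 - a (m %% N)%N = b m.+1 - b m.
  move=> mN; rewrite /b; have [mN'|Nm] := ltnP m N.
    by rewrite modn_small // ltnW.
  rewrite (_ : (m %% N)%N = (m - N)%N); last first.
    by rewrite -[in LHS](subnK Nm) modnDr modn_small //; lia.
  rewrite subSn //; case: ifP => [mN''|_].
    have -> : m = N by lia.
    by rewrite subnn a0; ring.
  by ring.
have sumE (i : 'I_N) : \sum_(k < N | (k < i)%N) (a ((k + j) %% N).+1 - a ((k + j) %% N)%N) =
    b (i + j)%N - a j.
  have -> : a j = b j by rewrite /b ltnW.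
  rewrite -(big_mkord (fun k => (k < i)%N) (fun k => a ((k + j) %% N).+1 - a ((k + j) %% N)%N)).
  rewrite -(@big_nat_widen _ _ _ 0 i N xpredT) 1?ltnW //.
  rewrite (eq_big_nat _ _ (F2 := fun k => b (k.+1 + j)%N - b (k + j)%N)).
    by rewrite (telescope_sumr (fun k => b (k + j)%N)).
  move=> k /andP[_ ki]; rewrite bS //.
  by have := ltn_ord i; lia.
transitivity (expR (a j) * \sum_(i < N) expR (- b (i + j)%N)).
  by rewrite mulr_sumr; apply: eq_bigr => i _; rewrite sumE -expRD; congr expR; ring.
congr (_ * _).
rewrite -(big_mkord xpredT (fun i => expR (- b (i + j)%N))).
rewrite (big_cat_nat (leq0n (N - j)) (leq_subr j N)) /=.
rewrite -!(big_mkord xpredT (fun i => expR (- a i))).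
rewrite [X in X + _ = _](_ : _ = \sum_(j <= i < N) expR (- a i)); last first.
  rewrite -[in RHS](add0n j) big_addn; apply: eq_big_nat => i /andP[_ iN].
  by rewrite /b; case: ifP => //; lia.
rewrite [X in _ + X = _](_ : _ = expR (- a N) * \sum_(0 <= i < j) expR (- a i)); last first.
  rewrite mulr_sumr -[in LHS](add0n (N - j)%N) big_addn.
  rewrite (_ : (N - (N - j))%N = j); last by lia.
  apply: eq_big_nat => i /andP[_ ij]; rewrite -expRD; congr expR.
  rewrite /b; case: ifP => [iN|_].
    have i0 : i = 0%N by lia.
    by rewrite i0 a0 (_ : (0 + (N - j) + j)%N = N); [ring|lia].
  by rewrite (_ : (i + (N - j) + j - N)%N = i); [ring|lia].
by rewrite (big_cat_nat (leq0n j) (ltnW jN)) /=; ring.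
Qed.

(** Sums the bounds 1 - 1/u <= ln u <= u - 1 at u = y_i / y_{i+1}. Replacing the denominator y_{i+1}
    of the upper bound by y_i costs at most e (1 / y_{i+1} - 1 / y_i), which telescopes. *)
Lemma telescope_ln (y : nat -> R) (n : nat) (e : R) :
  (forall i, (i <= n)%N -> 0 < y i) ->
  (forall i, (i < n)%N -> 0 <= y i - y i.+1 <= e) ->
  \sum_(i < n) (y i - y i.+1) / y i <= ln (y 0%N / y n) <=
    \sum_(i < n) (y i - y i.+1) / y i + e * ((y n)^-1 - (y 0%N)^-1).
Proof.
elim: n => [|n IH] ypos ydec.
  by rewrite big_ord0 divff ?gt_eqF ?ypos // ln1 subrr mulr0 addr0 lexx.
have /andP[] : _ := IH (fun i i_n => ypos i (leqW i_n)) (fun i i_n => ydec i (leqW i_n)).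
rewrite big_ord_recr /=; move: (\sum_(i < n) _) => r IH1 IH2.
have y0 := ypos 0%N isT; have yn := ypos n (leqnSn n); have yn1 := ypos n.+1 (leqnn _).
have /andP[d0 de] := ydec n (ltnSn n).
have lnE : ln (y 0%N / y n.+1) = ln (y 0%N / y n) + ln (y n / y n.+1).
  by rewrite -lnM ?posrE ?divr_gt0 // mulrA divfK // gt_eqF.
have l1 : (y n - y n.+1) / y n <= ln (y n / y n.+1).
  rewrite -[X in _ <= X]opprK -lnV ?posrE ?divr_gt0 // invf_div lerNr.
  have := @le_ln1Dx R (y n.+1 / y n - 1).
  rewrite subrKC ltrBrDl subrr divr_gt0 // => /(_ isT).
  by move/le_trans; apply; rewrite mulrBl divff ?gt_eqF // opprB.
have l2 : ln (y n / y n.+1) <= (y n - y n.+1) / y n.+1.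
  have := @le_ln1Dx R (y n / y n.+1 - 1).
  rewrite subrKC ltrBrDl subrr divr_gt0 // => /(_ isT).
  by move/le_trans; apply; rewrite mulrBl divff ?gt_eqF.
have l3 : (y n - y n.+1) / y n.+1 <= (y n - y n.+1) / y n + e * ((y n.+1)^-1 - (y n)^-1).
  have h : 0 <= (y n.+1)^-1 - (y n)^-1 by rewrite subr_ge0 lef_pV2 ?posrE // -subr_ge0.
  by rewrite -lerBlDl -mulrBr ler_wpM2r.
by rewrite lnE; apply/andP; split; lra.
Qed.

End CyclicSums.

Section CyclicExchange.
Context {R : realType} {d : measure_display} {Om : measurableType d}.
Local Notation TR := (measurableTypeR R).
Local Notation grid dx := (fun k : nat => k%:R * dx)%R.
Variable P : probability Om R.

Lemma mutually_independent_perm (n : nat) (X : 'I_n -> Om -> TR) (s : {perm 'I_n}) :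
  mutually_independent P X -> mutually_independent P (fun i => X (s i)).
Proof.
move=> iX B mB; rewrite (_ : [set w | _] = [set w | forall i, B ((s^-1)%g i) (X i w)]).
  rewrite (iX (fun i => B ((s^-1)%g i))) // (reindex_inj (@perm_inj _ s)) /=.
  by apply: eq_bigr => i _; rewrite permK.
apply/seteqP; split => w /= h i; first by have := h ((s^-1)%g i); rewrite permKV.
by have := h (s i); rewrite permK.
Qed.

Variable xi : R -> Om -> R.
Hypothesis rs : regular_subordinator P xi.

Let t_ge0 (dx : R) (k : nat) : 0 <= dx -> 0 <= k%:R * dx.
Proof. by move=> dx0; rewrite mulr_ge0. Qed.

Let t_leS (dx : R) (k : nat) : 0 <= dx -> k%:R * dx <= k.+1%:R * dx.
Proof. by move=> dx0; rewrite ler_wpM2r // ler_nat. Qed.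

(** Addition in ['I_n.+1] is modulo n + 1, so adding j is a cyclic permutation; equal grid steps
    make the increments identically distributed. *)
Lemma cyclic_exchange (n : nat) (dx : R) (j : 'I_n.+1) (F : n.+1.-tuple TR -> \bar R) :
  0 <= dx -> measurable_fun setT F -> (forall x, 0 <= F x)%E ->
  (\int[P]_w F (random_tuple (fun i : 'I_n.+1 => increment xi (grid dx) (i + j)%R) w) =
   \int[P]_w F (random_tuple (fun i : 'I_n.+1 => increment xi (grid dx) i) w))%E.
Proof.
move=> dx0 mF F0; pose s := perm (@addIr _ j).
have tS k : k%:R * dx <= k.+1%:R * dx by exact: t_leS.
have t0 : 0 <= 0%N%:R * dx by exact: t_ge0.
have ind := @increment_independent _ _ _ P xi rs (fun k => k%:R * dx) n.+1 t0 tS.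
apply: (@independent_eq_integral _ _ _ P) => //.
- by move=> i; exact: (measurable_increment rs).
- by move=> i; exact: (measurable_increment rs).
- have := mutually_independent_perm s ind.
  rewrite (_ : (fun i => _) = (fun i : 'I_n.+1 => increment xi (grid dx) (i + j)%R)) //.
  by apply/funext => i; rewrite permE.
- move=> i B mB; rewrite !(increment_law rs) ?t_ge0 ?t_leS //; congr (P _).
  apply/seteqP; split => w /=; congr (B (xi _ w)); rewrite -!natr1; ring.
Qed.

(* E[1/I_t] is computed by averaging over the cyclic shifts of the increments:
   the average of the shifted reciprocals is a Riemann sum for log. *)
Definition log_ratio (x : R) : R := if x == 0 then 1 else x / (1 - expR (- x)).

Lemma log_ratio_ge0 x : 0 <= x -> 0 <= log_ratio x.
Proof.
move=> x0; rewrite /log_ratio; case: eqP => // _.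
by rewrite divr_ge0 // subr_ge0 -expR0 ler_expR oppr_le0.
Qed.

(** By [cyclic_exchange] the n + 1 summands have the same expectation, so the expectation of the
    whole is t times that of the reciprocal left sum. *)
Definition shift_sum (t : R) (n : nat) (w : Om) : R :=
  \sum_(j < n.+1) t / n.+1%:R *
    (exp_sum (t / n.+1%:R) (random_tuple (fun i : 'I_n.+1 =>
       increment xi (fun k => k%:R * (t / n.+1%:R)) (i + j)) w))^-1.

(** Since y_j - y_{j+1} = (1 - q) dx e^{-a_j}, where e^{a_j} y_j is the j-th shifted left sum, (1 -
    q) times the sum is the sum of (y_j - y_{j+1}) / y_j. [telescope_ln] compares it with ln (y_0 /
    y_N) = - ln q = xi_t. *)
Lemma shift_sum_bounds (t : R) (n : nat) (w : Om) : 0 < t ->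
  shift_sum t n w <= log_ratio (xi t w) <=
  shift_sum t n w + n.+1%:R^-1 *
    (expR (- xi t w) ^+ 2 * (1 - expR (- xi t w)))^-1.
Proof.
move=> t0; pose N := n.+1; set dx := t / n.+1%:R.
have dx0 : 0 < dx by rewrite divr_gt0.
pose a k := xi (k%:R * dx) w.
have a0 : a 0%N = 0 by rewrite /a mul0r (rs_at0 rs).
have aN : a N = xi t w by rewrite /a /dx mulrC divfK ?pnatr_eq0.
have aS k : a k <= a k.+1 by rewrite /a (rs_mono rs) // t_leS // ltW.
pose q := expR (- xi t w).
have q0 : 0 < q by exact: expR_gt0.
have q1 : q <= 1 by rewrite -expR0 ler_expR oppr_le0 (rs_ge0 rs) // ltW.
pose S k := dx * \sum_(i < k) expR (- a i).
have SS k : S k.+1 = S k + dx * expR (- a k) by rewrite /S big_ord_recr mulrDr.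
have S0 : S 0%N = 0 by rewrite /S big_ord0 mulr0.
pose y k := S N - (1 - q) * S k.
have Smono k l : (k <= l)%N -> S k <= S l.
  move=> /subnK <-; elim: (l - k)%N => [|m IH]; first by rewrite add0n.
  by rewrite addSn SS; apply: le_trans IH _; rewrite lerDl mulr_ge0 ?expR_ge0 // ltW.
have Sge k : 0 <= S k by rewrite -S0 Smono.
(* Each exponential in S_N is at least q. This bounds y_N = q S_N from below by q^2 t, the source of
   the error term. *)
have qtS : q * t <= S N.
  rewrite /S /dx (_ : q * t = t / n.+1%:R * (q * n.+1%:R)); last first.
    by rewrite mulrCA divfK ?pnatr_eq0.
  rewrite ler_wpM2l ?(ltW dx0) // (_ : q * n.+1%:R = \sum_(i < N) q); last first.
    by rewrite sumr_const card_ord mulr_natr.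
  apply: ler_sum => i _; rewrite /q ler_expR lerN2 -aN.
  have := ltnW (ltn_ord i); move: (nat_of_ord i) => k /subnK <-.
  by elim: (N - k)%N => [|m IH] //; rewrite addSn; exact: le_trans (aS _).
have SN0 : 0 < S N by apply: lt_le_trans qtS; rewrite mulr_gt0.
have ypos k : (k <= N)%N -> 0 < y k.
  move=> kN; apply: (@lt_le_trans _ _ (q * S N)); first exact: mulr_gt0.
  by rewrite /y; have := Smono _ _ kN; nra.
have ydiff k : y k - y k.+1 = (1 - q) * (dx * expR (- a k)).
  by rewrite /y SS; ring.
have ydec k : (k < N)%N -> 0 <= y k - y k.+1 <= dx.
  move=> _; rewrite ydiff; have e0 := expR_gt0 (- a k).
  have e1 : expR (- a k) <= 1.
    by rewrite -expR0 ler_expR oppr_le0 (rs_ge0 rs) // mulr_ge0 // ltW.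
  have p0 : 0 <= dx * expR (- a k) by rewrite mulr_ge0 ?ltW.
  rewrite mulr_ge0 ?subr_ge0 //=; apply: (@le_trans _ _ (dx * expR (- a k))).
    by rewrite ler_piMl // gerBl ltW.
  by rewrite ler_piMr // ltW.
have yN : y N = q * S N by rewrite /y; ring.
have y0 : y 0%N = S N by rewrite /y S0 mulr0 subr0.
have shE : shift_sum t n w = \sum_(j < N) dx * expR (- a j) / y j.
  apply: eq_bigr => j _; rewrite /exp_sum.
  have -> : dx * \sum_(i < n.+1) expR (- \sum_(k < n.+1 | (k < i)%N)
      (tnth (random_tuple (fun i0 : 'I_n.+1 => increment xi (fun k => k%:R * dx) (i0 + j)) w) k : R)) =
      expR (a j) * y j.
    transitivity (dx * (expR (a j) * (\sum_(i < N) expR (- a i) -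
                (1 - expR (- a N)) * \sum_(i < j) expR (- a i)))); last first.
      by rewrite /y /S aN -/q; ring.
    congr (_ * _); rewrite -cyclic_exp_sum //.
    apply: eq_bigr => i _; congr (expR (- _)); apply: eq_bigr => k _.
    by rewrite tnth_mktuple /increment.
  by rewrite invfM -expRN mulrA.
rewrite /log_ratio; have [x0|x0] := eqVneq (xi t w) 0.
  (* Here every y_j equals S_N and the sum is exactly 1; the error term is 0 because the inverse of
     0 is 0. *)
  have q1E : q = 1 by rewrite /q x0 oppr0 expR0.
  rewrite shE x0 oppr0 expR0 subrr mulr0 invr0 mulr0 addr0.
  rewrite (eq_bigr (fun j : 'I_N => dx * expR (- a j) / S N)); last first.
    by move=> j _; rewrite /y q1E subrr mul0r subr0.
  by rewrite -mulr_suml -mulr_sumr -/(S N) divff ?gt_eqF // lexx.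
have q1n : 0 < 1 - q.
  by rewrite subr_gt0 -expR0 ltr_expR oppr_lt0 lt_neqAle eq_sym x0 (rs_ge0 rs) // ltW.
have := telescope_ln ypos ydec.
rewrite y0 yN (_ : S N / (q * S N) = q^-1); last by field; rewrite !gt_eqF.
rewrite -expRN opprK expRK.
rewrite (_ : \sum_(i < N) _ = (1 - q) * shift_sum t n w); last first.
  by rewrite shE mulr_sumr; apply: eq_bigr => j _; rewrite ydiff; ring.
move=> /andP[h1 h2].
rewrite -/q ler_pdivlMr // mulrC h1 /= ler_pdivrMr // mulrDl.
rewrite (mulrC (shift_sum _ _ _)).
apply: le_trans h2 _; rewrite lerD2l.
apply: (@le_trans _ _ (dx * (q * (q * t))^-1)).
  rewrite ler_wpM2l ?(ltW dx0) // lerBlDr; apply: (@le_trans _ _ (q * (q * t))^-1).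
    have qS : q * (q * t) <= q * S N by rewrite ler_wpM2l // ltW.
    have qqt : 0 < q * (q * t) by rewrite !mulr_gt0.
    by rewrite lef_pV2 // posrE //; exact: lt_le_trans qS.
  by rewrite lerDl invr_ge0 ltW.
rewrite le_eqVlt; apply/orP; left; apply/eqP; rewrite /dx.
have Nn0 : n.+1%:R != 0 :> R by rewrite pnatr_eq0.
by move: Nn0 q0 q1n t0; move: (n.+1%:R) => M M0 *; field; rewrite M0 !gt_eqF.
Qed.

End CyclicExchange.

Section InverseMoment.
Context {R : realType} {d : measure_display} {Om : measurableType d}.
Local Notation TR := (measurableTypeR R).
Local Notation grid dx := (fun k : nat => k%:R * dx)%R.
Variables (P : probability Om R) (xi : R -> Om -> R).
Hypothesis rs : regular_subordinator P xi.

Lemma exp_sum_gt0 (dx : R) (n : nat) (x : n.+1.-tuple TR) : 0 < dx -> 0 < exp_sum dx x.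
Proof.
move=> dx0; rewrite /exp_sum mulr_gt0 // big_ord_recl ltr_pwDl ?expR_gt0 //.
by apply: sumr_ge0 => i _; rewrite expR_ge0.
Qed.

Lemma shift_sum_cvg (t : R) (w : Om) : 0 < t ->
  shift_sum xi t n w @[n --> \oo] --> log_ratio (xi t w).
Proof.
move=> t0; set C := (expR (- xi t w) ^+ 2 * (1 - expR (- xi t w)))^-1.
apply: (@squeeze_cvgr _ _ _ _ (fun n => log_ratio (xi t w) - C * n.+1%:R^-1) (cst (log_ratio (xi t w)))).
- near=> n; have /andP[h1 h2] := shift_sum_bounds rs n w t0.
  by rewrite h1 andbT lerBlDr mulrC.
- rewrite -[X in _ --> X]subr0; apply: cvgB; first exact: cvg_cst.
  rewrite -[X in _ --> X](mulr0 C); apply: cvgM; first exact: cvg_cst.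
  exact: cvg_harmonic.
- exact: cvg_cst.
Unshelve. all: by end_near. Qed.

(** For each n the cyclic exchange equates t E[1 / left sum] with the expectation of [shift_sum];
    both integrands stay below their limits. *)
Lemma expfun_inv_moment (t : R) : 0 < t ->
  (t%:E * \int[P]_w (expfun xi t w `^ (- 1))%:E = \int[P]_w (log_ratio (xi t w))%:E)%E.
Proof.
move=> t0.
have dx0 n : 0 < t / n.+1%:R by rewrite divr_gt0.
have mexp n (X : 'I_n.+1 -> Om -> TR) : (forall i, measurable_fun setT (X i)) ->
    measurable_fun setT (fun w => exp_sum (t / n.+1%:R) (random_tuple X w)).
  move=> mX; apply: (measurableT_comp (measurable_exp_sum (t / n.+1%:R) (n:=n.+1))).
  exact: measurable_random_tuple.
have minc n (j : 'I_n.+1) (i : 'I_n.+1) :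
  measurable_fun setT (increment xi (grid (t / n.+1%:R)) (i + j)%R).
  exact: (measurable_increment rs).
have shE n w : shift_sum xi t n w = \sum_(j < n.+1) (t / n.+1%:R *
    (exp_sum (t / n.+1%:R) (random_tuple (fun i : 'I_n.+1 =>
       increment xi (grid (t / n.+1%:R)) (i + j)%R) w)) `^ (- 1)).
  by apply: eq_bigr => j _; rewrite powR_inv1 // ltW // exp_sum_gt0.
have msh n : measurable_fun setT (fun w => (shift_sum xi t n w)%:E).
  under eq_fun do rewrite shE; apply/measurable_EFinP; apply: measurable_sum => j.
  apply: measurable_funM => //; apply: (measurableT_comp (measurable_powR _)).
  exact: mexp.
have sh0 n w : 0 <= shift_sum xi t n w.
  by rewrite shE; apply: sumr_ge0 => j _; rewrite mulr_ge0 ?powR_ge0 // ltW.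
have c1 : (\int[P]_w (shift_sum xi t n w)%:E)%E @[n --> \oo] -->
    (\int[P]_w (log_ratio (xi t w))%:E)%E.
  apply: cvg_integral_below => //.
  - apply: (@emeasurable_fun_cvg _ _ _ _ (fun n w => (shift_sum xi t n w)%:E)) => //.
    move=> w _; apply: cvg_EFin; first exact: nearW.
    exact: shift_sum_cvg.
  - by move=> n w; rewrite !lee_fin sh0; case/andP: (shift_sum_bounds rs n w t0).
  - by move=> w; apply: cvg_EFin; [exact: nearW|exact: shift_sum_cvg].
have c2 := expfun_sum_powRN_cvg (mu := P) (rs_at0 rs) (rs_mono rs) (rs_measurable rs)
  t0 ler01 (@measurable_cst _ _ _ _ _ (t : R)) (fun w => ltW t0).
have mI : measurable_fun setT (fun w => (expfun xi t w `^ (- 1))%:E).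
  apply/measurable_EFinP; apply: (measurableT_comp (measurable_powR _)).
  by apply: measurable_expfun (rs_mono rs) (rs_measurable rs) _ _; exact: ltW.
transitivity (\int[P]_w (cst t w * expfun xi t w `^ (- 1))%:E)%E.
  under [RHS]eq_integral do rewrite EFinM.
  rewrite ge0_integralZl_EFin //; last exact: ltW.
  by move=> w _; rewrite lee_fin powR_ge0.
apply: (eq_cvg_ereal c2 c1) => n.
have [F FE] : exists F : n.+1.-tuple TR -> \bar R,
    F = (fun x => ((exp_sum (t / n.+1%:R) x) `^ (- 1))%:E) by eexists.
have mF : measurable_fun setT F.
  rewrite FE; apply/measurable_EFinP; apply: (measurableT_comp (measurable_powR _)).
  exact: measurable_exp_sum.
have F0 x : (0 <= F x)%E by rewrite FE lee_fin powR_ge0.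
pose X j w := F (random_tuple (fun i : 'I_n.+1 => increment xi (grid (t / n.+1%:R)) (i + j)%R) w).
have mX j : measurable_fun setT (X j).
  by apply: (measurableT_comp mF); exact: measurable_random_tuple.
pose A := (\int[P]_w F (random_tuple (fun i : 'I_n.+1 => increment xi (grid (t / n.+1%:R)) i) w))%E.
have XA j : (\int[P]_w X j w = A)%E by apply: cyclic_exchange => //; exact: ltW.
have -> : (\int[P]_w (shift_sum xi t n w)%:E =
    \sum_(j < n.+1) (t / n.+1%:R)%:E * \int[P]_w X j w)%E.
  transitivity (\int[P]_w (\sum_(j < n.+1) (t / n.+1%:R)%:E * X j w))%E.
    apply: eq_integral => w _; rewrite shE -sumEFin; apply: eq_bigr => j _.
    by rewrite EFinM /X FE.
  rewrite ge0_integral_sum //.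
  - apply: eq_bigr => j _; rewrite ge0_integralZl_EFin //; last exact: ltW.
    by move=> w _; exact: F0.
  - by move=> j; apply: emeasurable_funM.
  - by move=> j w _; apply: mule_ge0; [rewrite lee_fin ltW|exact: F0].
under eq_bigr do rewrite XA.
have -> : (\int[P]_w (cst t w * expfun_sum xi t n w `^ (-1))%:E = t%:E * A)%E.
  rewrite /A -ge0_integralZl_EFin //; last 2 first.
  - by apply: (measurableT_comp mF); apply: measurable_random_tuple => i; exact: (measurable_increment rs).
  - exact: ltW.
  apply: eq_integral => w _; rewrite FE exp_sumE EFinM mul0r (rs_at0 rs).
  congr (_ * (_ `^ _)%:E)%E; rewrite /expfun_sum /left_sum; congr (_ * _).
  by apply: eq_bigr => i _; rewrite add0r subr0.
rewrite -ge0_sume_distrl; last by move=> *; rewrite lee_fin ltW.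
by rewrite sumEFin sumr_const card_ord -[X in _ = (X%:E * _)%E]mulr_natr divfK ?pnatr_eq0.
Qed.

End InverseMoment.

(** * Recursion for the inverse moments *)

Section ElementaryInequalities.
Context {R : realType}.
Implicit Types x y z h : R.

Lemma bernoulli_pow (n : nat) x : 0 <= x -> 1 + n%:R * x <= (1 + x) ^+ n.
Proof.
move=> x0; elim: n => [|n IH]; first by rewrite mul0r addr0 expr0.
rewrite exprS -natr1; have := ler0n R n; move: IH.
by move: (_ ^+ n) (n%:R) => a b *; nra.
Qed.

Lemma bernoulli_pow_sub (n : nat) x : 0 <= x <= 1 -> 1 - n%:R * x <= (1 - x) ^+ n.
Proof.
move=> /andP[x0 x1]; elim: n => [|n IH]; first by rewrite mul0r subr0 expr0.
rewrite exprS -natr1; have := ler0n R n; move: IH.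
by move: (_ ^+ n) (n%:R) => a b *; nra.
Qed.

(** The graph of the convex function x^{-n} lies above its tangent at z. Multiplied by z^n, this is
    Bernoulli's inequality for z / x followed by (z - x) / z <= (z - x) / x. *)
Lemma pow_inv_tangent (n : nat) x z : 0 < x -> x <= z ->
  z ^- n + n%:R * (z - x) * z ^- n.+1 <= x ^- n.
Proof.
move=> x0 xz; have z0 := lt_le_trans x0 xz.
have r0 : 0 <= z / x - 1 by rewrite subr_ge0 ler_pdivlMr // mul1r.
have := bernoulli_pow n r0; rewrite subrKC expr_div_n => h.
have zn : 0 < z ^+ n by rewrite exprn_gt0.
rewrite -(ler_pM2l zn).
have -> : z ^+ n * (z ^- n + n%:R * (z - x) * z ^- n.+1) = 1 + n%:R * ((z - x) / z).
  by rewrite exprS; field; rewrite !gt_eqF.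
apply: le_trans h; rewrite lerD2l ler_wpM2l //.
rewrite -(divff (lt0r_neq0 x0)) -mulrBl ler_wpM2l ?subr_ge0 //.
by rewrite lef_pV2 ?posrE.
Qed.

(** For x <= 1 it follows from Bernoulli's inequality and 1 - x <= 1 / (1 + x); for x > 1 and n > 0
    the left side is nonpositive. *)
Lemma pow_inv_drop (n : nat) x : 0 <= x -> 1 - n%:R * x <= (1 + x) ^- n.
Proof.
move=> x0; have p0 : 0 < (1 + x) ^- n by rewrite invr_gt0 exprn_gt0 // ltr_wpDr.
have [x1|x1] := leP x 1; last first.
  case: n p0 => [|n] p0; first by rewrite mul0r subr0 expr0 invr1.
  apply: le_trans (ltW p0); rewrite subr_le0 -[leLHS]mul1r.
  by apply: ler_pM => //; [rewrite ler1n|exact: ltW].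
apply: le_trans (bernoulli_pow_sub n _) _; first by rewrite x0.
rewrite -exprVn; apply: lerXn2r; rewrite ?nnegrE ?subr_ge0 ?invr_ge0 ?addr_ge0 //.
by rewrite -[X in _ <= X]mul1r ler_pdivlMr ?ltr_wpDr //; nra.
Qed.

(* The term 2 v^eta (...) absorbs the large values of the jump E = exp xi with
   a moment of order slightly above m. *)
Lemma min_pow_bound (m : nat) (E Ee v ve : R) :
  (0 < m)%N -> 1 <= E -> 0 <= Ee <= 1 -> 0 <= v -> Num.min 1 v <= ve ->
  E ^+ m * Num.min 1 v + 2 * (ve * Ee) <= v / E + 2 * (E ^+ m * ve).
Proof.
move=> m0 E1 /andP[Ee0 Ee1] v0 vve; have E0 : 0 < E by exact: lt_le_trans E1.
have EEm : E <= E ^+ m by rewrite -{1}(expr1 E) ler_weXn2l.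
have k0 : 0 <= Num.min 1 v by rewrite le_min ler01.
have kv : Num.min 1 v <= v by rewrite ge_min lexx orbT.
have Ei : 2 - E <= E^-1.
  rewrite -[E^-1]mul1r ler_pdivlMr //; have := sqr_ge0 (E - 1); nra.
have Ei0 : 0 < E^-1 by rewrite invr_gt0.
move: (E ^+ m) (Num.min 1 v) (E^-1) EEm vve k0 kv Ei Ei0 => F k e *.
have h1 : (F - Ee) * k <= (F - Ee) * ve by rewrite ler_wpM2l // subr_ge0; lra.
have h2 : k * e <= v * e by rewrite ler_wpM2r // ltW.
have h3 : 0 <= k * (F + e - 2 * Ee) by rewrite mulr_ge0 //; lra.
nra.
Qed.

(** [x], [w] and [J] are values of xi_h, of the restarted functional and of I_h. After division by
    w^{-m}, with y = m h / w and E = e^x, the inequality reduces to [min_pow_bound] at v = y E. *)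
Lemma jump_upper_bound (m : nat) (eta h x w J : R) :
  (0 < m)%N -> 0 < eta < 1 -> 0 < h -> 0 <= x -> 0 < w -> 0 <= J <= h ->
  expR (m%:R * x) * w `^ (- m%:R) + 2 * (m%:R * h) `^ eta * w `^ (- (m%:R + eta)) <=
  (J + expR (- x) * w) `^ (- m%:R) + m%:R * h * w `^ (- (m.+1)%:R) +
  2 * (m%:R * h) `^ eta * (expR ((m%:R + eta) * x) * w `^ (- (m%:R + eta))).
Proof.
move=> m0 /andP[eta0 eta1] h0 x0 w0 /andP[J0 Jh].
pose E := expR x; pose y := m%:R * h / w.
have E1 : 1 <= E by rewrite -expR0 ler_expR.
have E0 : 0 < E by exact: expR_gt0.
have mh0 : 0 < m%:R * h by rewrite mulr_gt0 // ltr0n.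
have y0 : 0 < y by rewrite divr_gt0.
have w0' := ltW w0.
have wN n : w `^ (- n%:R) = w ^- n by rewrite powR_invn.
have ye : (m%:R * h) `^ eta * w `^ (- eta) = y `^ eta.
  by rewrite /y [in RHS]powRM ?(ltW mh0) ?invr_ge0 // -(@powR_inv1 _ w) // -powRrM mulN1r.
have wD : w `^ (- (m%:R + eta)) = w ^- m * w `^ (- eta).
  by rewrite opprD powRD ?wN // (gt_eqF w0) implybT.
have Em : expR (m%:R * x) = E ^+ m by rewrite expRM_natl.
have Eme : expR ((m%:R + eta) * x) = E ^+ m * expR (eta * x) by rewrite mulrDl expRD Em.
(* Since J <= h, the factor (1 + J E / w)^{-m} falls short of 1 by at most min(1, y E). *)
have drop : E ^+ m - E ^+ m * Num.min 1 (y * E) <= (J * E / w + 1) ^- m * E ^+ m.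
  rewrite -{1}[E ^+ m]mulr1 -mulrBr mulrC ler_wpM2r ?exprn_ge0 ?(ltW E0) //.
  have Jw : 0 <= J * E / w by rewrite divr_ge0 // mulr_ge0 // ltW.
  rewrite lerBlDr -lerBlDl le_min; apply/andP; split.
    by rewrite lerBlDr lerDl invr_ge0 exprn_ge0 // addr_ge0.
  apply: (@le_trans _ _ (m%:R * (J * E / w))).
    by have := pow_inv_drop m Jw; rewrite (addrC 1 (_ / _)); move: (_ ^- m) => *; lra.
  rewrite (_ : y * E = m%:R * (h * E / w)); last by rewrite /y; ring.
  by rewrite ler_wpM2l // ler_wpM2r ?invr_ge0 // ler_wpM2r // ltW.
have JE : (J + expR (- x) * w) `^ (- m%:R) = (J * E / w + 1) ^- m * E ^+ m * w ^- m.
  rewrite powR_invn; last by rewrite addr_ge0 // mulr_ge0 ?expR_ge0.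
  rewrite (_ : J + expR (- x) * w = (J * E / w + 1) * (w / E)); last first.
    by rewrite expRN -/E; field; rewrite !gt_eqF.
  by rewrite exprMn expr_div_n invfM invf_div mulrA.
have yE0 : 0 < y * E by rewrite mulr_gt0.
have Ee : expR (- (eta * x)) * (y * E) `^ eta = y `^ eta.
  by rewrite powRM ?(ltW y0) ?(ltW E0) // /E -expRM mulrC -mulrA -expRD (mulrC x) subrr expR0 mulr1.
have Eeta : expR (eta * x) * y `^ eta = (y * E) `^ eta.
  by rewrite powRM ?(ltW y0) ?(ltW E0) // /E -expRM mulrC (mulrC x).
have vve : Num.min 1 (y * E) <= (y * E) `^ eta.
  have [yE1|yE1] := leP 1 (y * E).
    have <- : 1 `^ eta = 1 :> R by rewrite powR1.
    by apply: ge0_ler_powR yE1; rewrite ?nnegrE; exact: ltW.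
  by apply: ger1_powR; [rewrite yE0 ltW|exact: ltW].
have Ee01 : 0 <= expR (- (eta * x)) <= 1.
  by rewrite expR_ge0 -expR0 ler_expR oppr_le0 mulr_ge0 // ltW.
have := min_pow_bound m0 E1 Ee01 (ltW yE0) vve.
rewrite (mulrC (_ `^ eta)) Ee mulfK ?gt_eqF // => main.
have wm0 : 0 < w ^- m by rewrite invr_gt0 exprn_gt0.
have key : E ^+ m + 2 * y `^ eta <= (J * E / w + 1) ^- m * E ^+ m + y +
    2 * (expR (eta * x) * y `^ eta * E ^+ m).
  by rewrite Eeta (mulrC (_ `^ eta)); lra.
move: key; rewrite -(ler_pM2l wm0); congr (_ <= _).
  by rewrite Em wN wD -ye; ring.
rewrite JE wN Eme wD -ye exprS invfM /y; ring.
Qed.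

End ElementaryInequalities.

Section Recursion.
Context {R : realType} {d : measure_display} {Om : measurableType d}.
Local Notation TR := (measurableTypeR R).
Variables (P : probability Om R) (xi : R -> Om -> R).
Hypothesis rs : regular_subordinator P xi.

Definition inv_moment (q T : R) : \bar R :=
  (\int[P]_w (expfun xi T w `^ (- q))%:E)%E.

Lemma inv_moment_ge0 q T : (0 <= inv_moment q T)%E.
Proof. by apply: integral_ge0 => w _; rewrite lee_fin powR_ge0. Qed.

Let mI T : 0 <= T -> measurable_fun setT (expfun xi T).
Proof. by move=> T0; exact: measurable_expfun (rs_mono rs) (rs_measurable rs) _ T0. Qed.

Let mIp q T : 0 <= T -> measurable_fun setT (fun w => (expfun xi T w `^ (- q))%:E).
Proof.
move=> T0; apply/measurable_EFinP; apply: (measurableT_comp (measurable_powR _)).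
exact: mI.
Qed.

Let mW h T : 0 <= T -> measurable_fun setT (expfun (shifted xi h) T).
Proof.
by move=> T0; exact: measurable_expfun (@shifted_mono _ _ _ _ _ rs h) (measurable_shifted rs h) _ T0.
Qed.

Let W_gt0 h T w : 0 < T -> 0 < expfun (shifted xi h) T w.
Proof. exact: expfun_gt0 (shifted0 xi h) (@shifted_mono _ _ _ _ _ rs h) _ _. Qed.

Let I_bounds h w : 0 <= h -> h * expR (- xi h w) <= expfun xi h w <= h.
Proof. exact: expfun_bounds (rs_at0 rs) (rs_mono rs) _ _. Qed.

Let mexp u h : measurable_fun [set: Om] (fun w => expR (u * xi h w)).
Proof. by have /measurable_EFinP := measurable_exp_moment rs u h. Qed.

Lemma split_moment (u q h T : R) : 0 <= h -> 0 < T -> 0 <= q ->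
  (exp_moment P xi u h < +oo)%E ->
  (\int[P]_w (expR (u * xi h w) * expfun (shifted xi h) T w `^ (- q))%:E =
   exp_moment P xi u h * inv_moment q T)%E.
Proof.
move=> h0 T0 q0 Moo.
have mg : measurable_fun [set: TR] (fun x : TR => expR (u * x) : TR).
  by apply: measurableT_comp => //; exact: measurable_funM.
exact: (integral_split_powRN rs h0 T0 q0 mg (fun x => expR_ge0 _)).
Qed.

(** Integrates the tangent inequality at z = I_{T+h} for x = e^{-xi_h} W, where z - x = I_h >= h
    e^{-xi_h}. *)
Lemma inv_moment_lower (m : nat) (h T : R) : 0 < h -> 0 < T ->
  (exp_moment P xi m%:R h < +oo)%E ->
  ((m%:R * h)%:E * \int[P]_w (expR (- xi h w) * expfun xi (T + h) w `^ (- m.+1%:R))%:E +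
   inv_moment m%:R (T + h) <= exp_moment P xi m%:R h * inv_moment m%:R T)%E.
Proof.
move=> h0 T0 Moo; have Th0 : 0 <= T + h by rewrite addr_ge0 // ltW.
have mm : measurable_fun setT (fun w => (expR (- xi h w) * expfun xi (T + h) w `^ (- m.+1%:R))%:E).
  apply: measurable_mul_powR; last exact: mI.
  by have := mexp (-1) h; under eq_fun do rewrite mulN1r.
rewrite -split_moment ?ler0n ?(ltW h0) //.
have g1 w : (0 <= (expR (- xi h w) * expfun xi (T + h) w `^ (- m.+1%:R))%:E)%E.
  by rewrite lee_fin mulr_ge0 ?expR_ge0 ?powR_ge0.
have g2 w : (0 <= (expfun xi (T + h) w `^ (- m%:R))%:E)%E by rewrite lee_fin powR_ge0.
have mh : (0 <= m%:R * h) by rewrite mulr_ge0 // ltW.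
apply: (@le_trans _ _ (\int[P]_w ((m%:R * h)%:E *
    (expR (- xi h w) * expfun xi (T + h) w `^ (- m.+1%:R))%:E +
    (expfun xi (T + h) w `^ (- m%:R))%:E))%E).
  rewrite ge0_integralD //; last 3 first.
  - by move=> w _; rewrite mule_ge0.
  - exact: emeasurable_funM.
  - exact: mIp.
  by rewrite ge0_integralZl_EFin.
apply: ge0_le_integral.
- exact: measurableT.
- by move=> w _; rewrite adde_ge0 // mule_ge0.
- by apply: emeasurable_funD; [exact: emeasurable_funM|exact: mIp].
- by apply: measurable_mul_powR; [exact: mexp|apply: mW; exact: ltW].
move=> w _; rewrite -EFinM -EFinD lee_fin.
have W0 := W_gt0 h w T0; set W := expfun _ T w in W0 *.
have x0 : 0 < expR (- xi h w) * W by rewrite mulr_gt0 ?expR_gt0.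
have IE : expfun xi (T + h) w = expfun xi h w + expR (- xi h w) * W.
  by rewrite addrC (expfun_shiftedD rs) // ltW.
have /andP[I1 I2] := I_bounds w (ltW h0).
have Ih0 : 0 <= expfun xi h w by apply: le_trans I1; rewrite mulr_ge0 ?expR_ge0 ?ltW.
have xI : expR (- xi h w) * W <= expfun xi (T + h) w by rewrite IE lerDr.
have IT0 := lt_le_trans x0 xI.
have := pow_inv_tangent m x0 xI; rewrite {2}IE addrK.
rewrite !powR_invn ?(ltW IT0) ?(ltW W0) // exprMn expRN exprVn invfM invrK -expRM_natl.
move=> tang; apply: le_trans tang; rewrite addrC lerD2l mulrA ler_wpM2r //.
  by rewrite invr_ge0 exprn_ge0 // ltW.
by rewrite -mulrA ler_wpM2l // -expRN.
Qed.

Lemma shifted_inv_moment (q h T : R) : 0 <= h -> 0 < T -> 0 <= q ->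
  (\int[P]_w (expfun (shifted xi h) T w `^ (- q))%:E = inv_moment q T)%E.
Proof.
move=> h0 T0 q0; have E0 : exp_moment P xi 0 h = 1%E.
  rewrite -(exp_moment0 rs 0); apply: eq_integral => w _.
  by rewrite !mul0r.
have := split_moment h0 T0 q0 (u := 0); rewrite E0 mul1e ltry => /(_ isT) <-.
by apply: eq_integral => w _; rewrite mul0r expR0 mul1r.
Qed.

(** Every term stays on the side where it is added, so that infinite integrals never meet a
    subtraction. *)
Lemma le_integral_combination (f1 f2 f3 f4 f5 : Om -> R) (A B : R) :
  0 <= A -> 0 <= B ->
  [/\ measurable_fun setT f1, measurable_fun setT f2, measurable_fun setT f3,
      measurable_fun setT f4 & measurable_fun setT f5] ->
  (forall w, [/\ 0 <= f1 w, 0 <= f2 w, 0 <= f3 w, 0 <= f4 w & 0 <= f5 w]) ->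
  (forall w, f1 w + A * f2 w <= f3 w + B * f4 w + A * f5 w) ->
  (\int[P]_w (f1 w)%:E + A%:E * \int[P]_w (f2 w)%:E <=
   \int[P]_w (f3 w)%:E + B%:E * \int[P]_w (f4 w)%:E + A%:E * \int[P]_w (f5 w)%:E)%E.
Proof.
move=> A0 B0 [/measurable_EFinP m1 /measurable_EFinP m2 /measurable_EFinP m3
  /measurable_EFinP m4 /measurable_EFinP m5] f0 key.
have {}f0 w : [/\ 0 <= (f1 w)%:E, 0 <= (f2 w)%:E, 0 <= (f3 w)%:E, 0 <= (f4 w)%:E
    & 0 <= (f5 w)%:E]%E by have [] := f0 w; split.
have mZ k f : measurable_fun setT f -> measurable_fun setT (fun w : Om => (k%:E * f w)%E).
  by move=> mf; exact: emeasurable_funM.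
have Z0 k (f : Om -> \bar R) : (0 <= k)%R -> (forall w, 0 <= f w)%E ->
    forall w, setT w -> (0 <= k%:E * f w)%E.
  by move=> k0 fp w _; rewrite mule_ge0.
have f10 w : (0 <= (f1 w)%:E)%E by case: (f0 w).
have f20 w : (0 <= (f2 w)%:E)%E by case: (f0 w).
have f30 w : (0 <= (f3 w)%:E)%E by case: (f0 w).
have f40 w : (0 <= (f4 w)%:E)%E by case: (f0 w).
have f50 w : (0 <= (f5 w)%:E)%E by case: (f0 w).
rewrite -!(@ge0_integralZl_EFin _ _ _ P setT) //.
rewrite -ge0_integralD //; [|exact: Z0|exact: mZ].
rewrite -ge0_integralD //; [|exact: Z0|exact: mZ].
rewrite -ge0_integralD //; [|by move=> w _; rewrite adde_ge0 // mule_ge0|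
  by apply: emeasurable_funD => //; exact: mZ|exact: Z0|exact: mZ].
apply: ge0_le_integral => //.
- by move=> w _; rewrite adde_ge0 // mule_ge0.
- by apply: emeasurable_funD => //; exact: mZ.
- by apply: emeasurable_funD; [apply: emeasurable_funD => //|]; exact: mZ.
- by move=> w _; rewrite -!EFinM -!EFinD lee_fin.
Qed.

(** The moments of order m + eta appear on both sides with the same coefficient 2 (m h)^eta. Their
    difference carries the extra factor E[e^{(m + eta) xi_h}] - 1, of order h, and is therefore
    o(h). *)
Lemma inv_moment_upper (m : nat) (eta h T : R) : (0 < m)%N -> 0 < eta < 1 ->
  0 < h -> 0 < T ->
  (exp_moment P xi m%:R h < +oo)%E -> (exp_moment P xi (m%:R + eta) h < +oo)%E ->
  (exp_moment P xi m%:R h * inv_moment m%:R T +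
   (2 * (m%:R * h) `^ eta)%:E * inv_moment (m%:R + eta) T <=
   inv_moment m%:R (T + h) + (m%:R * h)%:E * inv_moment m.+1%:R T +
   (2 * (m%:R * h) `^ eta)%:E *
     (exp_moment P xi (m%:R + eta) h * inv_moment (m%:R + eta) T))%E.
Proof.
move=> m0 eta01 h0 T0 Moo Moo'; have h0' := ltW h0; have T0' := ltW T0.
have Th0 : 0 <= T + h by rewrite addr_ge0.
have q0 : 0 <= m%:R + eta by rewrite addr_ge0 //; case/andP: eta01 => /ltW.
have A0 : 0 <= 2 * (m%:R * h) `^ eta by rewrite mulr_ge0 ?powR_ge0.
have mh : 0 <= m%:R * h by rewrite mulr_ge0.
have key w : expR (m%:R * xi h w) * expfun (shifted xi h) T w `^ (- m%:R) +
    2 * (m%:R * h) `^ eta * expfun (shifted xi h) T w `^ (- (m%:R + eta)) <=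
    expfun xi (T + h) w `^ (- m%:R) +
    m%:R * h * expfun (shifted xi h) T w `^ (- m.+1%:R) +
    2 * (m%:R * h) `^ eta *
      (expR ((m%:R + eta) * xi h w) * expfun (shifted xi h) T w `^ (- (m%:R + eta))).
  rewrite addrC (addrC T) (expfun_shiftedD rs) // addrC.
  have /andP[I1 I2] := I_bounds w h0'.
  apply: jump_upper_bound => //; first exact: (rs_ge0 rs).
  - exact: W_gt0.
  - by rewrite I2 andbT; apply: le_trans I1; rewrite mulr_ge0 ?expR_ge0.
move: key; set A := 2 * (m%:R * h) `^ eta in A0 *.
rewrite -(split_moment h0' T0 (ler0n _ m)) // -(split_moment h0' T0 q0) //.
rewrite -(shifted_inv_moment h0' T0 q0) -(shifted_inv_moment h0' T0 (ler0n _ m.+1)).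
have mp q (f : Om -> R) : measurable_fun setT f -> measurable_fun setT (fun w => f w `^ (- q)).
  by move=> mf; apply: (measurableT_comp (measurable_powR _)).
have mWT : measurable_fun setT (expfun (shifted xi h) T) by exact: mW.
have mIT : measurable_fun setT (expfun xi (T + h)) by exact: mI.
move=> key; apply: le_integral_combination key => //.
  split; [apply: measurable_funM; [exact: mexp|exact: mp]|exact: mp|exact: mp|exact: mp|].
  by apply: measurable_funM; [exact: mexp|exact: mp].
by move=> w; split; rewrite ?powR_ge0 // mulr_ge0 ?expR_ge0 ?powR_ge0.
Qed.

End Recursion.

Section SmallTimeLimits.
Context {R : realType}.
Local Notation h_ n := (n.+1%:R^-1 : R).

Lemma expR_sub1_le (x : R) : 0 <= x -> x <= expR x - 1 <= x * expR x.
Proof.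
move=> x0; have := expR_ge1Dx x; have := expR_ge1Dx (- x).
have := expRxMexpNx_1 x; have := expR_gt0 x.
by move: (expR x) (expR (- x)) => a b *; apply/andP; split; nra.
Qed.

Lemma expR_slope_cvg (L : R) : 0 <= L ->
  (expR (h_ n * L) - 1) / h_ n @[n --> \oo] --> L.
Proof.
move=> L0; have hL : (h_ n * L) @[n --> \oo] --> (0 : R).
  by rewrite -[X in _ --> X](mul0r L); apply: cvgMl; exact: cvg_harmonic.
apply: (@squeeze_cvgr _ _ _ _ (cst L) (fun n => L * expR (h_ n * L))).
- near=> n; have h0 : 0 < h_ n by rewrite invr_gt0.
  have hL0 : 0 <= h_ n * L by rewrite mulr_ge0 // ltW.
  have /andP[e1 e2] := expR_sub1_le hL0.
  rewrite ler_pdivlMr // mulrC e1 ler_pdivrMr //=.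
  by rewrite (mulrC _ (n.+1%:R^-1)) mulrA.
- exact: cvg_cst.
- rewrite -[X in _ --> X]mulr1; apply: cvgM; first exact: cvg_cst.
  by rewrite -[X in _ --> X]expR0; exact: (cvg_comp _ _ hL (@continuous_expR R 0)).
Unshelve. all: by end_near. Qed.

Lemma powR_cvgn0 (u : nat -> R) (eta : R) : 0 < eta -> (forall n, 0 < u n) ->
  u n @[n --> \oo] --> (0 : R) -> u n `^ eta @[n --> \oo] --> (0 : R).
Proof.
move=> eta0 u0 uc; apply: (@cvg_comp _ _ _ u (fun a => a `^ eta) _ (0 : R)^'+); last exact: powR_cvg0.
move=> A /= nA; change (\forall n \near \oo, A (u n)).
have : \forall n \near \oo, (0 < u n -> A (u n)) := uc _ nA.
by apply: filterS => n /(_ (u0 n)).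
Qed.

End SmallTimeLimits.

Section FatouBound.
Context {R : realType} {d : measure_display} {Om : measurableType d}.
Variable mu : {measure set Om -> \bar R}.

Lemma fatou_le (f_ : nat -> Om -> \bar R) (f : Om -> \bar R) (u : nat -> \bar R) l :
  (forall n, measurable_fun [set: Om] (f_ n)) ->
  (forall n w, 0 <= f_ n w)%E -> (forall w, f_ n w @[n --> \oo] --> f w) ->
  (forall n, \int[mu]_w f_ n w <= u n)%E -> u n @[n --> \oo] --> l ->
  (\int[mu]_w f w <= l)%E.
Proof.
move=> mf_ f_0 f_f le_u u_l.
have := @fatou _ _ _ mu _ measurableT _ mf_ (fun n w _ => f_0 n w).
have -> : (\int[mu]_x limn_einf (f_^~ x) = \int[mu]_x f x)%E.
  apply: eq_integral => x _; rewrite is_cvg_limn_einfE; last exact: cvgP (f_f x).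
  exact: cvg_lim (f_f x).
move=> /le_trans; apply; rewrite -(cvg_lim _ u_l) // -is_cvg_limn_einfE; last exact: cvgP u_l.
rewrite !limn_einf_lim; apply: lee_lim; [exact: is_cvg_einfs|exact: is_cvg_einfs|].
apply: nearW => n; apply: le_ereal_inf_tmp => _ [k /= nk <-].
by apply: le_trans (le_u k); apply: ereal_inf_lbound; exists k.
Qed.

End FatouBound.

(** * Dirichlet series with nonnegative coefficients *)

Section Dirichlet.
Context {R : realType}.

(** Values in [\bar R] allow a sum of nonnegative terms to diverge. The coefficients [c'] used below
    are those of minus the derivative in T. *)
Definition dirichlet (c lam : nat -> R) (T : R) : \bar R :=
  \sum_(k <oo) (c k * expR (- (lam k * T)))%:E.

Variables (c lam : nat -> R).
Hypothesis c0 : forall k, 0 <= c k.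
Hypothesis lam0 : forall k, 0 <= lam k.

Lemma dirichlet_ge0 T : (0 <= dirichlet c lam T)%E.
Proof. by apply: nneseries_ge0 => k _ _; rewrite lee_fin mulr_ge0 ?expR_ge0. Qed.

Local Notation c' := (fun k => c k * lam k).
Let c'0 k : 0 <= c k * lam k. Proof. by rewrite mulr_ge0. Qed.

(** From lam T / 2 <= e^{lam T / 2}: half of the exponential decay absorbs the factor lam. *)
Lemma dirichlet_deriv_le T : 0 < T ->
  (dirichlet c' lam T <= (2 / T)%:E * dirichlet c lam (T / 2))%E.
Proof.
move=> T0; have T20 : 0 < 2 / T by rewrite divr_gt0.
rewrite /dirichlet -nneseriesZl => [|k _]; last by rewrite lee_fin mulr_ge0 ?expR_ge0.
apply: lee_nneseries => k _; first by move=> _; rewrite lee_fin mulr_ge0 ?expR_ge0.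
rewrite -EFinM lee_fin -mulrA [leRHS]mulrCA ler_wpM2l //.
have -> : expR (- (lam k * T)) = expR (- (lam k * (T / 2))) * expR (- (lam k * (T / 2))).
  by rewrite -expRD; congr expR; field.
rewrite mulrA ler_wpM2r ?expR_ge0 //.
rewrite expRN ler_pdivrMr ?expR_gt0 // -ler_pdivrMl // invf_div.
by apply: le_trans (expR_ge1Dx _); rewrite mulrC lerDr.
Qed.

(** Termwise 1 - x <= e^{-x}. With [dirichlet_drop_ge] this encloses the decrease of the series over
    [T, T + h], divided by h, between the series for [c'] at T + h and at T. *)
Lemma dirichlet_drop_le h T : 0 <= h ->
  (dirichlet c lam T <= dirichlet c lam (T + h) + h%:E * dirichlet c' lam T)%E.
Proof.
move=> h0; rewrite /dirichlet -nneseriesZl => [|k _]; last by rewrite lee_fin mulr_ge0 ?expR_ge0.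
rewrite -nneseriesD => [|k _ _|k _ _]; last 2 first.
- by rewrite lee_fin mulr_ge0 ?expR_ge0.
- by rewrite -EFinM lee_fin mulr_ge0 // mulr_ge0 ?expR_ge0.
apply: lee_nneseries => k _; first by move=> _; rewrite lee_fin mulr_ge0 ?expR_ge0.
rewrite -EFinM -EFinD lee_fin mulrDr opprD expRD.
have := expR_ge1Dx (- (lam k * h)); have := expR_ge0 (- (lam k * T)); have := c0 k.
move: (expR _) (expR _) => a b ? ? ab.
have : 0 <= c k * b * (a + lam k * h - 1) by rewrite mulr_ge0 ?mulr_ge0 //; lra.
by lra.
Qed.

Lemma dirichlet_drop_ge h T : 0 <= h ->
  (dirichlet c lam (T + h) + h%:E * dirichlet c' lam (T + h) <= dirichlet c lam T)%E.
Proof.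
move=> h0; rewrite /dirichlet -nneseriesZl => [|k _]; last by rewrite lee_fin mulr_ge0 ?expR_ge0.
rewrite -nneseriesD => [|k _ _|k _ _]; last 2 first.
- by rewrite lee_fin mulr_ge0 ?expR_ge0.
- by rewrite -EFinM lee_fin mulr_ge0 // mulr_ge0 ?expR_ge0.
apply: lee_nneseries => k _.
  by move=> _; rewrite -EFinM -EFinD lee_fin addr_ge0 // ?mulr_ge0 ?expR_ge0.
rewrite -EFinM -EFinD lee_fin.
have -> : - (lam k * T) = - (lam k * (T + h)) + lam k * h by ring.
rewrite expRD; have := expR_ge1Dx (lam k * h); have := expR_ge0 (- (lam k * (T + h))); have := c0 k.
move: (expR _) (expR _) => a b ? ? ab.
have : 0 <= c k * b * (a - lam k * h - 1) by rewrite mulr_ge0 ?mulr_ge0 //; lra.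
by lra.
Qed.


Lemma dirichlet_deriv_fin : (forall T, 0 < T -> (dirichlet c lam T < +oo)%E) ->
  forall T, 0 < T -> (dirichlet c' lam T < +oo)%E.
Proof.
move=> cfin T T0; apply: le_lt_trans (dirichlet_deriv_le T0) _.
have T20 : 0 < T / 2 by rewrite divr_gt0.
have := cfin _ T20; have := dirichlet_ge0 (T / 2).
by case: (dirichlet _ _ _) => // r _ _; rewrite -EFinM ltry.
Qed.

End Dirichlet.

Section RecursionStep.
Context {R : realType} {d : measure_display} {Om : measurableType d}.
Variables (P : probability Om R) (xi : R -> Om -> R).
Hypothesis rs : regular_subordinator P xi.

Lemma exp_moment_at (u L h : R) : exp_moment P xi u 1 = (expR L)%:E -> 0 <= h ->
  exp_moment P xi u h = (expR (h * L))%:E.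
Proof. by move=> uL h0; rewrite (exp_momentE rs h0) uL ?ltry //= expRK. Qed.

Lemma expfun_small_cvg (T : R) (w : Om) : 0 < T ->
  expfun xi (T + n.+1%:R^-1) w @[n --> \oo] --> expfun xi T w.
Proof.
move=> T0; apply: (@squeeze_cvgr _ _ _ _ (cst (expfun xi T w))
  (fun n => expfun xi T w + n.+1%:R^-1)).
- near=> n; have h0 : 0 <= n.+1%:R^-1 :> R by rewrite invr_ge0.
  rewrite /= (expfun_le (rs_mono rs)) ?lerDl ?(ltW T0) //=.
  rewrite (expfun_shiftedD rs) ?(ltW T0) // lerD2l.
  have /andP[_ W1] := expfun_bounds (shifted0 xi T) (@shifted_mono _ _ _ _ _ rs T) w h0.
  apply: le_trans W1; rewrite ler_piMl //.
    exact: expfun_ge0 (shifted0 xi T) (@shifted_mono _ _ _ _ _ rs T) _ _ h0.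
  by rewrite -expR0 ler_expR oppr_le0 (rs_ge0 rs) // ltW.
- exact: cvg_cst.
- rewrite -[X in _ --> X]addr0; apply: cvgD; first exact: cvg_cst.
  exact: cvg_harmonic.
Unshelve. all: by end_near. Qed.

Lemma small_time_cvg (w : Om) : xi n.+1%:R^-1 w @[n --> \oo] --> (0 : R).
Proof.
apply: (@cvg_comp _ _ _ (fun n : nat => n.+1%:R^-1 : R) (xi^~ w) _ (0 : R)^'+);
  last exact: (rs_right_cvg rs w).
move=> A /= nA; change (\forall n \near \oo, A (n.+1%:R^-1)).
have : \forall n \near \oo, (0 < n.+1%:R^-1 -> A n.+1%:R^-1) := cvg_harmonic nA.
by apply: filterS => n; apply; rewrite invr_gt0.
Qed.

Variables (c lam : nat -> R).
Hypothesis c0 : forall k, 0 <= c k.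
Hypothesis lam0 : forall k, 0 <= lam k.
Local Notation c' := (fun k => c k * lam k).
Local Notation c'' := (fun k => c k * lam k * lam k).
Let c'0 k : 0 <= c k * lam k. Proof. by rewrite mulr_ge0. Qed.
Let c''0 k : 0 <= c k * lam k * lam k. Proof. by rewrite mulr_ge0. Qed.

(** In the application L = - phi(-m) and L' = - phi(-(m + eta)). *)
Variables (m : nat) (eta L L' : R).
Hypothesis m_gt0 : (0 < m)%N.
Hypothesis eta01 : 0 < eta < 1.
Hypothesis momL : exp_moment P xi m%:R 1 = (expR L)%:E.
Hypothesis momL' : exp_moment P xi (m%:R + eta) 1 = (expR L')%:E.
Hypothesis momE : forall T, 0 < T -> inv_moment P xi m%:R T = dirichlet c lam T.
Hypothesis dir_fin : forall T, 0 < T -> (dirichlet c lam T < +oo)%E.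

Let ge0_exponent u l : 0 <= u -> exp_moment P xi u 1 = (expR l)%:E -> 0 <= l.
Proof.
move=> u0 ul; have := exp_moment_mono rs u0 (@ler01 R).
by rewrite ul (exp_moment0 rs) lee_fin -{1}expR0 ler_expR.
Qed.

Let q0 : 0 <= m%:R + eta.
Proof. by rewrite addr_ge0 //; case/andP: eta01 => /ltW. Qed.

Let L0 : 0 <= L. Proof. exact: ge0_exponent momL. Qed.
Let L'0 : 0 <= L'. Proof. exact: ge0_exponent momL'. Qed.

Let dir_finE T : 0 < T -> dirichlet c lam T = (fine (dirichlet c lam T))%:E.
Proof. by move=> T0; rewrite fineK // ge0_fin_numE ?dirichlet_ge0 ?dir_fin //. Qed.

Let d_fin T : 0 < T -> dirichlet c' lam T = (fine (dirichlet c' lam T))%:E.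
Proof.
move=> T0; rewrite fineK // ge0_fin_numE; last exact: dirichlet_ge0.
exact: dirichlet_deriv_fin.
Qed.

Let d2_fin T : 0 < T -> dirichlet c'' lam T = (fine (dirichlet c'' lam T))%:E.
Proof.
move=> T0; rewrite fineK // ge0_fin_numE; last exact: dirichlet_ge0.
by apply: dirichlet_deriv_fin => // S; exact: dirichlet_deriv_fin.
Qed.

(** [X] is an expectation not yet known to be finite; the second premise excludes +oo. *)
Let step_le_arith (X : \bar R) (h M f f' dd : R) : 0 < h ->
  ((m%:R * h)%:E * X + f'%:E <= (M * f)%:E)%E -> f <= f' + h * dd ->
  (X <= ((dd + (M - 1) / h * f) / m%:R)%:E)%E.
Proof.
move=> h0; have mR0 : 0 < m%:R :> R by rewrite ltr0n.
have mh0 : 0 < m%:R * h by rewrite mulr_gt0.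
case: X => [x| |]; [|by rewrite mulry gtr0_sg // mul1e addye // leye_eq|by rewrite leNye].
rewrite -EFinM -EFinD !lee_fin ler_pdivlMr // => e1 e2.
have -> : (M - 1) / h * f = (M * f - f) / h by field; rewrite gt_eqF.
rewrite -lerBlDl ler_pdivlMr //.
by lra.
Qed.

(** [inv_moment_lower] divided by m h, then Fatou's lemma along h = 1 / (n + 1), since e^{-xi_h}
    I_{T+h}^{-m-1} tends to I_T^{-m-1}. This half also shows that E[I_T^{-m-1}] is finite. *)
Lemma inv_moment_step_le T : 0 < T ->
  (m%:R%:E * inv_moment P xi m.+1%:R T <=
   dirichlet c' lam T + L%:E * dirichlet c lam T)%E.
Proof.
move=> T0; rewrite (dir_finE T0) (d_fin T0).
set f := fine (dirichlet c lam T); set dd := fine (dirichlet c' lam T).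
have mR0 : 0 < m%:R :> R by rewrite ltr0n.
pose u n : R := (dd + (expR (n.+1%:R^-1 * L) - 1) / n.+1%:R^-1 * f) / m%:R.
have uc : u n @[n --> \oo] --> (dd + L * f) / m%:R.
  apply: cvgMl; apply: cvgD; first exact: cvg_cst.
  by apply: cvgMl; exact: expR_slope_cvg.
rewrite -(EFinM L f) -EFinD -lee_pdivlMl // -EFinM mulrC.
pose g n w := (expR (- xi n.+1%:R^-1 w) * expfun xi (T + n.+1%:R^-1) w `^ (- m.+1%:R))%:E.
apply: (@fatou_le _ _ _ P g _ (EFin \o u)).
- move=> n; apply: measurable_mul_powR.
    by have /measurable_EFinP := measurable_exp_moment rs (-1) n.+1%:R^-1;
      under eq_fun do rewrite mulN1r.
  apply: measurable_expfun (rs_mono rs) (rs_measurable rs) _ _.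
  by rewrite addr_ge0 ?invr_ge0 // ltW.
- by move=> n w; rewrite lee_fin mulr_ge0 ?expR_ge0 ?powR_ge0.
- move=> w; apply: cvg_EFin; first exact: nearW.
  rewrite -[X in _ --> X]mul1r; apply: cvgM.
    rewrite -[X in _ --> X]expR0 -oppr0.
    have h0 : - xi n.+1%:R^-1 w @[n --> \oo] --> (- 0 : R) by apply: cvgN; exact: small_time_cvg.
    exact: (cvg_comp _ _ h0 (@continuous_expR R (- 0))).
  apply: powR_cvg; last exact: expfun_small_cvg.
  exact: expfun_gt0 (rs_at0 rs) (rs_mono rs) _ _ T0.
- move=> n; have h0 : 0 < n.+1%:R^-1 :> R by rewrite invr_gt0.
  have Th0 : 0 < T + n.+1%:R^-1 by rewrite addr_gt0.
  have Mh := exp_moment_at momL (ltW h0).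
  have := inv_moment_lower rs h0 T0 (m := m); rewrite Mh ltry => /(_ isT).
  rewrite !momE // (dir_finE T0) (dir_finE Th0) -/(g n) -/f.
  set f' := fine _.
  have := dirichlet_drop_le c0 lam0 T (ltW h0); rewrite (dir_finE T0) (dir_finE Th0) (d_fin T0) -/f -/f' -/dd.
  rewrite -!EFinM -!EFinD lee_fin => e1 e2; exact: step_le_arith e2 e1.
- by apply: cvg_EFin => //; exact: nearW.
Qed.

Let X_fin T : 0 < T -> (inv_moment P xi m.+1%:R T < +oo)%E.
Proof.
move=> T0; have := inv_moment_step_le T0; rewrite (dir_finE T0) (d_fin T0) -EFinM -EFinD.
have := inv_moment_ge0 P xi m.+1%:R T; case: (inv_moment _ _ _ _) => [r|_|//]; rewrite ?ltry //.
by rewrite mulry gtr0_sg ?ltr0n // mul1e leye_eq.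
Qed.

Let step_ge_arith (f f' h e e' d2 X A E E' B : R) : 0 < h ->
  e <= e' + h * d2 -> f' + h * e' <= f ->
  E * f + A * B <= f' + m%:R * h * X + A * (E' * B) ->
  (E - 1) / h * f + (e - h * d2) <= m%:R * X + A * ((E' - 1) / h * B).
Proof.
move=> h0 e1 e2 e3.
have -> : (E - 1) / h * f = (E - 1) * f / h by field; rewrite gt_eqF.
have -> : A * ((E' - 1) / h * B) = A * (E' - 1) * B / h by field; rewrite gt_eqF.
have e4 : h * e <= h * (e' + h * d2) by rewrite ler_wpM2l // ltW.
rewrite -lerBrDr ler_pdivrMr //.
have -> : (m%:R * X + A * (E' - 1) * B / h - (e - h * d2)) * h =
    m%:R * h * X + A * (E' * B) - A * B - h * e + h * (h * d2) by field; rewrite gt_eqF.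
lra.
Qed.

(** I_T <= T gives I_T^{-(m + eta)} <= T^{1 - eta} I_T^{-m-1}. *)
Let B_fin T : 0 < T -> (inv_moment P xi (m%:R + eta) T < +oo)%E.
Proof.
move=> T0; have mI : measurable_fun setT (expfun xi T).
  exact: measurable_expfun (rs_mono rs) (rs_measurable rs) _ (ltW T0).
have mp q : measurable_fun setT (fun w => (expfun xi T w `^ q)%:E).
  by apply/measurable_EFinP; apply: (measurableT_comp (measurable_powR _)).
apply: (@le_lt_trans _ _ ((T `^ (1 - eta))%:E * inv_moment P xi m.+1%:R T)%E); last first.
  have := X_fin T0; have := inv_moment_ge0 P xi m.+1%:R T.
  by case: (inv_moment _ _ _ _) => [r _ _|//|//]; rewrite -EFinM ltry.
rewrite /inv_moment -(@ge0_integralZl_EFin _ _ _ P setT) ?powR_ge0 //; last first.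
  by move=> w _; rewrite lee_fin powR_ge0.
apply: ge0_le_integral => //.
- by move=> w _; rewrite lee_fin powR_ge0.
- by apply: emeasurable_funM.
move=> w _; rewrite -EFinM lee_fin.
have I0 : 0 < expfun xi T w by exact: expfun_gt0 (rs_at0 rs) (rs_mono rs) _ _ T0.
have /andP[_ IT] := expfun_bounds (rs_at0 rs) (rs_mono rs) w (ltW T0).
have -> : - (m%:R + eta) = (1 - eta) + - m.+1%:R by rewrite -natr1; ring.
rewrite powRD ?(gt_eqF I0) ?implybT // ler_wpM2r ?powR_ge0 //.
by rewrite ge0_ler_powR ?nnegrE ?subr_ge0 ?(ltW T0) ?(ltW I0) //; case/andP: eta01 => _ /ltW.
Qed.

(** [inv_moment_upper] divided by h: the moments of order m + eta contribute 2 (m h)^eta times a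
    convergent slope, which vanishes in the limit. *)
Lemma inv_moment_step_ge T : 0 < T ->
  (dirichlet c' lam T + L%:E * dirichlet c lam T <=
   m%:R%:E * inv_moment P xi m.+1%:R T)%E.
Proof.
move=> T0.
have fine_E (x : \bar R) : (0 <= x)%E -> (x < +oo)%E -> exists r : R, x = r%:E.
  by case: x => [r|//|//] _ _; exists r.
have [X XE] := fine_E _ (inv_moment_ge0 P xi m.+1%:R T) (X_fin T0).
have [B BE] := fine_E _ (inv_moment_ge0 P xi (m%:R + eta) T) (B_fin T0).
have := dir_finE T0; have := d_fin T0; have := d2_fin T0.
set f := fine (dirichlet c lam T); set dd := fine (dirichlet c' lam T).
set dd2 := fine (dirichlet c'' lam T) => d2E dE fE.
rewrite dE fE XE -!EFinM -!EFinD lee_fin.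
pose h n : R := n.+1%:R^-1.
have hgt0 n : 0 < h n by rewrite invr_gt0.
have mh0 n : 0 < m%:R * h n by rewrite mulr_gt0 // ltr0n.
pose Ah n := 2 * (m%:R * h n) `^ eta.
(* The derivative of the series at T + h is brought back to T at the cost of h times the second
   derivative [dd2]. *)
have lhs_cvg : (expR (h n * L) - 1) / h n * f + (dd - h n * dd2) @[n --> \oo] -->
    L * f + (dd - 0 * dd2).
  apply: cvgD; first by apply: cvgMl; exact: expR_slope_cvg.
  by apply: cvgB; [exact: cvg_cst|apply: cvgMl; exact: cvg_harmonic].
have rhs_cvg : m%:R * X + Ah n * ((expR (h n * L') - 1) / h n * B) @[n --> \oo] -->
    m%:R * X + 2 * 0 * (L' * B).
  apply: cvgD; first exact: cvg_cst.
  apply: cvgM; last by apply: cvgMl; exact: expR_slope_cvg.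
  apply: cvgM; first exact: cvg_cst.
  apply: powR_cvgn0 => //; first by case/andP: eta01.
  rewrite -[X in _ --> X](mulr0 m%:R); apply: cvgM; first exact: cvg_cst.
  exact: cvg_harmonic.
have key n : (expR (h n * L) - 1) / h n * f + (dd - h n * dd2) <=
    m%:R * X + Ah n * ((expR (h n * L') - 1) / h n * B).
  have h0 := hgt0 n; have h0' := ltW h0.
  have Th0 : 0 < T + h n by rewrite addr_gt0.
  have := inv_moment_upper rs m_gt0 eta01 h0 T0.
  rewrite (exp_moment_at momL h0') (exp_moment_at momL' h0') !ltry => /(_ isT isT).
  rewrite !momE // BE XE fE (dir_finE Th0) -/(Ah n).
  have := dirichlet_drop_ge c0 lam0 T h0'; rewrite fE (dir_finE Th0) (d_fin Th0).
  have := dirichlet_drop_le c'0 lam0 T h0'; rewrite dE (d_fin Th0) d2E.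
  move: (fine _) (fine _) => a b; move: (Ah n) (expR (h n * L)) (expR (h n * L')) => A E E'.
  rewrite -!EFinM -!EFinD !lee_fin.
  exact: step_ge_arith.
have lim_le : L * f + (dd - 0 * dd2) <= m%:R * X + 2 * 0 * (L' * B).
  exact: ler_cvg_to lhs_cvg rhs_cvg (nearW _ key).
by move: lim_le; rewrite mul0r subr0 mulr0 mul0r addr0 addrC.
Qed.

Lemma inv_moment_step T : 0 < T ->
  inv_moment P xi m.+1%:R T = dirichlet (fun k => c k * (lam k + L) / m%:R) lam T.
Proof.
move=> T0.
have E : (m%:R%:E * inv_moment P xi m.+1%:R T = dirichlet c' lam T + L%:E * dirichlet c lam T)%E.
  by apply/eqP; rewrite eq_le inv_moment_step_le // inv_moment_step_ge.
have mR0 : m%:R != 0 :> R by rewrite pnatr_eq0 -lt0n.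
have -> : inv_moment P xi m.+1%:R T =
    ((m%:R^-1)%:E * (dirichlet c' lam T + L%:E * dirichlet c lam T))%E.
  by rewrite -E muleA -EFinM mulVf // mul1e.
have t0 (e : nat -> R) k : (forall k, 0 <= e k) -> (0 <= (e k * expR (- (lam k * T)))%:E)%E.
  by move=> e0; rewrite lee_fin mulr_ge0 ?expR_ge0.
rewrite /dirichlet -(nneseriesZl (P := xpredT)) => [|k _]; last exact: t0.
rewrite -nneseriesD => [|k _ _|k _ _]; last 2 first.
- exact: (t0 (fun k => c k * lam k)).
- by apply: mule_ge0; [rewrite lee_fin|exact: t0].
rewrite -(nneseriesZl (P := xpredT)) => [|k _]; last first.
  apply: adde_ge0; first exact: (t0 (fun k => c k * lam k)).
  by apply: mule_ge0; [rewrite lee_fin|exact: t0].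
apply: eq_eseriesr => k _; rewrite -(EFinM L) -EFinD -EFinM; congr _%:E.
by field.
Qed.

Lemma inv_moment_step_fin T : 0 < T ->
  (dirichlet (fun k => (c k * (lam k + L) / m%:R)%R) lam T < +oo)%E.
Proof. by move=> T0; rewrite -inv_moment_step // X_fin. Qed.

End RecursionStep.

(** * Series for the first inverse moment *)

Section BaseSeriesAnalysis.
Context {R : realType}.

Lemma one_sub_expR_bounds (y : R) : 0 <= y -> y - y * y <= 1 - expR (- y) <= y.
Proof.
move=> y0; have := expR_ge1Dx y; have := expR_ge1Dx (- y).
have := expRxMexpNx_1 y; have := expR_gt0 (- y).
move: (expR y) (expR (- y)) => a b *; apply/andP; split; last by lra.
have e1 : b * (1 + y) <= 1 by nra.
have e2 : (1 - y + y * y - b) * (1 + y) >= 0 by nra.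
have y1 : 0 < 1 + y by lra.
by move: e2; rewrite pmulr_lge0 //; lra.
Qed.

Lemma one_sub_expR_cvg (y : nat -> R) (l : R) : (forall n, 0 <= y n) ->
  n.+1%:R * y n @[n --> \oo] --> l ->
  n.+1%:R * (1 - expR (- y n)) @[n --> \oo] --> l.
Proof.
move=> y0 yl; apply: (@squeeze_cvgr _ _ _ _
  (fun n => n.+1%:R * y n - n.+1%:R^-1 * (n.+1%:R * y n * (n.+1%:R * y n)))
  (fun n => n.+1%:R * y n)) => //.
  apply: nearW => n; have /andP[b1 b2] := one_sub_expR_bounds (y0 n).
  rewrite !ler_wpM2l // ?ler0n // andbT.
  apply: le_trans (ler_wpM2l (ler0n _ _) b1); rewrite le_eqVlt; apply/orP; left.
  by apply/eqP; field.
have lE : l = l - 0 * (l * l) by rewrite mul0r subr0.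
rewrite [X in _ --> X]lE; apply: cvgB => //; apply: cvgM; first exact: cvg_harmonic.
exact: cvgM.
Qed.

Lemma log_ratio_le x : 0 <= x -> log_ratio x <= 1 + x :> R.
Proof.
move=> x0; rewrite /log_ratio; case: eqP => [->|/eqP x1]; first by rewrite addr0.
have xp : 0 < x by rewrite lt0r x1.
have e1 : 1 + x <= expR x := expR_ge1Dx x.
have e2 := expRxMexpNx_1 x; have e3 := expR_gt0 (- x).
have e4 : expR (- x) < 1 by rewrite expR_lt1 oppr_lt0.
rewrite ler_pdivrMr ?subr_gt0 //; move: e1 e2 e3 e4.
by move: (expR x) (expR (- x)) => a b *; nra.
Qed.

(** At x = 0 every term of the series vanishes while [log_ratio] is 1; the last summand repairs
    this, and [no_atom_at0] later removes it from the expectation. *)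
Lemma log_ratio_geometric (x : R) : 0 <= x ->
  ((log_ratio x)%:E = \sum_(k <oo) (x * expR (- k%:R * x))%:E + (x == 0)%:R%:E)%E.
Proof.
move=> x0; rewrite /log_ratio; case: eqP => [->|/eqP x1].
  rewrite eseries0 ?add0e // => k _ _; by rewrite mul0r.
have xp : 0 < x by rewrite lt0r x1.
have q1 : `|expR (- x)| < 1 by rewrite ger0_norm ?expR_ge0 // expR_lt1 oppr_lt0.
rewrite adde0; apply/esym/cvg_lim => //.
have := @cvg_geometric_series R x _ q1 => gc.
have gE : (fun n => (\sum_(0 <= k < n) (x * expR (- k%:R * x))%:E)%E) =
    EFin \o series (geometric x (expR (- x))).
  apply/funext => n /=; rewrite sumEFin /series /=; congr _%:E.
  by apply: eq_bigr => k _; rewrite -expRM_natl mulrN mulNr.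
by rewrite gE; apply: cvg_EFin => //; exact: nearW.
Qed.

End BaseSeriesAnalysis.

Section BaseSeries.
Context {R : realType} {d : measure_display} {Om : measurableType d}.
Variables (P : probability Om R) (xi : R -> Om -> R).
Hypothesis rs : regular_subordinator P xi.
(** [Lam] is phi on the nonnegative reals; its derivative at an integer enters as the limit of
    difference quotients with step 1 / (n + 1). *)
Variables (Lam : R -> R) (dLam : nat -> R).
Hypothesis LamE : forall x, 0 <= x -> exp_moment P xi (- x) 1 = (expR (- Lam x))%:E.
Hypothesis dLamE : forall k : nat,
  n.+1%:R * (Lam (k%:R + n.+1%:R^-1) - Lam k%:R) @[n --> \oo] --> dLam k.
Hypothesis Lam_oo : Lam k%:R @[k --> \oo] --> +oo.

Let mxi t : measurable_fun setT (xi t). Proof. exact: rs_measurable rs _. Qed.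

Let mexp u t : measurable_fun setT (fun w => expR (u * xi t w)).
Proof. by have /measurable_EFinP := measurable_exp_moment rs u t. Qed.

Let mzero t : measurable [set w | xi t w = 0].
Proof. by rewrite -[X in measurable X]setTI; exact: (@mxi t measurableT [set 0] (measurable_set1 _)). Qed.

Let mk t (k : nat) : measurable_fun setT (fun w => (xi t w * expR (- k%:R * xi t w))%:E).
Proof. by apply/measurable_EFinP; apply: measurable_funM. Qed.

Let momE x t : 0 <= x -> 0 <= t -> exp_moment P xi (- x) t = (expR (- (Lam x * t)))%:E.
Proof. by move=> x0 t0; rewrite (exp_moment_at rs (LamE x0)) // mulrN mulrC. Qed.

Lemma exponent_mono x y : 0 <= x -> x <= y -> Lam x <= Lam y.
Proof.
move=> x0 xy; have y0 := le_trans x0 xy; rewrite -lerN2 -ler_expR -lee_fin -!LamE //.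
apply: ge0_le_integral => //; try exact: (measurable_exp_moment rs).
by move=> w _; rewrite lee_fin ler_expR ler_wpM2r ?lerN2 // (rs_ge0 rs).
Qed.

Lemma exponent_slope_ge0 k n : 0 <= Lam (k%:R + n.+1%:R^-1) - Lam k%:R.
Proof. by rewrite subr_ge0 exponent_mono ?lerDl. Qed.

Lemma exponent_deriv_ge0 k : 0 <= dLam k.
Proof.
have key n : 0 <= n.+1%:R * (Lam (k%:R + n.+1%:R^-1) - Lam k%:R).
  by rewrite mulr_ge0 ?exponent_slope_ge0.
by apply: (cvgr_to_ge (@dLamE k)); apply: nearW.
Qed.

(** Differentiates E[e^{-x xi_t}] = e^{-t Lam(x)} at x = k through difference quotients. The
    quotient inside the expectation stays below its limit xi_t e^{-k xi_t}, so [cvg_integral_below]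
    applies. *)
Lemma first_moment (k : nat) (t : R) : 0 < t ->
  (\int[P]_w (xi t w * expR (- k%:R * xi t w))%:E =
   (t * (dLam k * expR (- (Lam k%:R * t))))%:E)%E.
Proof.
move=> t0; have t0' := ltW t0.
pose h n : R := n.+1%:R^-1.
have h0 n : 0 <= h n by rewrite invr_ge0.
pose g (n : nat) w := expR (- k%:R * xi t w) * (n.+1%:R * (1 - expR (- (h n * xi t w)))).
have x0 w : 0 <= xi t w := rs_ge0 rs w t0'.
have g0 n w : 0 <= g n w.
  rewrite mulr_ge0 ?expR_ge0 // mulr_ge0 // subr_ge0 -[leRHS]expR0 ler_expR.
  by rewrite oppr_le0 mulr_ge0.
have mg n : measurable_fun setT (fun w => (g n w)%:E).
  apply/measurable_EFinP; apply: measurable_funM => //.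
  apply: measurable_funM => //; apply: measurable_funB => //.
  by have := mexp (- h n) t; under eq_fun do rewrite mulNr.
have gI n : (\int[P]_w (g n w)%:E)%E =
    (n.+1%:R * (1 - expR (- ((Lam (k%:R + h n) - Lam k%:R) * t))) *
      expR (- (Lam k%:R * t)))%:E.
  (* Stated as an addition; the moments are subtracted only once they are known to be finite. *)
  have fin1 : (\int[P]_w (g n w)%:E + n.+1%:R%:E * exp_moment P xi (- (k%:R + h n)) t =
      n.+1%:R%:E * exp_moment P xi (- k%:R) t)%E.
    have mE u : measurable_fun setT (fun w => (expR (u * xi t w))%:E).
      exact: (measurable_exp_moment rs).
    have E0 u w : [set: Om] w -> (0 <= (expR (u * xi t w))%:E)%E.
      by rewrite lee_fin expR_ge0.
    rewrite /exp_moment -(@ge0_integralZl_EFin _ _ _ P setT _ _ (E0 _)) //.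
    rewrite -(@ge0_integralZl_EFin _ _ _ P setT _ _ (E0 (- k%:R))) //.
    rewrite -ge0_integralD //; last 2 first.
    - by move=> w _; rewrite lee_fin.
    - by apply: emeasurable_funM => //; exact: (measurable_exp_moment rs).
    apply: eq_integral => w _; rewrite -!EFinM -EFinD; congr _%:E.
    rewrite /g opprD mulrDl expRD mulNr (mulNr (h n)).
    by move: (expR _) (expR _) => a b; ring.
  have e1 : (n.+1%:R%:E * exp_moment P xi (- (k%:R + h n)) t)%E =
      (n.+1%:R * expR (- (Lam (k%:R + h n) * t)))%:E by rewrite momE ?addr_ge0 -?EFinM.
  have e2 : (n.+1%:R%:E * exp_moment P xi (- k%:R) t)%E =
      (n.+1%:R * expR (- (Lam k%:R * t)))%:E by rewrite momE -?EFinM.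
  move: fin1; rewrite e1 e2; case: (integral _ _ _) => [r| |//]; last by [].
  rewrite -EFinD => -[] rE; congr _%:E.
  have -> : r = n.+1%:R * expR (- (Lam k%:R * t)) - n.+1%:R * expR (- (Lam (k%:R + h n) * t)).
    by rewrite -rE addrK.
  have -> : - (Lam (k%:R + h n) * t) =
    - ((Lam (k%:R + h n) - Lam k%:R) * t) + - (Lam k%:R * t) by ring.
  by rewrite expRD; move: (expR _) (expR _) => a b; ring.
have c1 : (\int[P]_w (g n w)%:E)%E @[n --> \oo] -->
    (\int[P]_w (xi t w * expR (- k%:R * xi t w))%:E)%E.
  apply: cvg_integral_below => //.
  - move=> n w; rewrite !lee_fin g0 /g mulrC ler_wpM2r ?expR_ge0 //.
    have /andP[_ b] := one_sub_expR_bounds (mulr_ge0 (h0 n) (x0 w)).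
    by rewrite -ler_pdivlMl // mulrC in b *; rewrite mulrC.
  - move=> w; apply: cvg_EFin; first exact: nearW.
    rewrite mulrC; apply: cvgM; first exact: cvg_cst.
    apply: one_sub_expR_cvg => [n|]; first by rewrite mulr_ge0.
    have -> : (fun n => n.+1%:R * (h n * xi t w)) = cst (xi t w).
      by apply/funext => n; rewrite mulrA divff // mul1r.
    exact: cvg_cst.
have c2 : (\int[P]_w (g n w)%:E)%E @[n --> \oo] -->
    (t * (dLam k * expR (- (Lam k%:R * t))))%:E.
  rewrite (_ : (fun n => _) = EFin \o (fun n => n.+1%:R *
      (1 - expR (- ((Lam (k%:R + h n) - Lam k%:R) * t))) * expR (- (Lam k%:R * t)))); last first.
    by apply/funext => n /=; rewrite gI.
  apply: cvg_EFin; first exact: nearW.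
  rewrite mulrA; apply: cvgMl; apply: one_sub_expR_cvg => [n|].
    by rewrite mulr_ge0 ?exponent_slope_ge0.
  rewrite mulrC; under eq_fun do rewrite mulrA.
  by apply: cvgMl; exact: (@dLamE k).
exact: eq_cvg_ereal c1 c2 (fun=> erefl).
Qed.

(** P(xi_t = 0) <= E[e^{-k xi_t}] = e^{-t Lam(k)} for every k, and Lam(k) tends to infinity. *)
Lemma no_atom_at0 (t : R) : 0 < t -> P [set w | xi t w = 0] = 0%E.
Proof.
move=> t0; have t0' := ltW t0.
apply/eqP; rewrite eq_le measure_ge0 andbT.
have c1 : (expR (- (Lam k%:R * t)))%:E @[k --> \oo] --> (0 : \bar R).
  apply: cvg_EFin; first exact: nearW.
  have Lt : Lam k%:R * t @[k --> \oo] --> +oo.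
    move/cvgryPge: Lam_oo => Lam_ge; apply/cvgryPge => A.
    by apply: filterS (Lam_ge (A / t)) => k; rewrite ler_pdivrMr.
  exact: (cvg_comp _ _ Lt (@cvgr_expR R)).
apply: (@lee_cvg_to _ _ _ _ (cst (P [set w | xi t w = 0])) _ _ _ (cvg_cst _) c1).
apply: nearW => k /=; rewrite -(momE (ler0n _ k) t0') -(setIT [set w | _]).
rewrite -integral_indic //; apply: ge0_le_integral => //.
- by apply/measurable_EFinP.
- exact: (measurable_exp_moment rs).
- move=> w _; rewrite lee_fin indicE; case: (boolP (w \in _)) => [|_]; last exact: expR_ge0.
  by rewrite inE /= => ->; rewrite mulr0 expR0.
Qed.

Lemma inv_moment1 (t : R) : 0 < t ->
  inv_moment P xi 1 t = dirichlet dLam (fun k => Lam k%:R) t.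
Proof.
move=> t0; have t0' := ltW t0.
have x0 w : 0 <= xi t w := rs_ge0 rs w t0'.
have k0 (k : nat) w : (0 <= (xi t w * expR (- k%:R * xi t w))%:E)%E.
  by rewrite lee_fin mulr_ge0 ?expR_ge0.
have e1 : (t%:E * inv_moment P xi 1 t = t%:E * dirichlet dLam (fun k => Lam k%:R) t)%E.
  rewrite /inv_moment (expfun_inv_moment rs t0).
  transitivity (\int[P]_w (\sum_(k <oo) (xi t w * expR (- k%:R * xi t w))%:E +
      (\1_[set w | xi t w = 0] w)%:E))%E.
    apply: eq_integral => w _; rewrite log_ratio_geometric //; congr (_ + _%:E)%E.
    by rewrite indicE; congr (nat_of_bool _)%:R; apply/eqP/idP; rewrite inE.
  rewrite ge0_integralD //; last 3 first.
  - by move=> w _; apply: nneseries_ge0 => k _ _.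
  - exact: ge0_emeasurable_sum.
  - by apply/measurable_EFinP.
  have -> : (\int[P]_w (\1_[set w | xi t w = 0] w)%:E = 0)%E.
    by rewrite integral_indic // setIT; exact: no_atom_at0.
  rewrite adde0.
  rewrite integral_nneseries // /dirichlet -nneseriesZl => [|k _]; last first.
    by rewrite lee_fin mulr_ge0 ?expR_ge0 ?exponent_deriv_ge0.
  by apply: eq_eseriesr => k _; rewrite first_moment // EFinM.
have tV : (1 = (t^-1)%:E * t%:E :> \bar R)%E by rewrite -EFinM mulVf // gt_eqF.
by move: e1; move: (inv_moment _ _ _ _) (dirichlet _ _ _) => a b e1; rewrite -[a]mul1e -[b]mul1e tV -!muleA e1.
Qed.

Let mlog (t : R) : 0 < t -> measurable_fun setT (fun w => (log_ratio (xi t w))%:E).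
Proof.
move=> t0; have t0' := ltW t0.
apply: (eq_measurable_fun (fun w => \sum_(k <oo) (xi t w * expR (- k%:R * xi t w))%:E +
      (\1_[set w | xi t w = 0] w)%:E)%E).
  move=> w _; rewrite log_ratio_geometric ?(rs_ge0 rs) //; congr (_ + _%:E)%E.
  by rewrite indicE; congr (nat_of_bool _)%:R; apply/idP/eqP; rewrite inE.
apply: emeasurable_funD; last by apply/measurable_EFinP.
apply: ge0_emeasurable_sum => [k w _ _|k _].
  by rewrite lee_fin mulr_ge0 ?expR_ge0 ?(rs_ge0 rs).
exact: mk.
Qed.

(** t E[1 / I_t] <= 1 + E[xi_t], and the right side is finite by [first_moment] at k = 0. *)
Lemma inv_moment1_fin (t : R) : 0 < t -> (dirichlet dLam (fun k => Lam k%:R) t < +oo)%E.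
Proof.
move=> t0; have t0' := ltW t0.
have x0 w : 0 <= xi t w := rs_ge0 rs w t0'.
rewrite -inv_moment1 //.
have : (t%:E * inv_moment P xi 1 t < +oo)%E.
  rewrite /inv_moment (expfun_inv_moment rs t0).
  apply: (@le_lt_trans _ _ (\int[P]_w (1 + (xi t w)%:E))%E).
    apply: ge0_le_integral => //.
    - by move=> w _; rewrite lee_fin log_ratio_ge0.
    - exact: mlog.
    - by apply: emeasurable_funD => //; apply/measurable_EFinP.
    - by move=> w _; rewrite -EFinD lee_fin log_ratio_le.
  rewrite ge0_integralD //; last 2 first.
  - by move=> w _; rewrite lee_fin.
  - by apply/measurable_EFinP.
  have -> : (\int[P]_w 1 = 1)%E.
    by rewrite integral_cst // mul1e; exact: probability_setT.
  have -> : (\int[P]_w (xi t w)%:E = (t * (dLam 0 * expR (- (Lam 0%:R * t))))%:E)%E.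
    rewrite -first_moment //; apply: eq_integral => w _.
    by rewrite oppr0 mul0r expR0 mulr1.
  by rewrite -EFinD ltry.
have := inv_moment_ge0 P xi 1 t.
case: (inv_moment _ _ _ _) => [r _ _|_|//]; first exact: ltry.
by rewrite mulry gtr0_sg // mul1e.
Qed.

End BaseSeries.

(** * Complex differentiation and Cauchy's formula *)

Section ComplexTopology.
Context {R : realType}.
Implicit Types z w : R[i].

Lemma norm_normc z : `|z| = (normc z)%:C.
Proof. by rewrite normc_def; case: z. Qed.

Lemma normc_ge0 z : 0 <= normc z.
Proof. by case: z => a b; exact: sqrtr_ge0. Qed.

Lemma normcR (x : R) : normc x%:C = `|x|.
Proof. by rewrite /normc /= expr0n addr0 sqrtr_sqr. Qed.

Lemma normc_Re z : `|complex.Re z| <= normc z.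
Proof. by rewrite -lecR -norm_normc normc_ge_Re. Qed.

Lemma normc_Im z : `|complex.Im z| <= normc z.
Proof.
case: z => a b; rewrite /normc /= -sqrtr_sqr ler_sqrt ?addr_ge0 ?sqr_ge0 //.
by rewrite lerDr sqr_ge0.
Qed.

Lemma normc_le z : normc z <= `|complex.Re z| + `|complex.Im z|.
Proof.
case: z => a b /=; rewrite -[leRHS]ger0_norm ?addr_ge0 // -sqrtr_sqr.
rewrite ler_sqrt ?sqr_ge0 // sqrrD !real_normK ?num_real // lerD2r lerDl.
by rewrite mulrn_wge0 // mulr_ge0.
Qed.

Lemma normcB z w : normc (z - w) = normc (w - z).
Proof. by rewrite -normcN opprB. Qed.

Lemma cvg_normcP {T} {F : set_system T} {FF : Filter F} (g : T -> R[i]) (l : R[i]) :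
  (g x : R[i]^o) @[x --> F] --> (l : R[i]^o) <->
  forall e : R, 0 < e -> \forall x \near F, normc (g x - l) < e.
Proof.
split=> [/cvgrPdist_lt gl e e0|gl].
  have := gl e%:C; rewrite ltcR => /(_ e0); apply: filterS => x.
  by rewrite norm_normc ltcR normcB.
apply/cvgrPdist_lt => -[e e']; rewrite ltcE /= => /andP[/eqP -> e0].
apply: filterS (gl _ e0) => x; by rewrite normcB complexr0 -ltcR -norm_normc.
Qed.

Lemma cvg_complexP {T} {F : set_system T} {FF : Filter F} (g : T -> R[i]) (l : R[i]) :
  (g x : R[i]^o) @[x --> F] --> (l : R[i]^o) <->
  complex.Re (g x) @[x --> F] --> complex.Re l /\
  complex.Im (g x) @[x --> F] --> complex.Im l.
Proof.
have ReB x y : complex.Re (x - y) = complex.Re x - complex.Re y :> R by case: x y => ? ? [].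
have ImB x y : complex.Im (x - y) = complex.Im x - complex.Im y :> R by case: x y => ? ? [].
split=> [/cvg_normcP gl|[/cvgrPdist_lt gr /cvgrPdist_lt gi]].
  split; apply/cvgrPdist_lt => e e0; apply: filterS (gl _ e0) => x;
    rewrite distrC -?ReB -?ImB; exact: le_lt_trans (normc_Re _) + exact: le_lt_trans (normc_Im _).
apply/cvg_normcP => e e0; have e20 : 0 < e / 2 by rewrite divr_gt0.
apply: filterS2 (gr _ e20) (gi _ e20) => x xr xi.
apply: le_lt_trans (normc_le _) _; rewrite ReB ImB (splitr e).
by rewrite ltrD // distrC.
Qed.

End ComplexTopology.

Section DeriveLocal.
Context {K : numFieldType}.

(** First-order expansion without quotients, over any numeric field: it serves for the real
    functions exp, cos and sin as well as for maps of R[i]. *)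
Lemma is_derive_localP (f : K -> K) (z l : K) :
  is_derive (z : K^o) 1 (f : K^o -> K^o) l <->
  forall e : K, 0 < e -> exists2 s : K, 0 < s &
    forall y, `|y - z| < s -> `|f y - f z - l * (y - z)| <= e * `|y - z|.
Proof.
have slopeE (h : K) : h != 0 ->
    `|h^-1 * (f (h + z) - f z) - l| * `|h| = `|f (h + z) - f z - l * (h + z - z)|.
  move=> h0; rewrite -normrM mulrC mulrBr mulrA divff // mul1r addrK; congr `|_ - _|.
  exact: mulrC.
pose q (h : K) : K := h^-1 * (f (h + z) - f z).
have qE : (fun h : K^o => h^-1 *: ((f : K^o -> K^o) (h *: (1 : K^o) + z) - f z)) = q.
  by apply/funext => h; rewrite /q /GRing.scale /= mulr1.
split=> [[df dv] e e0|loc].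
  have : (q h : K^o) @[h --> (0 : K^o)^'] --> (l : K^o) by rewrite -dv -qE; exact: df.
  move=> /cvgrPdist_lt/(_ e e0); rewrite near_withinE => /nbhs_normP[s /= s0 H].
  exists s => // y ys; have [->|yz] := eqVneq y z.
    by rewrite !subrr mulr0 subrr normr0 mulr0.
  have yz0 : y - z != 0 by rewrite subr_eq0.
  have := slopeE _ yz0; rewrite subrK => <-; rewrite ler_wpM2r //.
  by rewrite ltW // distrC -[X in f X](subrK z y); apply: H => //=; rewrite sub0r normrN.
have ql : (q h : K^o) @[h --> (0 : K^o)^'] --> (l : K^o).
  apply/cvgrPdist_lt => e e0; have e20 : 0 < e / 2 by rewrite divr_gt0.
  have [s s0 H] := loc _ e20; rewrite near_withinE; apply/(@nbhs_normP _ K^o).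
  exists s => // h /=; rewrite sub0r normrN => hs h0.
  have := H (h + z); rewrite -slopeE // addrK => /(_ hs).
  rewrite ler_pM2r ?normr_gt0 // distrC => /le_lt_trans; apply.
  by rewrite ltr_pdivrMr // ltr_pMr // ltr1n.
by split; [apply: cvgP; rewrite qE; exact: ql|apply: cvg_lim => //; rewrite qE; exact: ql].
Qed.

End DeriveLocal.

Section ComplexExponential.
Context {R : realType}.
Implicit Types z w : R[i].

Lemma cderivable_localP (f : R[i] -> R[i]) (z l : R[i]) :
  is_derive (z : R[i]^o) 1 (f : R[i]^o -> R[i]^o) l <->
  forall e : R, 0 < e -> exists2 s : R, 0 < s &
    forall y, normc (y - z) < s -> normc (f y - f z - l * (y - z)) <= e * normc (y - z).
Proof.
split=> [/is_derive_localP loc e e0|loc].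
  have [|[s s']] := loc e%:C; first by rewrite ltcR.
  rewrite ltcE /= => /andP[/eqP -> s0] H; exists s => // y ys.
  by have := H y; rewrite !norm_normc complexr0 ltcR -rmorphM lecR; apply.
apply/is_derive_localP => -[e e']; rewrite ltcE /= => /andP[/eqP -> e0].
have [s s0 H] := loc e e0; exists s%:C; first by rewrite ltcR.
by move=> y; rewrite !norm_normc complexr0 ltcR -rmorphM lecR; exact: H.
Qed.

Lemma cexpD z w : cexp (z + w) = cexp z * cexp w.
Proof.
case: z w => a b [x y]; rewrite /cexp /= expRD cosD sinD.
by apply/eqP; rewrite eq_complex /=; apply/andP; split; apply/eqP; ring.
Qed.

Lemma cexp0 : cexp 0 = 1 :> R[i].
Proof. by rewrite /cexp /= expR0 cos0 sin0 mul1r. Qed.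

Lemma normc_cexp z : normc (cexp z) = expR (complex.Re z).
Proof.
rewrite /cexp normcM normcR ger0_norm ?expR_ge0 //.
by rewrite /normc /= cos2Dsin2 sqrtr1 mulr1.
Qed.

Lemma cexpR (x : R) : cexp x%:C = (expR x)%:C.
Proof. by rewrite /cexp /= cos0 sin0 mulr1. Qed.

(** The real part of cexp h - 1 - h is e^x cos y - 1 - x and the imaginary part e^x sin y - y; each
    is controlled by the real derivatives at 0. *)
Let cexp_local0 (e : R) : 0 < e -> exists2 s : R, 0 < s &
  forall h, normc h < s -> normc (cexp h - 1 - h) <= e * normc h.
Proof.
(* 9 = (3 + 1) + (3 + 2) collects the coefficients of [c * n] in [kk] and [bb] below. *)
move=> e_gt0; have [c [c0 ce c1]] : exists c : R, [/\ 0 < c, c * 9 <= e & c <= 1].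
  exists (Num.min (e / 9) 1); split; first by rewrite lt_min divr_gt0 //= ltr01.
  - by rewrite -ler_pdivlMr // ge_min lexx.
  - by rewrite ge_min lexx orbT.
have [s1 s10 H1] := (is_derive_localP expR 0 (expR 0)).1 (is_derive_expR 0) c c0.
have [s2 s20 H2] := (is_derive_localP sin 0 (cos 0)).1 (is_derive_sin 0) c c0.
have [s3 s30 H3] := (is_derive_localP cos 0 (- sin 0)).1 (is_derive_cos 0) c c0.
exists (Num.min c (Num.min s1 (Num.min s2 s3))); first by rewrite !lt_min c0 s10 s20 s30.
move=> h; rewrite !lt_min => /and4P[hc hs1 hs2 hs3].
have hx := normc_Re h; have hy := normc_Im h; apply: le_trans (normc_le _) _.
move: (normc h) hc hs1 hs2 hs3 hx hy => n hc hs1 hs2 hs3; case: h => x y /= hx hy.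
have := H1 x; have := H2 y; have := H3 y.
rewrite !subr0 expR0 sin0 cos0 oppr0 !mul0r !mul1r !subr0 => /(_ (le_lt_trans hy hs3)) C.
move=> /(_ (le_lt_trans hy hs2)) S /(_ (le_lt_trans hx hs1)) E.
have xb : `|x| <= c by rewrite ltW // (le_lt_trans hx hc).
move: E S C; rewrite ?oppr0 !addr0.
move: (expR x) (sin y) (cos y) => a b k E S C.
have n0 : 0 <= n := le_trans (normr_ge0 _) hx.
have a1 : `|a - 1| <= 2 * c.
  rewrite -[a - 1](subrK x); apply: le_trans (ler_normD _ _) _.
  have : c * `|x| <= 1 * c by rewrite ler_pM // ltW.
  lra.
have a3 : `|a| <= 3.
  rewrite -[a](subrK 1); apply: le_trans (ler_normD _ _) _; rewrite normr1; lra.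
have kk : `|a * k - 1 - x| <= 3 * (c * n) + c * n.
  have -> : a * k - 1 - x = a * (k - 1) + (a - 1 - x) by ring.
  apply: le_trans (ler_normD _ _) _; rewrite normrM lerD ?ler_pM //.
    by apply: le_trans C _; rewrite ler_wpM2l // ltW.
  by apply: le_trans E _; rewrite ler_wpM2l // ltW.
have bb : `|a * b - y| <= 3 * (c * n) + 2 * c * n.
  have -> : a * b - y = a * (b - y) + (a - 1) * y by ring.
  apply: le_trans (ler_normD _ _) _; rewrite !normrM lerD ?ler_pM //.
  by apply: le_trans S _; rewrite ler_wpM2l // ltW.
have : c * 9 * n <= e * n by rewrite ler_wpM2r.
lra.
Qed.

(** The addition formula factors out cexp (- f z), which reduces the chain rule to the expansion of
    [cexp] at 0. *)
Lemma is_derive_cexp_opp (f : R[i] -> R[i]) (z l : R[i]) :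
  is_derive (z : R[i]^o) 1 (f : R[i]^o -> R[i]^o) l ->
  is_derive (z : R[i]^o) 1 ((fun y => cexp (- f y)) : R[i]^o -> R[i]^o) (- (cexp (- f z) * l)).
Proof.
move=> /cderivable_localP loc; apply/cderivable_localP => e e0.
set q := normc (cexp (- f z)); have q0 : 0 < q by rewrite /q normc_cexp expR_gt0.
pose e1 := e / 2 / (q * (1 + normc l)).
have l1 : 0 < 1 + normc l by rewrite ltr_pwDl ?normc_ge0.
have e10 : 0 < e1 by rewrite !divr_gt0 // mulr_gt0.
pose e2 := Num.min 1 (e / 2 / q).
have e20 : 0 < e2 by rewrite lt_min ltr01 !divr_gt0.
have [s1 s10 H1] := cexp_local0 e10.
have [s2 s20 H2] := loc e2 e20.
exists (Num.min s2 (s1 / (1 + normc l))); first by rewrite lt_min s20 divr_gt0.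
move=> y; rewrite lt_min => /andP[y2 y1].
have fy := H2 y y2; set dy := y - z in y1 y2 fy *; set df := f y - f z in fy.
have dy0 := normc_ge0 dy.
have dfb : normc df <= (1 + normc l) * normc dy.
  rewrite -[df](subrK (l * dy)); apply: le_trans (le_normcD _ _) _.
  rewrite mulrDl normcM lerD2r; apply: le_trans fy _.
  by rewrite ler_wpM2r // /e2 ge_min lexx.
have dfs : normc (- df) < s1.
  by rewrite normcN; apply: le_lt_trans dfb _; rewrite mulrC -ltr_pdivlMr.
have -> : cexp (- f y) - cexp (- f z) - - (cexp (- f z) * l) * dy =
    cexp (- f z) * ((cexp (- df) - 1 - (- df)) - (df - l * dy)).
  have -> : - f y = - f z - df by rewrite /df; ring.
  by rewrite cexpD; ring.
rewrite normcM -/q; have := H1 _ dfs; rewrite normcN => H3.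
have : normc (cexp (- df) - 1 - - df - (df - l * dy)) <=
    e1 * ((1 + normc l) * normc dy) + e2 * normc dy.
  apply: le_trans (le_normcD _ _) _; rewrite normcN lerD //.
  by apply: le_trans H3 _; rewrite ler_wpM2l // ltW.
move=> /(ler_wpM2l (ltW q0)) /le_trans; apply.
have -> : q * (e1 * ((1 + normc l) * normc dy) + e2 * normc dy) =
    e / 2 * normc dy + q * e2 * normc dy by rewrite /e1; field; rewrite !gt_eqF.
have : q * e2 <= e / 2 by rewrite mulrC -ler_pdivlMr // /e2 ge_min lexx orbT.
move=> /(ler_wpM2r dy0); lra.
Qed.

End ComplexExponential.

(** * Goursat's subdivision argument *)

Section RectangleFunction.
Context {R : realType}.
(** [Phi a b c d] is a function of the rectangle [a, b] x [c, d], additive under cuts in both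
    directions and, at every point, small compared with the squared size of the rectangles
    containing it. *)
Variable Phi : R -> R -> R -> R -> R[i].
Variables a0 b0 c0 d0 : R.
Hypothesis Phi_add1 : forall a m b c d, a0 <= a -> a <= m -> m <= b -> b <= b0 ->
  c0 <= c -> c <= d -> d <= d0 -> Phi a b c d = Phi a m c d + Phi m b c d.
Hypothesis Phi_add2 : forall a b c m d, a0 <= a -> a <= b -> b <= b0 ->
  c0 <= c -> c <= m -> m <= d -> d <= d0 -> Phi a b c d = Phi a b c m + Phi a b m d.
Hypothesis Phi_local : forall p q, a0 <= p <= b0 -> c0 <= q <= d0 ->
  forall e : R, 0 < e -> exists2 s : R, 0 < s & forall a b c d,
    a0 <= a -> a <= p -> p <= b -> b <= b0 -> c0 <= c -> c <= q -> q <= d -> d <= d0 ->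
    b - a < s -> d - c < s -> normc (Phi a b c d) <= e * (b - a + (d - c)) ^+ 2.

Let rect := (R * R * R * R)%type.
Let phi (Q : rect) := normc (Phi Q.1.1.1 Q.1.1.2 Q.1.2 Q.2).
Let valid (Q : rect) := [/\ a0 <= Q.1.1.1, Q.1.1.1 <= Q.1.1.2, Q.1.1.2 <= b0,
  c0 <= Q.1.2 & Q.1.2 <= Q.2] /\ Q.2 <= d0.

Let halving (Q Q' : rect) := [/\ Q.1.1.1 <= Q'.1.1.1, Q'.1.1.2 <= Q.1.1.2,
    Q.1.2 <= Q'.1.2 & Q'.2 <= Q.2] /\
  [/\ Q'.1.1.2 - Q'.1.1.1 = (Q.1.1.2 - Q.1.1.1) / 2,
    Q'.2 - Q'.1.2 = (Q.2 - Q.1.2) / 2 & phi Q <= 4 * phi Q'].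

(** Some quarter carries at least a quarter of the norm. The premise [valid Q] sits inside the
    existential so that [choice] gives a total step function. *)
Let bisect (Q : rect) : exists Q' : rect, valid Q -> valid Q' /\ halving Q Q'.
Proof.
have [vQ|] := pselect (valid Q); last by exists Q.
case: Q vQ => [[[a b] c] d] [/= [h1 h2 h3 h4 h5] h6].
pose m := (a + b) / 2; pose k := (c + d) / 2.
have am : a <= m by rewrite /m; lra.
have mb : m <= b by rewrite /m; lra.
have ck : c <= k by rewrite /k; lra.
have kd : k <= d by rewrite /k; lra.
have E : Phi a b c d = Phi a m c k + Phi a m k d + (Phi m b c k + Phi m b k d).
  rewrite (@Phi_add1 a m b) ?(@Phi_add2 a m c k d) ?(@Phi_add2 m b c k d) //; lra.
have : normc (Phi a b c d) <= normc (Phi a m c k) + normc (Phi a m k d) +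
    (normc (Phi m b c k) + normc (Phi m b k d)).
  by rewrite E; apply: le_trans (le_normcD _ _) _; rewrite lerD ?le_normcD.
move=> le4.
have quarter a' b' c' d' : a <= a' -> b' <= b -> c <= c' -> d' <= d ->
    b' - a' = (b - a) / 2 -> d' - c' = (d - c) / 2 ->
    normc (Phi a b c d) <= 4 * normc (Phi a' b' c' d') ->
    exists Q', valid (a, b, c, d) -> valid Q' /\ halving (a, b, c, d) Q'.
  move=> aa bb cc dd ba dc le; exists (a', b', c', d') => _; rewrite /valid /halving /phi /=.
  by split; [|split]; repeat split => //; lra.
have [l1|l1] := leP (normc (Phi a b c d)) (4 * normc (Phi a m c k)).
  by apply: (quarter a m c k) => //; rewrite /m /k; lra.
have [l2|l2] := leP (normc (Phi a b c d)) (4 * normc (Phi a m k d)).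
  by apply: (quarter a m k d) => //; rewrite /m /k; lra.
have [l3|l3] := leP (normc (Phi a b c d)) (4 * normc (Phi m b c k)).
  by apply: (quarter m b c k) => //; rewrite /m /k; lra.
by apply: (quarter m b k d) => //; rewrite /m /k; lra.
Qed.

(** The chosen quarters shrink to a point, and there |Phi(Q_0)| <= 4^n |Phi(Q_n)| <= e S^2 with S
    the half-perimeter of Q_0 and e arbitrary. *)
Lemma goursat_bisection : a0 <= b0 -> c0 <= d0 -> Phi a0 b0 c0 d0 = 0.
Proof.
move=> ab0 cd0; apply/eq0_normc/eqP; rewrite eq_le normc_ge0 andbT leNgt; apply/negP => M0.
have [step stepP] := choice bisect.
pose Q n := iter n step (a0, b0, c0, d0).
have vQ n : valid (Q n).
  by elim: n => [|n /stepP[]//]; rewrite /valid /=; repeat split.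
have hQ n : halving (Q n) (Q n.+1) by case: (stepP _ (vQ n)).
pose al n := (Q n).1.1.1; pose be n := (Q n).1.1.2; pose ga n := (Q n).1.2; pose de n := (Q n).2.
have mono (u : nat -> R) : (forall n, u n <= u n.+1) -> forall m n, (m <= n)%N -> u m <= u n.
  by move=> u_mono m n; exact: (homo_leq (@lexx _ _) (@le_trans _ _)).
have al_mono := mono al (fun n => let: conj (And4 h _ _ _) _ := hQ n in h).
have ga_mono := mono ga (fun n => let: conj (And4 _ _ h _) _ := hQ n in h).
have be_mono m n : (m <= n)%N -> be n <= be m.
  move=> mn; rewrite -lerN2; apply: (mono (fun n => - be n)) mn => k.
  by rewrite lerN2; have [[]] := hQ k.
have de_mono m n : (m <= n)%N -> de n <= de m.
  move=> mn; rewrite -lerN2; apply: (mono (fun n => - de n)) mn => k.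
  by rewrite lerN2; have [[]] := hQ k.
have alN m n : al m <= be n.
  apply: (@le_trans _ _ (al (maxn m n))); first by rewrite al_mono ?leq_maxl.
  apply: (@le_trans _ _ (be (maxn m n))); last by rewrite be_mono ?leq_maxr.
  by have [[]] := vQ (maxn m n).
have gaN m n : ga m <= de n.
  apply: (@le_trans _ _ (ga (maxn m n))); first by rewrite ga_mono ?leq_maxl.
  apply: (@le_trans _ _ (de (maxn m n))); last by rewrite de_mono ?leq_maxr.
  by have [[]] := vQ (maxn m n).
pose p := sup (range al); pose q := sup (range ga).
have pn n : al n <= p <= be n.
  apply/andP; split.
    by apply: ub_le_sup; [exists (be 0%N) => _ [m _ <-]|exists n].
  by apply: ge_sup; [exists (al 0%N), 0%N|move=> _ [m _ <-]].
have qn n : ga n <= q <= de n.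
  apply/andP; split.
    by apply: ub_le_sup; [exists (de 0%N) => _ [m _ <-]|exists n].
  by apply: ge_sup; [exists (ga 0%N), 0%N|move=> _ [m _ <-]].
have w1 n : be n - al n = (b0 - a0) / 2 ^+ n.
  elim: n => [|n IH]; first by rewrite divr1.
  by have [_ [e1 _ _]] := hQ n; rewrite /be /al e1 -/(al n) -/(be n) IH exprSr invfM mulrA.
have w2 n : de n - ga n = (d0 - c0) / 2 ^+ n.
  elim: n => [|n IH]; first by rewrite divr1.
  by have [_ [_ e1 _]] := hQ n; rewrite /de /ga e1 -/(ga n) -/(de n) IH exprSr invfM mulrA.
set M := normc (Phi a0 b0 c0 d0) in M0.
have phiM n : M <= 4 ^+ n * phi (Q n).
  elim: n => [|n IH]; first by rewrite mul1r.
  apply: le_trans IH _; rewrite exprSr -mulrA ler_wpM2l ?exprn_ge0 //.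
  by have [_ []] := hQ n.
set S := b0 - a0 + (d0 - c0).
have S0 : 0 <= S by rewrite /S; lra.
(* Chosen so that e S^2 < M. *)
pose e := M / (S ^+ 2 + 1).
have S20 : 0 < S ^+ 2 + 1 by rewrite ltr_wpDl ?sqr_ge0.
have e0 : 0 < e by rewrite divr_gt0.
have [s s0 loc] := Phi_local (pn 0%N) (qn 0%N) e0.
have cv : S / 2 ^+ n @[n --> \oo] --> (0 : R).
  have -> : (fun n => S / 2 ^+ n) = geometric S 2^-1.
    by apply/funext => n; rewrite /geometric /= exprVn.
  by apply: cvg_geometric; rewrite ger0_norm // invf_lt1 // ltr1n.
have /cvgrPdist_lt/(_ s s0) := cv.
move=> [n _ /(_ n (leqnn n))] /=; rewrite sub0r normrN ger0_norm; last first.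
  by rewrite divr_ge0 ?exprn_ge0.
have P2 : 0 < 2 ^+ n :> R by rewrite exprn_gt0.
have wS : be n - al n + (de n - ga n) = S / 2 ^+ n by rewrite w1 w2 -mulrDl.
have wl1 : 0 <= be n - al n by rewrite subr_ge0 alN.
have wl2 : 0 <= de n - ga n by rewrite subr_ge0 gaN.
move=> Ss; have /andP[p1 p2] := pn n; have /andP[q1 q2] := qn n.
have [[v1 v2 v3 v4 v5] v6] := vQ n.
have := loc (al n) (be n) (ga n) (de n) v1 p1 p2 v3 v4 q1 q2 v6.
rewrite wS => /(_ _ _) H.
have : phi (Q n) <= e * (S / 2 ^+ n) ^+ 2 by apply: H; lra.
have P4 : 0 <= 4 ^+ n :> R by rewrite exprn_ge0.
move=> /(ler_wpM2l P4) /(le_trans (phiM n)).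
have -> : 4 ^+ n * (e * (S / 2 ^+ n) ^+ 2) = e * S ^+ 2.
  have -> : 4 = 2 ^+ 2 :> R by ring.
  by rewrite -exprM mulnC exprM; field; rewrite gt_eqF.
rewrite leNgt /e mulrAC ltr_pdivrMr // => /negP; apply.
by rewrite ltr_pM2l // ltrDl.
Qed.

End RectangleFunction.

(** * Integrals of complex functions over a segment *)

Section ComplexIntegral.
Context {R : realType}.
Local Notation mu := (@lebesgue_measure R).
Implicit Types (g h : R -> R[i]) (a b m : R).

Definition ccontinuous_at g (x : R) : Prop := (g y : R[i]^o) @[y --> x] --> (g x : R[i]^o).
(** Continuity at the endpoints is two-sided as well. *)
Definition ccontinuous_on a b g : Prop := forall x, a <= x <= b -> ccontinuous_at g x.

Definition cint a b g : R[i] := cintegral mu `[a, b] g.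

Lemma ccontinuous_cst (c : R[i]) x : ccontinuous_at (fun=> c) x.
Proof. exact: cvg_cst. Qed.

Lemma ccontinuousM g h x : ccontinuous_at g x -> ccontinuous_at h x ->
  ccontinuous_at (fun y => g y * h y) x.
Proof. by move=> gx hx; exact: (@cvgM _ _ _ _ g h _ _ gx hx). Qed.

Lemma ccontinuousD g h x : ccontinuous_at g x -> ccontinuous_at h x ->
  ccontinuous_at (fun y => g y + h y) x.
Proof. by move=> gx hx; exact: (@cvgD _ (R[i]^o) _ _ _ g h _ _ gx hx). Qed.

Lemma ccontinuousN g x : ccontinuous_at g x -> ccontinuous_at (fun y => - g y) x.
Proof. by move=> gx; exact: (@cvgN _ (R[i]^o) _ _ _ g _ gx). Qed.

Lemma ccontinuousV g x : g x != 0 -> ccontinuous_at g x -> ccontinuous_at (fun y => (g y)^-1) x.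
Proof. by move=> g0 gx; exact: (@cvgV _ _ _ _ g _ g0 gx). Qed.

Lemma ccontinuous_ReIm g x : (complex.Re (g y) @[y --> x] --> complex.Re (g x)) ->
  (complex.Im (g y) @[y --> x] --> complex.Im (g x)) -> ccontinuous_at g x.
Proof. by move=> gr gi; apply/cvg_complexP. Qed.

Lemma itv_integrable (u : R -> R) a b :
  (forall x, a <= x <= b -> u y @[y --> x] --> u x) ->
  mu.-integrable `[a, b] (EFin \o u).
Proof.
move=> uc; apply: continuous_compact_integrable; first exact: segment_compact.
by apply: continuous_in_subspaceT => x; rewrite inE /= in_itv /=; exact: uc.
Qed.

Let iRe a b g : ccontinuous_on a b g -> mu.-integrable `[a, b] (EFin \o (fun x => complex.Re (g x))).
Proof. by move=> gc; apply: itv_integrable => x /gc /cvg_complexP[]. Qed.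

Let iIm a b g : ccontinuous_on a b g -> mu.-integrable `[a, b] (EFin \o (fun x => complex.Im (g x))).
Proof. by move=> gc; apply: itv_integrable => x /gc /cvg_complexP[]. Qed.

Lemma eq_cint a b g h : (forall x, a <= x <= b -> g x = h x) -> cint a b g = cint a b h.
Proof.
move=> gh; rewrite /cint /cintegral; congr (_ +i* _); apply: eq_Rintegral => x;
  by rewrite inE /= in_itv /= => /gh ->.
Qed.

Lemma cintD a b g h : ccontinuous_on a b g -> ccontinuous_on a b h ->
  cint a b (fun x => g x + h x) = cint a b g + cint a b h.
Proof.
move=> gc hc; rewrite /cint /cintegral.
have -> : (fun x => complex.Re (g x + h x)) = (fun x => complex.Re (g x) + complex.Re (h x)).
  by apply/funext => x; case: (g x) (h x) => ? ? [].
have -> : (fun x => complex.Im (g x + h x)) = (fun x => complex.Im (g x) + complex.Im (h x)).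
  by apply/funext => x; case: (g x) (h x) => ? ? [].
by rewrite !RintegralD //; [exact: iIm|exact: iIm|exact: iRe|exact: iRe].
Qed.

Lemma cintZ a b (c : R[i]) g : ccontinuous_on a b g ->
  cint a b (fun x => c * g x) = c * cint a b g.
Proof.
move=> gc; have ir := iRe gc; have ii := iIm gc; rewrite /cint /cintegral.
have Z (k : R) u : mu.-integrable `[a, b] (EFin \o u) ->
    mu.-integrable `[a, b] (EFin \o (fun x => k * u x)).
  by move=> iu; rewrite (_ : _ \o _ = (fun x => k%:E * (EFin \o u) x)%E) //; exact: integrableZl.
have -> : (fun x => complex.Re (c * g x)) =
    (fun x => complex.Re c * complex.Re (g x) - complex.Im c * complex.Im (g x)).
  by apply/funext => x; case: c (g x) => ? ? [].
have -> : (fun x => complex.Im (c * g x)) =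
    (fun x => complex.Re c * complex.Im (g x) + complex.Im c * complex.Re (g x)).
  by apply/funext => x; case: c (g x) => ? ? [? ?] /=.
rewrite RintegralB; [|by []|exact: Z|exact: Z].
rewrite RintegralD; [|by []|exact: Z|exact: Z].
by rewrite !RintegralZl //; case: (c).
Qed.

Lemma cintB a b g h : ccontinuous_on a b g -> ccontinuous_on a b h ->
  cint a b (fun x => g x - h x) = cint a b g - cint a b h.
Proof.
move=> gc hc; have hN : ccontinuous_on a b (fun x => - h x).
  by move=> x /hc; exact: ccontinuousN.
rewrite (cintD gc hN); congr (_ + _); rewrite -mulN1r -(cintZ _ hc).
by apply: eq_cint => x _; rewrite mulN1r.
Qed.

Lemma ccontinuous_sum a b (n : nat) (g : nat -> R -> R[i]) :
  (forall k, ccontinuous_on a b (g k)) -> ccontinuous_on a b (fun x => \sum_(k < n) g k x).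
Proof.
move=> gc x xab; elim: n => [|n IH]; rewrite /ccontinuous_at.
  by under eq_fun do rewrite big_ord0; rewrite big_ord0; exact: cvg_cst.
under eq_fun do rewrite big_ord_recr /=; rewrite big_ord_recr /=.
by apply: (ccontinuousD IH); exact: gc.
Qed.

Lemma cint_sum a b (n : nat) (g : nat -> R -> R[i]) :
  (forall k, ccontinuous_on a b (g k)) ->
  cint a b (fun x => \sum_(k < n) g k x) = \sum_(k < n) cint a b (g k).
Proof.
move=> gc; elim: n => [|n IH].
  rewrite [RHS]big_ord0; apply: etrans (etrans (cintZ 0 (gc 0%N)) (mul0r _)).
  by apply: eq_cint => x _; rewrite big_ord0 mul0r.
rewrite big_ord_recr /= -IH -(cintD (@ccontinuous_sum _ _ n _ gc) (gc n)).
by apply: eq_cint => x _; rewrite big_ord_recr.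
Qed.

Let Rint_split (u : R -> R) a m b : a <= m -> m <= b -> mu.-integrable `[a, b] (EFin \o u) ->
  Rintegral mu `[a, b] u = Rintegral mu `[a, m] u + Rintegral mu `[m, b] u.
Proof.
move=> am mb iu; have := @Rintegral_itvB R u _ _ m iu.
rewrite !bnd_simp => /(_ am mb) /eqP; rewrite subr_eq => /eqP ->.
rewrite addrC; congr (_ + _); apply: Rintegral_itv_obnd_cbnd.
by apply: integrableS iu => //; apply: subset_itvr; rewrite bnd_simp.
Qed.

Lemma cint_split a m b g : a <= m -> m <= b -> ccontinuous_on a b g ->
  cint a b g = cint a m g + cint m b g.
Proof.
move=> am mb gc; rewrite /cint /cintegral (Rint_split am mb (iRe gc)).
by rewrite (Rint_split am mb (iIm gc)).
Qed.

Lemma lebesgue_segment a b : a <= b -> fine (mu `[a, b]%classic) = b - a.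
Proof.
move=> ab; rewrite lebesgue_measure_itv /= lte_fin; case: ltP => [_ //|ba].
by have -> : b = a by [apply/eqP; rewrite eq_le ab ba]; rewrite subrr.
Qed.

Let Rint_bound (u : R -> R) a b (C : R) : a <= b -> mu.-integrable `[a, b] (EFin \o u) ->
  (forall x, a <= x <= b -> `|u x| <= C) -> `|Rintegral mu `[a, b] u| <= C * (b - a).
Proof.
move=> ab iu uC; apply: le_trans (le_normr_Rintegral _ iu) _ => //.
have -> : C * (b - a) = Rintegral mu `[a, b] (fun=> C).
  by rewrite Rintegral_cst // lebesgue_segment.
apply: le_Rintegral => //.
- by have := integrable_norm iu.
- by apply: itv_integrable => x _; exact: cvg_cst.
Qed.

(** The factor 2 comes from bounding the real and imaginary parts separately. *)
Lemma cint_bound a b g (C : R) : a <= b -> ccontinuous_on a b g ->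
  (forall x, a <= x <= b -> normc (g x) <= C) -> normc (cint a b g) <= 2 * C * (b - a).
Proof.
move=> ab gc gC; apply: le_trans (normc_le _) _ => /=.
have -> : 2 * C * (b - a) = C * (b - a) + C * (b - a) by ring.
apply: lerD; apply: Rint_bound => //.
- exact: iRe.
- by move=> x /gC; apply: le_trans; exact: normc_Re.
- exact: iIm.
- by move=> x /gC; apply: le_trans; exact: normc_Im.
Qed.

Lemma cint_cst a b (k : R[i]) : a <= b -> cint a b (fun=> k) = k * (b - a)%:C.
Proof.
move=> ab; rewrite /cint /cintegral !Rintegral_cst // lebesgue_segment //; case: k => x y.
by apply/eqP; rewrite eq_complex /= !mulr0 subr0 add0r !eqxx.
Qed.

Lemma Rint_FTC (F f : R -> R) a b : a <= b -> (forall x : R, is_derive x 1 F (f x)) ->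
  continuous f -> Rintegral mu `[a, b] f = F b - F a.
Proof.
move=> ab Ff fc; have [<-|ab'] := eqVneq a b.
  by rewrite set_itv1 Rintegral_set1 subrr.
rewrite /Rintegral (@continuous_FTC2 _ f F) //.
- by rewrite lt_neqAle ab'.
- by apply: continuous_in_subspaceT => x _; exact: fc.
- have Fc x : F y @[y --> x] --> F x.
    by apply: differentiable_continuous; apply/derivable1_diffP; exact: ex_derive.
  split.
  + by move=> x _; exact: ex_derive.
  + by apply: cvg_at_right_filter; exact: Fc.
  + by apply: cvg_at_left_filter; exact: Fc.
- by move=> x _; rewrite derive1E; exact: derive_val.
Qed.

End ComplexIntegral.

Section UnitCircle.
Context {R : realType}.

Definition cis (x : R) : R[i] := cos x +i* sin x.

Lemma normc_cis x : normc (cis x) = 1.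
Proof. by rewrite /normc /= cos2Dsin2 sqrtr1. Qed.

Lemma cis_continuous x : ccontinuous_at cis x.
Proof. by apply: ccontinuous_ReIm; [exact: continuous_cos|exact: continuous_sin]. Qed.

Lemma cisD x y : cis (x + y) = cis x * cis y.
Proof. by rewrite /cis cosD sinD; apply/eqP; rewrite eq_complex /= eqxx addrC eqxx. Qed.

Lemma cis0 : cis 0 = 1. Proof. by rewrite /cis cos0 sin0. Qed.

Lemma cisN x : cis x * cis (- x) = 1.
Proof. by rewrite -cisD subrr cis0. Qed.

Lemma cis_2pi : cis (2 * pi) = 1.
Proof. by rewrite /cis mulr_natl cos2pi sin2pi. Qed.

Lemma cis_Nexp x n : cis (- x) ^+ n = cis (- (n%:R * x)).
Proof.
elim: n => [|n IH]; first by rewrite mul0r oppr0 cis0.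
by rewrite exprS IH -cisD; congr cis; rewrite -natr1; ring.
Qed.

Lemma cint_cis a b : a <= b -> cint a b (fun x => 'i * cis x) = cis b - cis a.
Proof.
move=> ab; rewrite /cint /cintegral.
have -> : (fun x => complex.Re ('i * cis x)) = (fun x => - sin x).
  by apply/funext => x; rewrite /= mul0r mul1r sub0r.
have -> : (fun x => complex.Im ('i * cis x)) = cos.
  by apply/funext => x; rewrite /= mul0r mul1r add0r.
rewrite (@Rint_FTC _ cos) //; last by move=> x; apply: cvgN; exact: continuous_sin.
by rewrite (@Rint_FTC _ sin) //; exact: continuous_cos.
Qed.

Lemma cis_lipschitz x y : normc (cis x - cis y) <= 2 * `|x - y|.
Proof.
wlog xy : x y / y <= x => [H|].
  by have [/ltW/H|/H//] := ltP x y; rewrite normcB distrC.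
rewrite ger0_norm ?subr_ge0 // -cint_cis // -[2]mulr1; apply: cint_bound => //.
  by move=> z _; apply: ccontinuousM; [exact: ccontinuous_cst|exact: cis_continuous].
by move=> z _; rewrite normcM normc_cis mulr1 /normc /= expr0n expr1n add0r sqrtr1.
Qed.

Lemma cint_cis_Nexp n : cint 0 (2 * pi) (fun x => cis (- x) ^+ n) =
  (if n is 0%N then 2 * pi else 0)%:C.
Proof.
have pi20 : 0 <= 2 * pi :> R by rewrite mulr_ge0 ?pi_ge0.
rewrite /cint /cintegral; case: n => [|n].
  by rewrite !Rintegral_cst // lebesgue_segment // subr0 mul1r mul0r.
have n0 : n.+1%:R != 0 :> R by [].
have -> : (fun x => complex.Re (cis (- x) ^+ n.+1)) = (fun x => cos (n.+1%:R * x)).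
  by apply/funext => x; rewrite cis_Nexp /= cosN.
have -> : (fun x => complex.Im (cis (- x) ^+ n.+1)) = (fun x => - sin (n.+1%:R * x)).
  by apply/funext => x; rewrite cis_Nexp /= sinN.
have lc : continuous (fun x : R => n.+1%:R * x) by move=> x; apply: cvgM; [exact: cvg_cst|exact: cvg_id].
have lin (x : R) : is_derive x 1 (fun y : R => n.+1%:R * y) n.+1%:R.
  by apply: (is_derive_eq (is_deriveZ n.+1%:R (is_derive_id x 1))); rewrite /GRing.scale /= mulr1.
have dsin (x : R) : is_derive x 1 (fun y : R => n.+1%:R^-1 * sin (n.+1%:R * y)) (cos (n.+1%:R * x)).
  apply: (is_derive_eq (is_deriveZ n.+1%:R^-1 (is_derive1_comp (is_derive_sin (n.+1%:R * x)) (lin x)))).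
  by rewrite /GRing.scale /=; field.
have dcos (x : R) : is_derive x 1 (fun y : R => n.+1%:R^-1 * cos (n.+1%:R * y)) (- sin (n.+1%:R * x)).
  apply: (is_derive_eq (is_deriveZ n.+1%:R^-1 (is_derive1_comp (is_derive_cos (n.+1%:R * x)) (lin x)))).
  by rewrite /GRing.scale /=; field.
have ccos : continuous (fun x : R => cos (n.+1%:R * x)).
  by move=> x; apply: (cvg_comp _ _ (lc x)); exact: continuous_cos.
have csin : continuous (fun x : R => - sin (n.+1%:R * x)).
  by move=> x; apply: cvgN; apply: (cvg_comp _ _ (lc x)); exact: continuous_sin.
rewrite (Rint_FTC pi20 dsin ccos) (Rint_FTC pi20 dcos csin).
have /eqP := cis_Nexp (- (2 * pi)) n.+1.
rewrite opprK cis_2pi expr1n mulrN opprK eq_complex /= => /andP[/eqP <- /eqP <-].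
by rewrite !mulr0 sin0 cos0 mulr0 !subrr.
Qed.

End UnitCircle.

(** * Cauchy's formula on a disc *)

Section CauchyDisc.
Context {R : realType}.
Variables (f : R[i] -> R[i]) (c w : R[i]) (r : R).
Hypothesis fD : forall z, normc (z - c) <= r -> cderivable f z.
Hypothesis wD : normc (w - c) < r.

Let r0 : 0 < r := le_lt_trans (normc_ge0 _) wD.
Let gap : 0 < r - normc (w - c). Proof. by rewrite subr_gt0. Qed.
Let pi20 : 0 <= 2 * pi :> R. Proof. by rewrite mulr_ge0 ?pi_ge0. Qed.

Let fc z : normc (z - c) <= r -> (f y : R[i]^o) @[y --> (z : R[i]^o)] --> (f z : R[i]^o).
Proof.
by move=> /fD /derivable1_diffP /differentiable_continuous.
Qed.

(* The circle is contracted to w by W l x = w + l * zeta x, and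
   f(W) dW / (W - w) = K1 dl + K2 dx.  The affine part of f contributes exactly
   0 to the circulation of this form around a rectangle in (l, x). *)
Let zeta x : R[i] := c - w + r%:C * cis x.
Let dzeta x : R[i] := r%:C * ('i * cis x).
Let W l x : R[i] := w + l%:C * zeta x.

Let zeta_neq0 x : zeta x != 0.
Proof.
apply/eqP => z0; have : r%:C * cis x = w - c by apply/eqP; rewrite -subr_eq0 opprB addrC -/(zeta x) z0.
by move=> /(congr1 (@normc R)) /eqP; rewrite normcM normc_cis mulr1 normcR gtr0_norm // gt_eqF.
Qed.

Let zeta_ge x : r - normc (w - c) <= normc (zeta x).
Proof.
rewrite lerBlDr; have := le_normcD (zeta x) (w - c).
have -> : zeta x + (w - c) = r%:C * cis x by rewrite /zeta; ring.
by rewrite normcM normc_cis mulr1 normcR gtr0_norm.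
Qed.

Let zeta_le x : normc (zeta x) <= 2 * r.
Proof.
apply: le_trans (le_normcD _ _) _.
rewrite normcM normc_cis mulr1 normcR gtr0_norm // normcB.
by have := ltW wD; lra.
Qed.

Let W_in l x : 0 <= l <= 1 -> normc (W l x - c) <= r.
Proof.
move=> /andP[l0 l1].
have -> : W l x - c = (1 - l)%:C * (w - c) + (l * r)%:C * cis x.
  by rewrite /W /zeta !rmorphE /=; ring.
apply: le_trans (le_normcD _ _) _; rewrite !normcM normc_cis mulr1 !normcR.
rewrite !ger0_norm ?subr_ge0 ?mulr_ge0 // ?(ltW r0) //.
have : (1 - l) * normc (w - c) <= (1 - l) * r by rewrite ler_wpM2l ?subr_ge0 // ltW.
lra.
Qed.

Let W_lip l x l' x' : 0 <= l' <= 1 ->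
  normc (W l x - W l' x') <= 2 * r * (`|l - l'| + `|x - x'|).
Proof.
move=> /andP[l0 l1].
have -> : W l x - W l' x' = (l - l')%:C * zeta x + (l' * r)%:C * (cis x - cis x').
  by rewrite /W /zeta !rmorphE /=; ring.
apply: le_trans (le_normcD _ _) _; rewrite !normcM !normcR mulrDr.
rewrite lerD //; first by rewrite mulrC ler_wpM2r.
rewrite ger0_norm ?mulr_ge0 // ?(ltW r0) //.
have := ler_wpM2l (ltW r0) (cis_lipschitz x x'); have := normc_ge0 (cis x - cis x').
move: (normc _) => k k0 kr.
have : l' * (r * k) <= r * k by rewrite ler_piMl // mulr_ge0 // ltW.
rewrite mulrA; lra.
Qed.

(** The part of dW / (W - w) along x; it does not depend on l because W - w = l zeta(x). *)
Let kappa x : R[i] := dzeta x / zeta x.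

Let zeta_cont x : ccontinuous_at zeta x.
Proof.
apply: ccontinuousD; first exact: ccontinuous_cst.
by apply: ccontinuousM; [exact: ccontinuous_cst|exact: cis_continuous].
Qed.

Let dzeta_cont x : ccontinuous_at dzeta x.
Proof.
do 2![apply: ccontinuousM; first exact: ccontinuous_cst].
exact: cis_continuous.
Qed.

Let kappa_cont x : ccontinuous_at kappa x.
Proof.
apply: ccontinuousM; first exact: dzeta_cont.
by apply: ccontinuousV => //; exact: zeta_cont.
Qed.

Let kappa_le x : normc (kappa x) <= r / (r - normc (w - c)).
Proof.
have z0 : 0 < normc (zeta x) by exact: lt_le_trans gap (zeta_ge x).
rewrite /kappa /dzeta !normcM normcV normc_cis mulr1 normcR (gtr0_norm r0).
have -> : normc 'i = 1 :> R by rewrite /normc /= expr0n expr1n add0r sqrtr1.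
by rewrite mulr1 ler_wpM2l ?(ltW r0) // lef_pV2 ?posrE.
Qed.

Let fW_theta l x : 0 <= l <= 1 -> ccontinuous_at (fun y => f (W l y)) x.
Proof.
move=> l01; have Wc : ccontinuous_at (W l) x.
  apply: ccontinuousD; first exact: ccontinuous_cst.
  by apply: ccontinuousM; [exact: ccontinuous_cst|exact: zeta_cont].
exact: (cvg_comp _ _ Wc (fc (W_in x l01))).
Qed.

Let fW_lambda l x : 0 <= l <= 1 -> ccontinuous_at (fun y => f (W y x)) l.
Proof.
move=> l01; have Wc : ccontinuous_at (W^~ x) l.
  apply: ccontinuousD; first exact: ccontinuous_cst.
  apply: ccontinuousM; last exact: ccontinuous_cst.
  by apply: ccontinuous_ReIm; [exact: cvg_id|exact: cvg_cst].
exact: (cvg_comp _ _ Wc (fc (W_in x l01))).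
Qed.

(** The part of dW / (W - w) along l is 1 / l for the same reason, which is why the rectangles are
    kept in l >= eps > 0. *)
Let K1 l x : R[i] := f (W l x) / l%:C.
Let K2 l x : R[i] := f (W l x) * kappa x.

Let K1_cont l x : 0 < l <= 1 -> ccontinuous_at (K1^~ x) l.
Proof.
move=> /andP[l0 l1]; apply: ccontinuousM; first by apply: fW_lambda; rewrite ltW.
apply: (@ccontinuousV _ (fun y => y%:C)).
  by rewrite eq_complex /= eqxx andbT gt_eqF.
by apply: ccontinuous_ReIm; [exact: cvg_id|exact: cvg_cst].
Qed.

Let K2_cont l x : 0 <= l <= 1 -> ccontinuous_at (K2 l) x.
Proof. by move=> l01; apply: ccontinuousM; [exact: fW_theta|exact: kappa_cont]. Qed.

(** Circulation of K1 dl + K2 dx around [a, b] x [t, u]. Opposite sides are paired under one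
    integral, so that constants cancel in the integrands. *)
Let Phi (a b t u : R) : R[i] :=
  cint t u (fun x => K2 b x - K2 a x) - cint a b (fun l => K1 l u - K1 l t).

Let PhiE a b t u : 0 < a <= 1 -> 0 < b <= 1 -> Phi a b t u =
  (cint t u (K2 b) - cint t u (K2 a)) - (cint a b (K1^~ u) - cint a b (K1^~ t)).
Proof.
move=> /andP[a0 a1] /andP[b0 b1]; rewrite /Phi; congr (_ - _); apply: cintB => x.
- by move=> _; apply: K2_cont; rewrite (ltW b0).
- by move=> _; apply: K2_cont; rewrite (ltW a0).
- by move=> /andP[ax xb]; apply: K1_cont; rewrite (lt_le_trans a0 ax) (le_trans xb b1).
- by move=> /andP[ax xb]; apply: K1_cont; rewrite (lt_le_trans a0 ax) (le_trans xb b1).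
Qed.

(** The linear part of f at W p q contributes f'(W p q) (b - a) (zeta u - zeta t) to both integrals
    and cancels. The remainder is at most e1 times the distance to W p q, which is O(D), and it is
    integrated over lengths at most D. *)
Let Phi_local (eps p q e : R) : 0 < eps -> eps <= p <= 1 -> 0 < e ->
  exists2 s : R, 0 < s & forall a b t u,
    eps <= a -> a <= p -> p <= b -> b <= 1 -> t <= q -> q <= u ->
    b - a < s -> u - t < s -> normc (Phi a b t u) <= e * (b - a + (u - t)) ^+ 2.
Proof.
move=> eps0 /andP[ep p1] e0.
have p01 : 0 <= p <= 1 by rewrite p1 andbT (le_trans (ltW eps0)).
set Ck := r / (r - normc (w - c)).
have Ck0 : 0 <= Ck by rewrite divr_ge0 // ltW.
have B0 : 0 < Ck + eps^-1 by rewrite ltr_wpDl ?invr_gt0.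
(* 8 is the product of three factors 2: from [cint_bound], from the Lipschitz bound on W, and from
   the two values of [G] in each integrand. *)
pose e1 := e / (8 * r * (Ck + eps^-1)).
have e10 : 0 < e1 by rewrite divr_gt0 // !mulr_gt0.
have fder : is_derive (W p q : R[i]^o) 1 (f : R[i]^o -> R[i]^o) (cderive f (W p q)).
  by apply: derivableP; apply: fD; exact: W_in.
have [s1 s10 loc] := (cderivable_localP _ _ _).1 fder e1 e10.
set l := cderive f (W p q) in fder loc.
have r40 : 0 < 4 * r by rewrite mulr_gt0.
(* Two sides below this bound give D < s1 / (2 r), which keeps W within s1 of W p q. *)
exists (s1 / (4 * r)); first by rewrite divr_gt0.
move=> a b t u ea ap pb b1 tq qu bas uts.
have a0 : 0 < a := lt_le_trans eps0 ea.
have ab : a <= b := le_trans ap pb.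
have tu : t <= u := le_trans tq qu.
set D := b - a + (u - t).
have D0 : 0 <= D by rewrite addr_ge0 ?subr_ge0.
have ba0 : 0 <= b - a by rewrite subr_ge0.
have ut0 : 0 <= u - t by rewrite subr_ge0.
have inab y : a <= y <= b -> 0 < y <= 1.
  by move=> /andP[ay yb]; rewrite (lt_le_trans a0 ay) (le_trans yb b1).
pose G z : R[i] := f z - f (W p q) - l * (z - W p q).
have Gb y x : a <= y <= b -> t <= x <= u -> normc (G (W y x)) <= e1 * (2 * r * D).
  move=> /andP[ay yb] /andP[tx xu].
  have near : normc (W y x - W p q) <= 2 * r * D.
    apply: le_trans (@W_lip y x p q p01) _; rewrite ler_wpM2l ?mulr_ge0 ?(ltW r0) //.
    by rewrite /D lerD // ler_norml; apply/andP; split; lra.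
  apply: le_trans (loc _ _) _; last by rewrite ler_wpM2l // ltW.
  apply: le_lt_trans near _.
  have : D < s1 / (4 * r) + s1 / (4 * r) by rewrite /D ltrD.
  have -> : s1 / (4 * r) + s1 / (4 * r) = s1 / (2 * r) by field; rewrite gt_eqF.
  by rewrite ltr_pdivlMr ?mulr_gt0 // mulrC.
pose E2 x : R[i] := K2 b x - K2 a x - l * (b - a)%:C * dzeta x.
pose E1 y : R[i] := K1 y u - K1 y t - l * (zeta u - zeta t).
have b0 : 0 < b := lt_le_trans a0 ab.
have c2 : ccontinuous_on t u (fun x => K2 b x - K2 a x).
  move=> x _; apply: ccontinuousD; last apply: ccontinuousN.
    by apply: K2_cont; rewrite (ltW b0).
  by apply: K2_cont; rewrite (ltW a0) (le_trans ab b1).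
have c2' : ccontinuous_on t u (fun x => l * (b - a)%:C * dzeta x).
  by move=> x _; apply: ccontinuousM; [exact: ccontinuous_cst|exact: dzeta_cont].
have c1 : ccontinuous_on a b (fun y => K1 y u - K1 y t).
  move=> y /inab y01; apply: ccontinuousD; last apply: ccontinuousN; exact: K1_cont.
have c1' : ccontinuous_on a b (fun=> l * (zeta u - zeta t)).
  by move=> y _; exact: ccontinuous_cst.
have cE2 : ccontinuous_on t u E2.
  by move=> x xtu; apply: ccontinuousD; [exact: c2|apply: ccontinuousN; exact: c2'].
have cE1 : ccontinuous_on a b E1.
  by move=> x xab; apply: ccontinuousD; [exact: c1|apply: ccontinuousN; exact: c1'].
have dzeta_int : cint t u dzeta = zeta u - zeta t.
  rewrite /dzeta cintZ; last first.
    by move=> x _; apply: ccontinuousM; [exact: ccontinuous_cst|exact: cis_continuous].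
  by rewrite cint_cis // /zeta; ring.
have PhiE2 : Phi a b t u = cint t u E2 - cint a b E1.
  rewrite /E2 /E1 (cintB c2 c2') (cintB c1 c1') /Phi cint_cst //.
  have dc : ccontinuous_on t u dzeta by move=> x _; exact: dzeta_cont.
  rewrite (cintZ (l * (b - a)%:C) dc) dzeta_int.
  by move: (cint _ _ _) (cint _ _ _) => X Y; ring.
have E2b x : t <= x <= u -> normc (E2 x) <= 2 * (e1 * (2 * r * D)) * Ck.
  move=> xtu; have -> : E2 x = (G (W b x) - G (W a x)) * kappa x.
    rewrite /E2 /K2 /kappa /G /W !rmorphE /=; field; exact: zeta_neq0.
  rewrite normcM ler_pM ?normc_ge0 //.
  apply: le_trans (le_normcD _ _) _; rewrite normcN mulr2n mulrDl mul1r.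
  by rewrite lerD // Gb // ?lexx ?ab ?andbT.
have E1b y : a <= y <= b -> normc (E1 y) <= 2 * (e1 * (2 * r * D)) * eps^-1.
  move=> yab; have /andP[y0 y1] := inab _ yab.
  have -> : E1 y = (G (W y u) - G (W y t)) / y%:C.
    rewrite /E1 /K1 /G /W; field; by rewrite eq_complex /= eqxx andbT gt_eqF.
  rewrite normcM ler_pM ?normc_ge0 //; last first.
    rewrite normcV normcR gtr0_norm // lef_pV2 ?posrE //.
    by case/andP: yab => ay _; exact: le_trans ea ay.
  apply: le_trans (le_normcD _ _) _; rewrite normcN mulr2n mulrDl mul1r.
  by rewrite lerD // Gb // ?lexx ?tu ?andbT.
rewrite PhiE2; apply: le_trans (le_normcD _ _) _; rewrite normcN.
apply: le_trans (lerD (cint_bound tu cE2 E2b) (cint_bound ab cE1 E1b)) _.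
have eE : e1 * (8 * r * (Ck + eps^-1)) = e by rewrite /e1 divfK // gt_eqF // !mulr_gt0.
rewrite -eE expr2; have q1 : u - t <= D by rewrite /D; lra.
have q2 : b - a <= D by rewrite /D; lra.
have A0 : 0 <= 8 * (e1 * r * D).
  by rewrite mulr_ge0 // mulr_ge0 // mulr_ge0 // ltW.
have := ler_wpM2l (mulr_ge0 A0 Ck0) q1.
have V0 : 0 <= eps^-1 by rewrite invr_ge0 ltW.
have := ler_wpM2l (mulr_ge0 A0 V0) q2.
move: (eps^-1) => v; clear; move: (u - t) (b - a) D => ut ba D h1 h2.
have -> : 2 * (2 * (e1 * (2 * r * D)) * Ck) * ut = 8 * (e1 * r * D) * Ck * ut by ring.
have -> : 2 * (2 * (e1 * (2 * r * D)) * v) * ba = 8 * (e1 * r * D) * v * ba by ring.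
apply: le_trans (lerD h2 h1) _; rewrite le_eqVlt; apply/orP; left; apply/eqP; ring.
Qed.

Let Phi_eq0 eps : 0 < eps <= 1 -> Phi eps 1 0 (2 * pi) = 0.
Proof.
move=> /andP[e0 e1]; have in01 y : eps <= y -> y <= 1 -> 0 < y <= 1.
  by move=> ey ->; rewrite (lt_le_trans e0 ey).
have in01' y : eps <= y -> y <= 1 -> 0 <= y <= 1.
  by move=> ey ->; rewrite (le_trans (ltW e0) ey).
apply: (@goursat_bisection _ Phi) => //.
- move=> a m b t u ea am mb b1 t0 tu u2.
  have ia := in01 a ea (le_trans am (le_trans mb b1)).
  have im := in01 m (le_trans ea am) (le_trans mb b1).
  have ib := in01 b (le_trans ea (le_trans am mb)) b1.
  rewrite !PhiE //.
  have s x : cint a b (K1^~ x) = cint a m (K1^~ x) + cint m b (K1^~ x).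
    apply: cint_split => // y /andP[ay yb]; apply: K1_cont.
    exact: in01 (le_trans ea ay) (le_trans yb b1).
  by rewrite !s; move: (cint _ _ _) (cint _ _ _) (cint _ _ _) => *; ring.
- move=> a b t v u ea ab b1 t0 tv vu u2.
  have ia := in01 a ea (le_trans ab b1).
  have ib := in01 b (le_trans ea ab) b1.
  rewrite !PhiE //.
  have s y : 0 < y <= 1 -> cint t u (K2 y) = cint t v (K2 y) + cint v u (K2 y).
    move=> /andP[y0 y1]; apply: cint_split => // x _; apply: K2_cont.
    by rewrite (ltW y0).
  by rewrite !s //; move: (cint _ _ _) (cint _ _ _) (cint _ _ _) => *; ring.
- move=> p q pe _ e egt0; have [s s0 H] := Phi_local q e0 pe egt0.
  by exists s => // a b t u ? ? ? ? _ ? ? _; exact: H.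
Qed.

(** By periodicity the sides x = 0 and x = 2 pi cancel, so the integral of K2 at l = 1 equals that
    at l = eps, which tends to f(w) times the integral of [kappa] as eps tends to 0. *)
Lemma cauchy_kernel : cint 0 (2 * pi) (fun x => f (c + r%:C * cis x) * kappa x) =
  f w * cint 0 (2 * pi) kappa.
Proof.
have W1 x : W 1 x = c + r%:C * cis x by rewrite /W /zeta; ring.
have kc : ccontinuous_on 0 (2 * pi) kappa by move=> x _; exact: kappa_cont.
have K2c l : 0 <= l <= 1 -> ccontinuous_on 0 (2 * pi) (K2 l) by move=> l01 x _; exact: K2_cont.
have fkc : ccontinuous_on 0 (2 * pi) (fun x => f w * kappa x).
  by move=> x _; apply: ccontinuousM; [exact: ccontinuous_cst|exact: kappa_cont].
have -> : cint 0 (2 * pi) (fun x => f (c + r%:C * cis x) * kappa x) = cint 0 (2 * pi) (K2 1).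
  by apply: eq_cint => x _; rewrite /K2 W1.
have wc : normc (w - c) <= r by exact: ltW.
have fder : is_derive (w : R[i]^o) 1 (f : R[i]^o -> R[i]^o) (cderive f w).
  by apply: derivableP; apply: fD.
have [s s0 loc] := (cderivable_localP _ _ _).1 fder 1 ltr01.
set l := cderive f w in fder loc.
set Ck := r / (r - normc (w - c)).
have Ck0 : 0 <= Ck by rewrite divr_ge0 // ltW.
pose C := 2 * ((1 + normc l) * (2 * r) * Ck) * (2 * pi).
have C0 : 0 <= C.
  by rewrite mulr_ge0 // mulr_ge0 // mulr_ge0 // mulr_ge0 ?addr_ge0 ?normc_ge0 ?mulr_ge0 // ltW.
have small eps : 0 < eps <= 1 -> eps * (2 * r) < s ->
    normc (cint 0 (2 * pi) (K2 1) - f w * cint 0 (2 * pi) kappa) <= eps * C.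
  move=> /[dup] eps01 /andP[e0 e1] es.
  have e01 : 0 <= eps <= 1 by rewrite (ltW e0).
  have -> : cint 0 (2 * pi) (K2 1) = cint 0 (2 * pi) (K2 eps).
    have := Phi_eq0 eps01; rewrite PhiE ?ltr01 ?lexx //.
    have -> : K1^~ (2 * pi) = K1^~ 0.
      by apply/funext => y; rewrite /K1 /W /zeta cis_2pi cis0.
    by rewrite subrr subr0 => /eqP; rewrite subr_eq0 => /eqP.
  have <- := cintZ (f w) kc; rewrite -(cintB (K2c _ e01) fkc).
  have -> : eps * C = 2 * (eps * ((1 + normc l) * (2 * r) * Ck)) * (2 * pi - 0).
    by rewrite /C; ring.
  apply: cint_bound; first exact: pi20.
    by move=> x xI; apply: ccontinuousD; [exact: K2_cont|apply: ccontinuousN; exact: fkc].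
  move=> x _; rewrite /K2 -mulrBl normcM mulrA ler_pM ?normc_ge0 //.
  have We : normc (W eps x - w) <= eps * (2 * r).
    rewrite /W addrAC subrr add0r normcM normcR gtr0_norm //.
    by rewrite ler_wpM2l // ltW.
  have := loc _ (le_lt_trans We es); rewrite mul1r => H.
  rewrite -[f (W eps x) - f w](subrK (l * (W eps x - w))).
  apply: le_trans (le_normcD _ _) _; rewrite normcM.
  have n0 := normc_ge0 l.
  have := ler_wpM2l (addr_ge0 (@ler01 R) n0) We; move: H.
  move: (normc _) (normc _) (normc _) => A B n; lra.
apply/eqP; rewrite -subr_eq0; apply/eqP/eq0_normc/eqP; rewrite eq_le normc_ge0 andbT.
set Dl := normc _ in small *.
apply/ler_addgt0Pr => e e0; rewrite add0r.
(* The three bounds ensure eps <= 1, eps (2 r) < s and eps C <= e. *)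
pose eps := Num.min 1 (Num.min (s / (4 * r)) (e / (C + 1))).
have C10 : 0 < C + 1 by rewrite ltr_wpDl.
have r40 : 0 < 4 * r by rewrite mulr_gt0.
have e1 : 0 < eps <= 1 by rewrite !lt_min ltr01 !divr_gt0 //= ge_min lexx.
have e2 : eps <= s / (4 * r) by rewrite !ge_min lexx orbT.
have e3 : eps <= e / (C + 1) by rewrite !ge_min lexx !orbT.
have e4 : eps * (2 * r) < s.
  have : eps * (4 * r) <= s by rewrite -ler_pdivlMr.
  have : 0 < eps * r by case/andP: e1 => ? _; rewrite mulr_gt0.
  lra.
apply: le_trans (small _ e1 e4) _; move: e3; rewrite ler_pdivlMr //.
by case/andP: e1 => eps0 _; lra.
Qed.


End CauchyDisc.

(** * Taylor expansion on a disc *)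

Section CauchyTaylor.
Context {R : realType}.
Variables (c w : R[i]) (r : R).
Hypothesis wD : normc (w - c) < r.

Let r0 : 0 < r := le_lt_trans (normc_ge0 _) wD.
Let pi20 : 0 <= 2 * pi :> R. Proof. by rewrite mulr_ge0 ?pi_ge0. Qed.
Let rC : r%:C != 0. Proof. by rewrite eq_complex /= eqxx andbT gt_eqF. Qed.
(** Cauchy's kernel on the circle, divided by i. *)
Let kern x : R[i] := r%:C * cis x / (c - w + r%:C * cis x).
Let q : R[i] := (w - c) / r%:C.

Lemma ccontinuous_bounded (g : R -> R[i]) (a b : R) : a <= b -> ccontinuous_on a b g ->
  exists M, forall x, a <= x <= b -> normc (g x) <= M.
Proof.
move=> ab gc; have [u [m uP]] : exists u m, forall x, a <= x <= b -> `|complex.Re (g x)| <= u /\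
    `|complex.Im (g x)| <= m.
  have bd (h : R -> R) : (forall x, a <= x <= b -> h y @[y --> x] --> h x) ->
      exists M, forall x, a <= x <= b -> `|h x| <= M.
    move=> hc; have [|z _ zP] := @EVT_max _ (fun x => `|h x|) a b ab.
      apply: continuous_in_subspaceT => x; rewrite inE /= in_itv /= => xab.
      by apply: cvg_norm; exact: hc.
    by exists `|h z| => x xab; apply: zP; rewrite in_itv.
  have [u uP] := bd _ (fun x xab => proj1 (iffLR (cvg_complexP _ _) (gc x xab))).
  have [m mP] := bd _ (fun x xab => proj2 (iffLR (cvg_complexP _ _) (gc x xab))).
  by exists u, m => x xab; split; [exact: uP|exact: mP].
exists (u + m) => x /uP[h1 h2]; exact: le_trans (normc_le _) (lerD h1 h2).
Qed.

Let den_neq0 x : c - w + r%:C * cis x != 0.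
Proof.
apply/eqP => z0; have : r%:C * cis x = w - c.
  by apply/eqP; rewrite -subr_eq0 opprB addrC z0.
by move=> /(congr1 (@normc R)) /eqP; rewrite normcM normc_cis mulr1 normcR gtr0_norm // gt_eqF.
Qed.

Let kern_cont x : ccontinuous_at kern x.
Proof.
have rc : ccontinuous_at (fun x => r%:C * cis x) x.
  by apply: ccontinuousM; [exact: ccontinuous_cst|exact: cis_continuous].
apply: (ccontinuousM rc); apply: ccontinuousV; first exact: den_neq0.
by apply: (ccontinuousD _ rc); exact: ccontinuous_cst.
Qed.

Let cisN_cont n (x : R) : ccontinuous_at (fun y : R => cis (- y) ^+ n) x.
Proof.
elim: n => [|n IH]; first exact: ccontinuous_cst.
have -> : (fun y : R => cis (- y) ^+ n.+1) = (fun y => cis (- y) * cis (- y) ^+ n).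
  by apply/funext => y; rewrite exprS.
apply: ccontinuousM; last exact: IH.
have Nx : - y @[y --> x] --> - x by exact: cvgN.
exact: (cvg_comp _ _ Nx (@cis_continuous R (- x))).
Qed.

(** (1 - q e^{-ix}) kern(x) = 1, so the kernel is a geometric series in q e^{-ix}, here with its
    remainder. *)
Let kern_geometric x N :
  kern x = \sum_(n < N) q ^+ n * cis (- x) ^+ n + q ^+ N * (cis (- x) ^+ N * kern x).
Proof.
have e1 : (1 - q * cis (- x)) * kern x = 1.
  have -> : 1 - q * cis (- x) = cis (- x) * (c - w + r%:C * cis x) / r%:C.
    rewrite -(cisN x) /q; field; exact: rC.
  rewrite /kern; transitivity (cis x * cis (- x)); last exact: cisN.
  by field; rewrite rC den_neq0.
rewrite mulrA -exprMn; under eq_bigr do rewrite -exprMn.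
move: (q * cis (- x)) e1 => y e1.
have := subrX1 y N => yN.
have e2 : (y - 1) * kern x = -1.
  have -> : (y - 1) * kern x = - ((1 - y) * kern x) by ring.
  by rewrite e1.
 have : (y ^+ N - 1) * kern x = - \sum_(i < N) y ^+ i.
  by rewrite yN mulrAC e2 mulN1r.
by rewrite mulrBl mul1r => /eqP; rewrite subr_eq => /eqP ->; ring.
Qed.

Lemma kernel_series (g : R -> R[i]) : ccontinuous_on 0 (2 * pi) g ->
  (\sum_(n < N) q ^+ n * cint 0 (2 * pi) (fun x => g x * cis (- x) ^+ n) : R[i]^o)
    @[N --> \oo] --> (cint 0 (2 * pi) (fun x => g x * kern x) : R[i]^o).
Proof.
move=> gc; have gnc n : ccontinuous_on 0 (2 * pi) (fun x => g x * cis (- x) ^+ n).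
  by move=> x xI; apply: ccontinuousM; [exact: gc|exact: cisN_cont].
have gkc : ccontinuous_on 0 (2 * pi) (fun x => g x * kern x).
  by move=> x xI; apply: ccontinuousM; [exact: gc|exact: kern_cont].
have gnkc n : ccontinuous_on 0 (2 * pi) (fun x => cis (- x) ^+ n * (g x * kern x)).
  by move=> x xI; apply: ccontinuousM; [exact: cisN_cont|exact: gkc].
have qgnc n : ccontinuous_on 0 (2 * pi) (fun x => q ^+ n * (g x * cis (- x) ^+ n)).
  by move=> x xI; apply: ccontinuousM; [exact: ccontinuous_cst|exact: gnc].
have [M MP] := ccontinuous_bounded pi20 gkc.
have M0 : 0 <= M by apply: le_trans (MP 0 _); rewrite ?normc_ge0 // lexx pi20.
have split N : cint 0 (2 * pi) (fun x => g x * kern x) =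
    \sum_(n < N) q ^+ n * cint 0 (2 * pi) (fun x => g x * cis (- x) ^+ n) +
    q ^+ N * cint 0 (2 * pi) (fun x => cis (- x) ^+ N * (g x * kern x)).
  rewrite -(cintZ (q ^+ N) (gnkc N)).
  have -> : \sum_(n < N) q ^+ n * cint 0 (2 * pi) (fun x => g x * cis (- x) ^+ n) =
      cint 0 (2 * pi) (fun x => \sum_(n < N) q ^+ n * (g x * cis (- x) ^+ n)).
    by rewrite (cint_sum _ qgnc); apply: eq_bigr => n _; rewrite (cintZ _ (gnc n)).
  rewrite -cintD.
  - apply: eq_cint => x _; rewrite {1}(kern_geometric x N) mulrDr; congr (_ + _); last by ring.
    by rewrite mulr_sumr; apply: eq_bigr => n _; ring.
  - exact: (ccontinuous_sum qgnc).
  - by move=> x xI; apply: ccontinuousM; [exact: ccontinuous_cst|exact: gnkc].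
have q1 : normc q < 1.
  by rewrite /q normcM normcV normcR gtr0_norm // ltr_pdivrMr // mul1r.
have nE n : normc (q ^+ n) = normc q ^+ n.
  by elim: n => [|n IH]; rewrite ?expr0 ?normc1 // !exprS normcM IH.
apply/cvg_normcP => e e0.
have gz : geometric (2 * M * (2 * pi)) (normc q) @ \oo --> (0 : R).
  by apply: cvg_geometric; rewrite ger0_norm ?normc_ge0.
have /cvgrPdist_lt/(_ e e0) := gz; apply: filterS => N /=.
rewrite sub0r normrN => He; apply: le_lt_trans (le_lt_trans (ler_norm _) He).
rewrite (split N) opprD addrA subrr add0r normcN normcM nE mulrC.
rewrite ler_wpM2r ?exprn_ge0 ?normc_ge0 //.
have := @cint_bound _ _ _ _ M pi20 (gnkc N); rewrite subr0; apply.
move=> x xI; rewrite normcM.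
have -> : normc (cis (- x) ^+ N) = 1 by rewrite cis_Nexp normc_cis.
by rewrite mul1r; exact: MP.
Qed.

Variable f : R[i] -> R[i].
Hypothesis fD : forall z, normc (z - c) <= r -> cderivable f z.

(** This is 2 pi r^n times the n-th Taylor coefficient of f at c. *)
Definition taylor_coef n : R[i] :=
  cint 0 (2 * pi) (fun x => f (c + r%:C * cis x) * cis (- x) ^+ n).

Let circle_cont : ccontinuous_on 0 (2 * pi) (fun x => f (c + r%:C * cis x)).
Proof.
move=> x _; have Wc : ccontinuous_at (fun x => c + r%:C * cis x) x.
  apply: ccontinuousD; first exact: ccontinuous_cst.
  by apply: ccontinuousM; [exact: ccontinuous_cst|exact: cis_continuous].
have zr : normc (c + r%:C * cis x - c) <= r.
  by rewrite addrAC subrr add0r normcM normc_cis mulr1 normcR gtr0_norm.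
by move: (fD zr) => /derivable1_diffP /differentiable_continuous fc; exact: (cvg_comp _ _ Wc fc).
Qed.

Lemma taylor_coef_bounded : exists M, forall n, normc (taylor_coef n) <= M.
Proof.
have [M MP] := ccontinuous_bounded pi20 circle_cont.
exists (2 * M * (2 * pi - 0)) => n; apply: cint_bound; first exact: pi20.
  by move=> x xI; apply: ccontinuousM; [exact: circle_cont|exact: cisN_cont].
move=> x xI; rewrite normcM.
have -> : normc (cis (- x) ^+ n) = 1 by rewrite cis_Nexp normc_cis.
by rewrite mulr1; exact: MP.
Qed.

Lemma cauchy_taylor :
  (\sum_(n < N) ((w - c) / r%:C) ^+ n * taylor_coef n : R[i]^o) @[N --> \oo] -->
  (f w * (2 * pi)%:C : R[i]^o).
Proof.
have i0 : 'i != 0 :> R[i] by rewrite eq_complex /= oner_eq0 andbF.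
have kc : ccontinuous_on 0 (2 * pi) kern by move=> x _; exact: kern_cont.
(* The kernel integral left open by [cauchy_kernel] is read off the kernel series with g = 1, where
   only the term n = 0 survives. *)
have k1 : cint 0 (2 * pi) kern = (2 * pi)%:C.
  have := @kernel_series (fun=> 1) (fun x _ => @ccontinuous_cst _ 1 x).
  have -> : cint 0 (2 * pi) (fun x => 1 * kern x) = cint 0 (2 * pi) kern.
    by apply: eq_cint => x _; rewrite mul1r.
  have cE n : cint 0 (2 * pi) (fun x => 1 * cis (- x) ^+ n) = (if n is 0%N then 2 * pi else 0)%:C.
    by rewrite -cint_cis_Nexp; apply: eq_cint => x _; rewrite mul1r.
  have s1 N : \sum_(n < N.+1) q ^+ n * cint 0 (2 * pi) (fun x => 1 * cis (- x) ^+ n) = (2 * pi)%:C.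
    rewrite big_ord_recl expr0 mul1r cE big1 ?addr0 // => i _.
    by rewrite cE mulr0.
  move=> H; pose S N : R[i]^o := \sum_(n < N) q ^+ n * cint 0 (2 * pi) (fun x => 1 * cis (- x) ^+ n).
  have H1 : S n.+1 @[n --> \oo] --> (cint 0 (2 * pi) kern : R[i]^o) by rewrite cvg_shiftS.
  have H2 : S n.+1 @[n --> \oo] --> ((2 * pi)%:C : R[i]^o).
    by rewrite (_ : (fun n => S n.+1) = cst ((2 * pi)%:C : R[i]^o)); [exact: cvg_cst|apply/funext => n; exact: s1].
  by rewrite -(cvg_lim (@norm_hausdorff _ (R[i]^o)) H1) (cvg_lim (@norm_hausdorff _ (R[i]^o)) H2).
have := kernel_series circle_cont; rewrite -/q.
have -> : cint 0 (2 * pi) (fun x => f (c + r%:C * cis x) * kern x) = f w * (2 * pi)%:C; last by [].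
have gkc : ccontinuous_on 0 (2 * pi) (fun x => f (c + r%:C * cis x) * kern x).
  by move=> x xI; apply: ccontinuousM; [exact: circle_cont|exact: kern_cont].
apply: (mulfI i0); rewrite -(cintZ _ gkc) -k1 mulrCA -(cintZ _ kc).
have KE x : r%:C * ('i * cis x) / (c - w + r%:C * cis x) = 'i * kern x.
  by rewrite /kern; move: (cis x) (_ + _) => a b; ring.
apply: etrans (etrans (cauchy_kernel fD wD) _); last first.
  by congr (_ * _); apply: eq_cint => x _; exact: KE.
by apply: eq_cint => x _; rewrite KE mulrCA.
Qed.

End CauchyTaylor.

(** * The Laplace transform left of 0 *)

Section PowerSeriesUniqueness.
Context {R : realType}.

(** Once the earlier coefficients vanish, |d_n| y^n is at most the tail, hence at most 2 B y^{n+1}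
    for y <= 1/2; divide by y^n and let y decrease to 0. *)
Lemma power_series_eq0 (d : nat -> R) (B : R) : (forall n, `|d n| <= B) ->
  (forall y, 0 <= y -> y < 1 -> \sum_(k < N) y ^+ k * d k @[N --> \oo] --> (0 : R)) ->
  forall n, d n = 0.
Proof.
move=> dB lim0; have B0 : 0 <= B := le_trans (normr_ge0 _) (dB 0%N).
elim/ltn_ind => n IH.
(* The subtracted term lets the induction on N close: a new term of size B y^{n+1+N} fits because 1
   + 2 y <= 2. *)
have tail y N : 0 <= y -> y <= 2^-1 ->
    `|\sum_(k < n.+1 + N) y ^+ k * d k - y ^+ n * d n| <=
    B * (2 * y ^+ n.+1 - 2 * y ^+ (n.+1 + N)).
  move=> y0 y2; elim: N => [|N IHN].
    rewrite addn0 big_ord_recr /= big1 => [|i _]; last by rewrite IH ?mulr0.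
    by rewrite add0r !subrr normr0 mulr0.
  rewrite addnS big_ord_recr /= addrAC; apply: le_trans (ler_normD _ _) _.
  have yN : 0 <= y ^+ (n.+1 + N) by rewrite exprn_ge0.
  have h1 : `|y ^+ (n.+1 + N) * d (n.+1 + N)%N| <= y ^+ (n.+1 + N) * B.
    by rewrite normrM ger0_norm // ler_wpM2l.
  apply: le_trans (lerD IHN h1) _; rewrite (exprS y (n.+1 + N)).
  move: (y ^+ (n.+1 + N)) (y ^+ n.+1) yN => a b a0.
  have : y * a <= 2^-1 * a by rewrite ler_wpM2r.
  move=> h2; have : 0 <= B * (2^-1 * a - y * a) by rewrite mulr_ge0 // subr_ge0.
  lra.
have dn y : 0 < y -> y <= 2^-1 -> `|d n| <= B * 2 * y.
  move=> y0 y2; have y1 : y < 1 by lra.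
  have l1 := lim0 y (ltW y0) y1.
  have l2 : `|\sum_(k < N) y ^+ k * d k - y ^+ n * d n| @[N --> \oo] --> `|0 - y ^+ n * d n|.
    by apply: cvg_norm; apply: cvgB => //; exact: cvg_cst.
  have : `|0 - y ^+ n * d n| <= B * (2 * y ^+ n.+1).
    apply: (cvgr_to_le l2); exists n.+1 => // N /= nN.
    rewrite -(subnKC nN); apply: le_trans (tail y _ (ltW y0) y2) _.
    by rewrite ler_wpM2l // gerBl mulr_ge0 // exprn_ge0 // ltW.
  rewrite sub0r normrN normrM ger0_norm ?exprn_ge0 ?(ltW y0) //.
  have -> : B * (2 * y ^+ n.+1) = y ^+ n * (B * 2 * y) by rewrite exprS; ring.
  by rewrite ler_pM2l // exprn_gt0.
apply/eqP; rewrite -normr_eq0 eq_le normr_ge0 andbT.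
apply/ler_addgt0Pr => e e0; rewrite add0r.
have B1 : 0 < B * 2 + 1 by rewrite ltr_wpDl // mulr_ge0.
pose y := Num.min 2^-1 (e / (B * 2 + 1)).
have y0 : 0 < y by rewrite lt_min divr_gt0 //= invr_gt0 ltr0n.
have y2 : y <= 2^-1 by rewrite ge_min lexx.
have ye : y <= e / (B * 2 + 1) by rewrite ge_min lexx orbT.
apply: le_trans (dn y y0 y2) _; move: ye; rewrite ler_pdivlMr // => ye.
by clear -ye y0; lra.
Qed.

Lemma power_series_unique (a b : nat -> R) (A : R) (g : R -> R) :
  (forall n, `|a n| <= A) -> (forall n, `|b n| <= A) ->
  (forall y, 0 <= y -> y < 1 -> \sum_(k < N) y ^+ k * a k @[N --> \oo] --> g y) ->
  (forall y, 0 <= y -> y < 1 -> \sum_(k < N) y ^+ k * b k @[N --> \oo] --> g y) ->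
  forall n, a n = b n.
Proof.
move=> aA bA ag bg n; apply/eqP; rewrite -subr_eq0; apply/eqP.
apply: (@power_series_eq0 (fun n => a n - b n) (A + A)) => [k|y y0 y1].
  by apply: le_trans (ler_normB _ _) _; rewrite lerD.
have -> : (fun N => \sum_(k < N) y ^+ k * (a k - b k)) =
    (fun N => \sum_(k < N) y ^+ k * a k - \sum_(k < N) y ^+ k * b k).
  by apply/funext => N; rewrite -sumrB; apply: eq_bigr => k _; rewrite mulrBr.
have := cvgB (ag y y0 y1) (bg y y0 y1); rewrite subrr; exact.
Qed.

End PowerSeriesUniqueness.

Section LaplaceExtension.
Context {R : realType} {d : measure_display} {Om : measurableType d}.
Variables (P : probability Om R) (X : Om -> R).
Hypothesis mX : measurable_fun setT X.
Hypothesis X0 : forall w, 0 <= X w.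

(** Up to the sign (-1)^n, the n-th Taylor coefficient at 1 of the Laplace transform of [X]. *)
Let taylor_moment n : \bar R := (\int[P]_w (expR (- X w) * (X w ^+ n / n`!%:R))%:E)%E.

Let mexp u : measurable_fun setT (fun w => expR (u * X w)).
Proof. by apply: measurableT_comp => //; exact: measurable_funM. Qed.

Let tm0 n w : 0 <= expR (- X w) * (X w ^+ n / n`!%:R).
Proof. by rewrite mulr_ge0 ?expR_ge0 // divr_ge0 ?exprn_ge0. Qed.

Let mtm n : measurable_fun setT (fun w => (expR (- X w) * (X w ^+ n / n`!%:R))%:E).
Proof.
apply/measurable_EFinP; apply: measurable_funM.
  by have := mexp (-1); under eq_fun do rewrite mulN1r.
by apply: measurable_funM => //; exact: measurable_funX.
Qed.

(** Tonelli's theorem on the expansion of e^{yX}. The identity holds in [0, +oo] for every y >= 0,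
    also beyond y = 1, where finiteness is not yet known. *)
Lemma laplace_series (y : R) : 0 <= y ->
  (\int[P]_w (expR ((y - 1) * X w))%:E = \sum_(n <oo) ((y ^+ n)%:E * taylor_moment n))%E.
Proof.
move=> y0; transitivity (\int[P]_w (\sum_(n <oo) (y ^+ n)%:E *
    (expR (- X w) * (X w ^+ n / n`!%:R))%:E))%E.
  apply: eq_integral => w _; apply/esym/cvg_lim => //.
  have gE : (fun n => (\sum_(0 <= k < n) (y ^+ k)%:E * (expR (- X w) * (X w ^+ k / k`!%:R))%:E)%E) =
      EFin \o (fun n => expR (- X w) * series (exp_coeff (y * X w)) n).
    apply/funext => n /=; rewrite mulr_sumr -sumEFin; apply: eq_bigr => k _.
    by rewrite -EFinM /exp_coeff /= exprMn; congr _%:E; ring.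
  rewrite gE; apply: cvg_EFin; first exact: nearW.
  have -> : (y - 1) * X w = - X w + y * X w by ring.
  rewrite expRD; apply: cvgM; first exact: cvg_cst.
  by rewrite [X in _ --> X]/expR; exact: is_cvg_series_exp_coeff.
rewrite integral_nneseries // => [|n|n w _]; last 2 first.
- by apply: emeasurable_funM.
- by rewrite mule_ge0 // lee_fin ?exprn_ge0.
apply: eq_eseriesr => n _; rewrite ge0_integralZl_EFin // ?exprn_ge0 // => w _.
by rewrite lee_fin.
Qed.

Let tm_ge0 n : (0 <= taylor_moment n)%E.
Proof. by apply: integral_ge0 => w _; rewrite lee_fin. Qed.

(** At y = 1 the series of nonnegative terms sums to the total mass 1. *)
Let tm_le1 n : (taylor_moment n <= 1)%E.
Proof.
have <- : (\sum_(n <oo) ((1 ^+ n)%:E * taylor_moment n) = 1)%E.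
  rewrite -laplace_series //; transitivity (\int[P]_w (cst 1%E w))%E.
    by apply: eq_integral => w _; rewrite subrr mul0r expR0.
  by rewrite integral_cst // mul1e; exact: probability_setT.
under eq_eseriesr do rewrite expr1n mul1e.
apply: le_trans (nneseries_lim_ge n.+1 _) => [|k _]; last by [].
rewrite big_nat_recr //= leeDr //; exact: sume_ge0.
Qed.

Let tmE n : taylor_moment n = (fine (taylor_moment n))%:E.
Proof.
by rewrite fineK // ge0_fin_numE //; exact: le_lt_trans (tm_le1 n) (ltry 1).
Qed.

Variables (f : R[i] -> R[i]) (r : R).
Hypothesis r1 : 1 < r.
Hypothesis fD : forall z, normc (z - 1) <= r -> cderivable f z.
Hypothesis fE : forall x : R, 0 <= x ->
  (\int[P]_w (expR (- x * X w))%:E = (complex.Re (f x%:C))%:E)%E /\ complex.Im (f x%:C) = 0.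

Let m n := fine (taylor_moment n).

Let m_bound n : `|m n| <= 1.
Proof. by rewrite ger0_norm /m ?fine_ge0 // -lee_fin -tmE. Qed.

Let partialE y N : (\sum_(0 <= k < N) ((y ^+ k)%:E * taylor_moment k) =
  (\sum_(k < N) y ^+ k * m k)%:E)%E.
Proof. by rewrite big_mkord -sumEFin; apply: eq_bigr => k _; rewrite tmE. Qed.

Let moment_series_cvg (y L : R) : 0 <= y ->
  (\int[P]_w (expR ((y - 1) * X w))%:E = L%:E)%E ->
  \sum_(k < N) y ^+ k * m k @[N --> \oo] --> L.
Proof.
move=> y0; rewrite laplace_series // => sL.
have := @is_cvg_nneseries R (fun k => ((y ^+ k)%:E * taylor_moment k)%E) xpredT 0.
move=> /(_ (fun k _ _ => mule_ge0 _ (tm_ge0 k))) H.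
have : (\sum_(0 <= k < N) ((y ^+ k)%:E * taylor_moment k))%E @[N --> \oo] --> L%:E.
  by rewrite -sL; apply: H => k; rewrite lee_fin exprn_ge0.
rewrite (_ : (fun N => _) = EFin \o (fun N => \sum_(k < N) y ^+ k * m k)); last first.
  by apply/funext => N; exact: partialE.
by move=> /fine_cvg.
Qed.

Let moment_series_lim (y L : R) : 0 <= y ->
  \sum_(k < N) y ^+ k * m k @[N --> \oo] --> L ->
  (\int[P]_w (expR ((y - 1) * X w))%:E = L%:E)%E.
Proof.
move=> y0 sL; rewrite laplace_series //; apply: cvg_lim => //.
rewrite (_ : (fun N => _) = EFin \o (fun N => \sum_(k < N) y ^+ k * m k)); last first.
  by apply/funext => N; exact: partialE.
by apply: cvg_EFin; [exact: nearW|exact: sL].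
Qed.

Let r0 : 0 < r := lt_trans ltr01 r1.
Let pi20 : 0 < 2 * pi :> R. Proof. by rewrite mulr_gt0 ?pi_gt0. Qed.
(** Coefficient of y^n in the expansion of f(1 - y); the sign comes from w - 1 = - y. *)
Let co n : R[i] := (- r^-1)%:C ^+ n * taylor_coef 1 r f n / (2 * pi)%:C.

Let normcX (z : R[i]) n : normc (z ^+ n) = normc z ^+ n.
Proof. by elim: n => [|n IH]; rewrite ?expr0 ?normc1 // !exprS normcM IH. Qed.

Let co_bounded : exists A, 1 <= A /\ forall n, normc (co n) <= A.
Proof.
have w1 : normc (1 - 1 : R[i]) < r by rewrite subrr normc0.
have [M MP] := taylor_coef_bounded w1 fD.
have M0 : 0 <= M := le_trans (normc_ge0 _) (MP 0%N).
exists (1 + M / (2 * pi)); split; first by rewrite lerDl divr_ge0 // ltW.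
move=> n; rewrite /co !normcM normcV normcX !normcR normrN (gtr0_norm pi20).
rewrite gtr0_norm ?invr_gt0 //.
apply: (@le_trans _ _ (M / (2 * pi))); last by rewrite lerDr.
rewrite ler_wpM2r ?invr_ge0 ?(ltW pi20) //.
apply: le_trans (MP n); rewrite ler_piMl ?normc_ge0 // exprn_ile1 ?invr_ge0 ?(ltW r0) //.
by rewrite invf_le1 // ltW.
Qed.

Let Re_sum (F : nat -> R[i]) N : complex.Re (\sum_(k < N) F k) = \sum_(k < N) complex.Re (F k).
Proof.
elim: N => [|N IH]; first by rewrite !big_ord0.
by rewrite !big_ord_recr /= -IH; case: (\sum_(k < N) _) (F N) => ? ? [].
Qed.

Let Im_sum (F : nat -> R[i]) N : complex.Im (\sum_(k < N) F k) = \sum_(k < N) complex.Im (F k).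
Proof.
elim: N => [|N IH]; first by rewrite !big_ord0.
by rewrite !big_ord_recr /= -IH; case: (\sum_(k < N) _) (F N) => ? ? [].
Qed.

Let co_series (y : R) : 0 <= y -> y < r ->
  \sum_(k < N) y ^+ k * complex.Re (co k) @[N --> \oo] --> complex.Re (f (1 - y)%:C) /\
  \sum_(k < N) y ^+ k * complex.Im (co k) @[N --> \oo] --> complex.Im (f (1 - y)%:C).
Proof.
move=> y0 yr; pose w : R[i] := (1 - y)%:C.
have w1E : w - 1 = (- y)%:C by rewrite /w !rmorphE /=; ring.
have w1 : normc (w - 1) < r by rewrite w1E normcR normrN ger0_norm.
have rC : r%:C != 0 by rewrite eq_complex /= eqxx andbT gt_eqF.
have pC : (2 * pi)%:C != 0 :> R[i] by rewrite eq_complex /= eqxx andbT gt_eqF.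
have H := cauchy_taylor w1 fD.
have termE k : ((w - 1) / r%:C) ^+ k * taylor_coef 1 r f k / (2 * pi)%:C = (y ^+ k)%:C * co k.
  rewrite w1E /co.
  have -> : (- y)%:C / r%:C = y%:C * (- r^-1)%:C :> R[i].
    by rewrite !rmorphE /= rmorphV ?unitfE ?gt_eqF //=; ring.
  by rewrite exprMn -!mulrA; congr (_ * _); rewrite rmorphXn.
pose S N : R[i]^o := \sum_(k < N) (y ^+ k)%:C * co k.
have SE : S = fun N => (\sum_(n < N) ((w - 1) / r%:C) ^+ n * taylor_coef 1 r f n) / (2 * pi)%:C.
  by apply/funext => N; rewrite /S mulr_suml; apply: eq_bigr => k _; rewrite termE.
have [h1 h2] : complex.Re (S N) @[N --> \oo] --> complex.Re (f w) /\
    complex.Im (S N) @[N --> \oo] --> complex.Im (f w).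
  apply/cvg_complexP; rewrite SE -[X in _ --> X](mulfK pC (f w)).
  by apply: (@cvgM R[i]); [exact: H|exact: cvg_cst].
rewrite -/w; split.
  rewrite (_ : (fun N => _) = (fun N => complex.Re (S N))) //; apply/funext => N.
  apply/esym; apply: (etrans (Re_sum (fun k => (y ^+ k)%:C * co k) N)).
  by apply: eq_bigr => k _; case: (co k) => a b /=; ring.
rewrite (_ : (fun N => _) = (fun N => complex.Im (S N))) //; apply/funext => N.
apply/esym; apply: (etrans (Im_sum (fun k => (y ^+ k)%:C * co k) N)).
by apply: eq_bigr => k _; case: (co k) => a b /=; ring.
Qed.

(** In the variable y = 1 - x the two expansions are compared on [0, 1[; equality of coefficients
    then makes the moment series converge for all y < r. *)
Lemma laplace_extension (x : R) : 1 - r < x ->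
  (\int[P]_w (expR (- x * X w))%:E = (complex.Re (f x%:C))%:E)%E /\ complex.Im (f x%:C) = 0.
Proof.
move=> rx; have [x0|/ltW x0] := leP 0 x; first exact: fE.
have fE' y : 0 <= y -> y < 1 ->
    (\int[P]_w (expR ((y - 1) * X w))%:E = (complex.Re (f (1 - y)%:C))%:E)%E /\
    complex.Im (f (1 - y)%:C) = 0.
  by move=> y0 y1; rewrite -[y - 1]opprB; apply: fE; rewrite subr_ge0 ltW.
have [A [A1 AP]] := co_bounded.
have coR n : complex.Re (co n) = m n.
  apply: (@power_series_unique _ (fun n => complex.Re (co n)) m A (fun y => complex.Re (f (1 - y)%:C))) => {}n.
  - exact: le_trans (normc_Re _) (AP n).
  - exact: le_trans (m_bound n) A1.
  - by move=> n0 n1; case: (co_series n0 (lt_trans n1 r1)).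
  - by move=> n0 n1; apply: moment_series_cvg => //; case: (fE' n n0 n1).
have coI n : complex.Im (co n) = 0.
  apply: (@power_series_unique _ (fun n => complex.Im (co n)) (fun=> 0) A (fun y => complex.Im (f (1 - y)%:C))) => {}n.
  - exact: le_trans (normc_Im _) (AP n).
  - by rewrite normr0 (le_trans ler01).
  - by move=> n0 n1; case: (co_series n0 (lt_trans n1 r1)).
  - move=> n0 n1; rewrite (proj2 (fE' n n0 n1)).
    rewrite (_ : (fun N => _) = cst 0); first exact: cvg_cst.
    by apply/funext => N; rewrite big1 // => k _; rewrite mulr0.
pose y := 1 - x; have y0 : 0 <= y by rewrite /y; lra.
have yr : y < r by rewrite /y; lra.
have xE : x = 1 - y by rewrite /y; ring.
have [h1 h2] := co_series y0 yr; split.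
  have -> : - x = y - 1 by rewrite /y; ring.
  apply: moment_series_lim => //; rewrite xE.
  by move: h1; under eq_fun do under eq_bigr do rewrite coR.
have h3 : (fun N => \sum_(k < N) y ^+ k * complex.Im (co k)) = cst 0.
  by apply/funext => N; rewrite big1 // => k _; rewrite coI mulr0.
rewrite xE; move: h2; rewrite h3 => h2.
by rewrite -(cvg_lim _ h2) // lim_cst.
Qed.

End LaplaceExtension.

(** * Series for the inverse moments *)

Section RealExponent.
Context {R : realType} {d : measure_display} {Om : measurableType d}.
Variables (P : probability Om R) (xi : R -> Om -> R) (phi : R[i] -> R[i]).
Hypothesis rs : regular_subordinator P xi.
Hypothesis phi_ext : holomorphic_right_of (a_ phi) phi.
Hypothesis lap : forall x : R, 0 <= x ->
  exp_moment P xi (- x) 1 = (complex.Re (cexp (- phi x%:C)))%:E /\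
  complex.Im (cexp (- phi x%:C)) = 0.
Hypothesis phi0 : phi 0 = 0.
Hypothesis a_lt0 : (a_ phi < 0)%E.

Lemma lte_between (a : \bar R) (x : R) : (a < x%:E)%E -> exists2 b : R, (a < b%:E)%E & b < x.
Proof.
case: a => [a| |]; last 2 first.
- by rewrite ltNge leey.
- by exists (x - 1); rewrite ?ltNyr // ltrBlDr ltrDl.
by rewrite lte_fin => ax; exists ((a + x) / 2); rewrite ?lte_fin; lra.
Qed.

(** With a < b < min(x, 0), the closed disc of centre 1 and radius 1 - b lies in Re z >= b, where
    phi is holomorphic, and the radius exceeds 1. *)
Lemma laplace_right_of (x : R) : (a_ phi < x%:E)%E ->
  exp_moment P xi (- x) 1 = (complex.Re (cexp (- phi x%:C)))%:E /\
  complex.Im (cexp (- phi x%:C)) = 0.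
Proof.
move=> ax; have [b ab bm] : exists2 b : R, (a_ phi < b%:E)%E & b < Num.min x 0.
  by apply: lte_between; rewrite EFin_min lt_min ax.
move: bm; rewrite lt_min => /andP[bx b0].
have r1 : 1 < 1 - b by lra.
have fD z : normc (z - 1) <= 1 - b -> cderivable (fun z => cexp (- phi z)) z.
  move=> zr; have : (a_ phi < (complex.Re z)%:E)%E.
    apply: lt_le_trans ab _; rewrite lee_fin.
    have := le_trans (normc_Re _) zr; case: z {zr} => u v /=.
    by rewrite ler_norml => /andP[+ _]; lra.
  move=> /phi_ext phiD; by have [] := is_derive_cexp_opp (derivableP phiD).
have bx' : 1 - (1 - b) < x by lra.
have mX : measurable_fun setT (xi 1) by exact: rs_measurable rs _.
have X0 w : 0 <= xi 1 w by exact: (rs_ge0 rs).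
exact: (@laplace_extension _ _ _ P _ mX X0 _ _ r1 fD lap _ bx').
Qed.

Let Imphi_cont (x : R) : (a_ phi < x%:E)%E ->
  complex.Im (phi y%:C) @[y --> x] --> complex.Im (phi x%:C).
Proof.
move=> ax; have := phi_ext (z := x%:C) ax.
move=> /derivable1_diffP /differentiable_continuous phic.
have rc : ccontinuous_at (fun y : R => y%:C) x.
  by apply: ccontinuous_ReIm; [exact: cvg_id|exact: cvg_cst].
by have /cvg_complexP[] : (phi y%:C : R[i]^o) @[y --> x] --> (phi x%:C : R[i]^o)
  by exact: (cvg_comp _ _ rc phic).
Qed.

(** e^{-phi(x)} is real, so the sine of Im phi vanishes on the whole half-line. If Im phi(x) were
    nonzero, continuity from Im phi(0) = 0 would give it a nonzero value in ]-1, 1[, where the sine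
    does not vanish. *)
Lemma phi_real (x : R) : (a_ phi < x%:E)%E -> complex.Im (phi x%:C) = 0.
Proof.
move=> ax; have sin0' y : (a_ phi < y%:E)%E -> sin (complex.Im (phi y%:C)) = 0.
  move=> /laplace_right_of[_]; rewrite /cexp; case: (phi _) => u v /=.
  rewrite mul0r addr0 sinN mulrN => /eqP; rewrite oppr_eq0 mulf_eq0 => /orP[|/eqP //].
  by rewrite gt_eqF ?expR_gt0.
have I0 : complex.Im (phi 0%:C) = 0 by rewrite phi0.
have small (v : R) : `|v| <= 1 -> sin v = 0 -> v = 0.
  move=> v1 sv; apply/eqP; apply: contraTT (eqxx (0 : R)) => v0; rewrite -{1}sv.
  have p2 := @pi_ge2 R.
  have [vp|vn|vz] := ltgtP 0 v; last by rewrite -vz eqxx in v0.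
    rewrite gt_eqF // sin_gt0_pi //; rewrite vp /=; move: v1; rewrite gtr0_norm //; lra.
  rewrite lt_eqF // -oppr_gt0 -sinN sin_gt0_pi //; rewrite oppr_gt0 vn /=.
  move: v1; rewrite ltr0_norm //; lra.
(* [u] lies between 0 and [v], has |u| < 1, and vanishes only with [v]. *)
set v := complex.Im (phi x%:C); pose u := v / (1 + `|v|).
have v1 : 0 < 1 + `|v| by rewrite ltr_pwDl.
have uv : u * (1 + `|v|) = v by rewrite /u divfK // gt_eqF.
have bet : Num.min 0 v <= u <= Num.max 0 v.
  rewrite ge_min le_max; have [v0|v0] := leP 0 v.
    have u0 : 0 <= u by rewrite /u divr_ge0 // ltW.
    have vu : u <= v by rewrite /u ler_pdivrMr // ler_peMr // lerDl.
    by rewrite u0 vu orbT.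
  have u0 : u <= 0 by rewrite /u ler_pdivrMr // mul0r ltW.
  have vu : v <= u.
    by rewrite /u ler_pdivlMr // mulrDr mulr1 gerDl mulr_le0_ge0 // ltW.
  by rewrite u0 vu orbT.
have gc (l b : R) : (a_ phi < l%:E)%E -> {within `[l, b], continuous (fun y => complex.Im (phi y%:C))}.
  move=> al; apply: continuous_in_subspaceT => y; rewrite inE /= in_itv /= => /andP[ly _].
  by apply: Imphi_cont; apply: lt_le_trans al _; rewrite lee_fin.
have [c ac cu] : exists2 c : R, (a_ phi < c%:E)%E & complex.Im (phi c%:C) = u.
  have [x0|/ltW x0] := leP 0 x.
    have [|c] := IVT x0 (gc 0 x a_lt0) (v := u); first by rewrite I0.
    rewrite in_itv /= => /andP[c0 _] cu; exists c => //.
    by apply: lt_le_trans a_lt0 _; rewrite lee_fin.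
  have [|c] := IVT x0 (gc x 0 ax) (v := u); first by rewrite I0 minC maxC.
  rewrite in_itv /= => /andP[c0 _] cu; exists c => //.
  by apply: lt_le_trans ax _; rewrite lee_fin.
have := sin0' c ac; rewrite cu => /small u0; rewrite -uv u0 ?mul0r //.
rewrite /u normrM normfV (gtr0_norm v1) ler_pdivrMr // mul1r; lra.
Qed.

Definition exponent (x : R) : R := complex.Re (phi x%:C).

Lemma phiE (x : R) : (a_ phi < x%:E)%E -> phi x%:C = (exponent x)%:C.
Proof. by move=> /phi_real; rewrite /exponent; case: (phi _) => a b /= ->. Qed.

Lemma exponentE (x : R) : (a_ phi < x%:E)%E ->
  exp_moment P xi (- x) 1 = (expR (- exponent x))%:E.
Proof. by move=> ax; case: (laplace_right_of ax); rewrite phiE // -rmorphN cexpR. Qed.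

Lemma ge0_right_of (x : R) : 0 <= x -> (a_ phi < x%:E)%E.
Proof. by move=> x0; apply: lt_le_trans a_lt0 _; rewrite lee_fin. Qed.

(** The complex derivative is the limit of quotients along real steps; these are real, hence so is
    the limit. *)
Lemma cderive_cvg (x : R) : (a_ phi < x%:E)%E ->
  (n.+1%:R * (exponent (x + n.+1%:R^-1) - exponent x) @[n --> \oo] -->
    complex.Re (cderive phi x%:C)) /\ complex.Im (cderive phi x%:C) = 0.
Proof.
move=> ax; have /derivableP phiD := phi_ext (z := x%:C) ax.
have loc := (cderivable_localP _ _ _).1 phiD; rewrite -/(cderive phi x%:C) in loc *.
move: (cderive phi x%:C) loc => l loc.
pose q n : R[i] := (n.+1%:R * (exponent (x + n.+1%:R^-1) - exponent x))%:C.
have ql : (q n : R[i]^o) @[n --> \oo] --> (l : R[i]^o).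
  apply/cvg_normcP => e e0; have e20 : 0 < e / 2 by rewrite divr_gt0.
  have [s s0 H] := loc _ e20.
  have /cvgrPdist_lt/(_ s s0) := @cvg_harmonic R; apply: filterS => n /=.
  rewrite sub0r normrN => hs; set h : R := n.+1%:R^-1 in hs *.
  have h0 : 0 < h by rewrite invr_gt0.
  have hE : (x + h)%:C - x%:C = h%:C by rewrite rmorphD /= addrAC subrr add0r.
  have := H (x + h)%:C; rewrite hE normcR => /(_ hs).
  rewrite !phiE //; last by apply: lt_trans ax _; rewrite lte_fin ltrDl.
  have -> : q n - l = (n.+1%:R)%:C * ((exponent (x + h))%:C - (exponent x)%:C - l * h%:C).
    rewrite mulrBr -rmorphB /= /q rmorphM /=; congr (_ - _).
    by rewrite mulrCA -rmorphM /= divff // mulr1.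
  rewrite normcM normcR [`|n.+1%:R|]ger0_norm // => Hl.
  apply: le_lt_trans (ler_wpM2l (ler0n _ _) Hl) _.
  by rewrite gtr0_norm // mulrCA divff // mulr1 ltr_pdivrMr // ltr_pMr // ltr1n.
move/cvg_complexP: ql => [q1 q2]; split; first exact: q1.
have q2' : complex.Im (q n) @[n --> \oo] --> (0 : R) by exact: cvg_cst.
by rewrite -(cvg_lim _ q2') // -(cvg_lim _ q2).
Qed.

Hypothesis lim_phi : complex.Re (phi x%:C) @[x --> +oo%R] --> +oo%R.

Let dphi (k : nat) : R := complex.Re (cderive phi k%:R%:C).

Let exponentE0 (x : R) : 0 <= x -> exp_moment P xi (- x) 1 = (expR (- exponent x))%:E.
Proof. by move=> /ge0_right_of /exponentE. Qed.

Let dphiE (k : nat) :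
  n.+1%:R * (exponent (k%:R + n.+1%:R^-1) - exponent k%:R) @[n --> \oo] --> dphi k.
Proof. by case: (cderive_cvg (ge0_right_of (ler0n _ k))). Qed.

Let exponent_cvgy : exponent k%:R @[k --> \oo] --> +oo.
Proof. exact: (cvg_comp _ _ (@cvgr_idn R) lim_phi). Qed.

Lemma exponent_ge0 (k : nat) : 0 <= exponent k%:R.
Proof.
have e0 : exponent 0 = 0 by rewrite /exponent phi0.
by rewrite -{1}e0; apply: (exponent_mono rs exponentE0).
Qed.

Lemma exponent_le0 (x : R) : 0 <= x -> (a_ phi < (- x)%:E)%E -> exponent (- x) <= 0.
Proof.
move=> x0 /exponentE; rewrite opprK => E.
have := exp_moment_mono rs x0 (@ler01 R).
by rewrite E (exp_moment0 rs) lee_fin -{1}expR0 ler_expR oppr_ge0.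
Qed.

(** For l = -(n + 1), the product in [bterm] read backwards, with phi(-j) in place of phi(j + l). *)
Definition moment_coef (n k : nat) : R :=
  (\prod_(1 <= j < n.+1) (exponent k%:R - exponent (- j%:R))) / n`!%:R *
  complex.Re (cderive phi k%:R%:C).

(** Nonnegativity of the coefficients and finiteness of the series are carried along the induction
    because the recursion step requires both. *)
Lemma inv_moment_series (n : nat) : (a_ phi < (- n%:R)%:E)%E ->
  (forall k, 0 <= moment_coef n k) /\ forall T, 0 < T ->
  inv_moment P xi n.+1%:R T = dirichlet (moment_coef n) (fun k => exponent k%:R) T /\
  (dirichlet (moment_coef n) (fun k => exponent k%:R) T < +oo)%E.
Proof.
elim: n => [_|n IH an].
  have -> : moment_coef 0 = dphi.
    by apply/funext => k; rewrite /moment_coef big_geq // fact0 divr1 mul1r.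
  split=> [k|T T0]; first exact: (exponent_deriv_ge0 rs exponentE0 dphiE).
  by split; [exact: inv_moment1|exact: (inv_moment1_fin rs exponentE0 dphiE)].
have nS : - n.+1%:R <= - n%:R :> R by rewrite lerN2 ler_nat.
have [c0 IHm] : (forall k, 0 <= moment_coef n k) /\ forall T, 0 < T ->
    inv_moment P xi n.+1%:R T = dirichlet (moment_coef n) (fun k => exponent k%:R) T /\
    (dirichlet (moment_coef n) (fun k => exponent k%:R) T < +oo)%E.
  by apply: IH; apply: lt_le_trans an _; rewrite lee_fin.
have [b ab bn] := lte_between an.
(* The strict inequality a < b < -(n + 1) leaves room for a moment of order n + 1 + eta with 0 < eta
   < 1. *)
pose eta : R := Num.min 2^-1 (- n.+1%:R - b).
have eta01 : 0 < eta < 1.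
  by rewrite lt_min invr_gt0 ltr0n subr_gt0 bn gt_min invf_lt1 ?ltr1n.
have etab : b <= - (n.+1%:R + eta).
  by rewrite opprD lerBrDl -lerBrDr ge_min lexx orbT.
have aeta : (a_ phi < (- (n.+1%:R + eta))%:E)%E.
  by apply: lt_le_trans ab _; rewrite lee_fin.
have momL := exponentE an; have momL' := exponentE aeta; rewrite !opprK in momL momL'.
have L0 := exponent_le0 (ler0n _ n.+1) an.
have coefE : moment_coef n.+1 =
    fun k => moment_coef n k * (exponent k%:R + - exponent (- n.+1%:R)) / n.+1%:R.
  apply/funext => k; rewrite /moment_coef big_nat_recr //= factS natrM.
  have n1 : n.+1%:R != 0 :> R by [].
  have n2 : n`!%:R != 0 :> R by rewrite pnatr_eq0 -lt0n fact_gt0.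
  set p := \prod_(1 <= j < n.+1) (exponent k%:R - exponent (- j%:R)).
  move: p (exponent k%:R) (exponent (- n.+1%:R)) (complex.Re _) => p e1 e2 e3.
  by move: (n.+1%:R : R) (n`!%:R : R) n1 n2 => x y x0 y0; field; rewrite x0 y0.
split=> [k|T T0].
  by rewrite coefE mulr_ge0 ?invr_ge0 // mulr_ge0 // addr_ge0 ?exponent_ge0 // oppr_ge0.
have mE T' : 0 < T' -> inv_moment P xi n.+1%:R T' =
    dirichlet (moment_coef n) (fun k => exponent k%:R) T' by case/IHm.
have mF T' : 0 < T' -> (dirichlet (moment_coef n) (fun k => exponent k%:R) T' < +oo)%E by case/IHm.
rewrite coefE; split.
  exact: (inv_moment_step rs c0 exponent_ge0 (ltn0Sn n) eta01 momL momL' mE mF).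
exact: (inv_moment_step_fin rs c0 exponent_ge0 (ltn0Sn n) eta01 momL momL' mE mF).
Qed.

End RealExponent.

(** * Return from the regular version to the given process *)

Section NullModification.
Context {R : realType} {d : measure_display} {Om : measurableType d}.
Variable P : probability Om R.

(* The integral of a nonnegative function is a supremum over the simple
   functions below it, so this monotonicity needs no measurability. *)
Lemma ge0_integral_mono (g h : Om -> \bar R) : (forall w, 0 <= g w)%E ->
  (forall w, g w <= h w)%E -> (\int[P]_w g w <= \int[P]_w h w)%E.
Proof.
move=> g0 gh; have h0 w : (0 <= h w)%E := le_trans (g0 w) (gh w).
rewrite !ge0_integralTE //; apply: le_ereal_sup => _ [s sg <-].
by exists s => // w; exact: le_trans (sg w) (gh w).
Qed.

(** [g] need not be measurable: it lies between two measurable modifications of [h], equal to 0 and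
    to +oo on [N], whose integrals both equal that of [h]. *)
Lemma ge0_integral_off_null (N : set Om) (g h : Om -> \bar R) :
  measurable N -> P N = 0%E -> measurable_fun setT h ->
  (forall w, 0 <= g w)%E -> (forall w, 0 <= h w)%E -> (forall w, ~ N w -> g w = h w) ->
  (\int[P]_w g w = \int[P]_w h w)%E.
Proof.
move=> mN N0 mh g0 h0 gh.
pose lo w := (h w * (\1_(~` N) w)%:E)%E; pose up w := (h w + +oo * (\1_N w)%:E)%E.
have mNC : measurable (~` N) by exact: measurableC.
have m1 (A : set Om) : measurable A -> measurable_fun setT (fun w => (\1_A w)%:E : \bar R).
  by move=> mA; apply/measurable_EFinP.
have mlo : measurable_fun setT lo by apply: emeasurable_funM => //; exact: m1.
have mup : measurable_fun setT up.
  by apply: emeasurable_funD => //; apply: emeasurable_funM => //; exact: m1.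
have lo_in w : N w -> lo w = 0%E.
  by move=> Nw; rewrite /lo indicE memNset ?mule0 //; apply.
have lo_out w : ~ N w -> lo w = h w by move=> Nw; rewrite /lo indicE mem_set // mule1.
have up_in w : N w -> up w = +oo%E.
  by move=> Nw; rewrite /up indicE mem_set // mule1 addey // gt_eqF // (lt_le_trans (ltNyr 0)).
have up_out w : ~ N w -> up w = h w by move=> Nw; rewrite /up indicE memNset // mule0 adde0.
have lo0 w : (0 <= lo w)%E.
  by have [Nw|Nw] := pselect (N w); [rewrite lo_in|rewrite lo_out].
have up0 w : (0 <= up w)%E.
  by have [Nw|Nw] := pselect (N w); [rewrite up_in // leey|rewrite up_out].
have log w : (lo w <= g w)%E.
  by have [Nw|Nw] := pselect (N w); [rewrite lo_in|rewrite lo_out // gh].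
have gup w : (g w <= up w)%E.
  by have [Nw|Nw] := pselect (N w); [rewrite up_in // leey|rewrite up_out // gh].
have ae (k : Om -> \bar R) : (forall w, ~ N w -> k w = h w) -> ae_eq P setT k h.
  move=> kh; exists N; split => // w /= /not_implyP[_ kw].
  by apply: contrapT => /kh.
have lo_int : (\int[P]_w lo w = \int[P]_w h w)%E by apply: ge0_ae_eq_integral => //; exact: ae.
have up_int : (\int[P]_w up w = \int[P]_w h w)%E by apply: ge0_ae_eq_integral => //; exact: ae.
apply/eqP; rewrite eq_le -{1}up_int -lo_int; apply/andP; split; exact: ge0_integral_mono.
Qed.

End NullModification.

Section SeriesTerms.
Context {R : realType}.
Variables (phi : R[i] -> R[i]).
Hypothesis a_lt0 : (a_ phi < 0)%E.
Hypothesis phi_exponent : forall x : R, (a_ phi < x%:E)%E -> phi x%:C = (exponent phi x)%:C.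
Hypothesis cderive_real : forall x : R, (a_ phi < x%:E)%E ->
  cderive phi x%:C = (complex.Re (cderive phi x%:C))%:C.

Let natC (k : nat) : k%:R = (k%:R)%:C :> R[i].
Proof. by rewrite (rmorph_nat (@real_complex R)). Qed.

Let phi_nat (k : nat) : phi k%:R = (exponent phi k%:R)%:C.
Proof. by rewrite natC phi_exponent // (lt_le_trans a_lt0) // lee_fin. Qed.

(** Reversing the product by j -> n + 1 - j turns j + l into -j; all factors are then real values of
    phi on ]a, oo[. *)
Lemma bterm_real (n k : nat) (t : R) : (a_ phi < (- n%:R)%:E)%E ->
  bterm phi (- (n.+1)%:Z) t k =
  (moment_coef phi n k * expR (- (exponent phi k%:R * t)))%:C.
Proof.
move=> an; rewrite /bterm /moment_coef abszN absz_nat /=.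
have -> : cexp (- (phi k%:R * t%:C)) = (expR (- (exponent phi k%:R * t)))%:C.
  by rewrite phi_nat -rmorphM -rmorphN cexpR.
have -> : cderive phi k%:R = (complex.Re (cderive phi k%:R%:C))%:C.
  by rewrite -cderive_real -?natC // (lt_le_trans a_lt0) // lee_fin.
have -> : \prod_(1 <= j < n.+1) (phi k%:R - phi (j%:Z + - n.+1%:Z)%:~R) =
    (\prod_(1 <= j < n.+1) (exponent phi k%:R - exponent phi (- j%:R)))%:C.
  rewrite rmorph_prod big_nat_rev /= !big_seq; apply: eq_bigr => j.
  rewrite mem_index_iota => /andP[j1 jn].
  rewrite (rmorphB (@real_complex R)) phi_nat; congr (_ - _).
  have -> : ((1 + n.+1 - j.+1)%:Z + - n.+1%:Z)%:~R = (- j%:R)%:C :> R[i].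
    have -> : (1 + n.+1 - j.+1)%:Z + - n.+1%:Z = - j%:Z.
      by move: jn; clear; lia.
    by rewrite rmorphN /= rmorphN /= -natC.
  rewrite phi_exponent // (lt_le_trans an) // lee_fin lerN2 ler_nat.
  by rewrite -ltnS.
by rewrite natC !rmorphM /= rmorphV // unitfE pnatr_eq0 -lt0n fact_gt0.
Qed.

End SeriesTerms.

Section Transfer.
Context {R : realType} {d : measure_display} {Om : measurableType d}.
Variables (P : probability Om R) (xi xi' : R -> Om -> R) (phi : R[i] -> R[i]) (N : set Om).
Hypothesis xi_sub : subordinator P xi.
Hypothesis xi_phi : laplace_exponent P xi phi.
Hypothesis rs : regular_subordinator P xi'.
Hypotheses (mN : measurable N) (N0 : P N = 0%E).
Hypothesis xi'E : forall w, ~ N w -> forall s, 0 <= s -> xi' s w = xi s w.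

Lemma regularized_laplace (x : R) : 0 <= x ->
  exp_moment P xi' (- x) 1 = (complex.Re (cexp (- phi x%:C)))%:E /\
  complex.Im (cexp (- phi x%:C)) = 0.
Proof.
move=> x0; have := xi_phi (z := x%:C) x0.
have -> : (fun w => cexp (- (x%:C * (xi 1 w)%:C))) = (fun w => (expR (- x * xi 1 w))%:C).
  by apply/funext => w; rewrite -rmorphM -rmorphN cexpR mulNr.
move=> lapE; rewrite -lapE /cintegral /=; split; last first.
  by rewrite Rintegral_cst // mul0r.
have momE : (\int[P]_w (expR (- x * xi 1 w))%:E = exp_moment P xi' (- x) 1)%E.
  apply: (ge0_integral_off_null mN N0).
  - exact: (measurable_exp_moment rs).
  - by move=> w; rewrite lee_fin expR_ge0.
  - by move=> w; rewrite lee_fin expR_ge0.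
  - by move=> w Nw; rewrite xi'E.
rewrite /Rintegral momE fineK // ge0_fin_numE ?exp_moment_ge0 //.
have x1 : - x <= 0 by rewrite oppr_le0.
have := exp_moment_anti rs x1 (@ler01 R); rewrite (exp_moment0 rs).
by move=> /le_lt_trans; apply; rewrite ltry.
Qed.

(** The functionals agree off [N]; on [N] the paths of the original process are arbitrary, so its
    functional is not known to be measurable. *)
Lemma regularized_inv_moment (n : nat) (t : R) : 0 < t ->
  ('E_P[fun w => expfun xi t w ^ (- n%:Z)] = inv_moment P xi' n%:R t)%E.
Proof.
move=> t0; rewrite unlock.
have I0 z w : 0 <= expfun z t w :> R by apply: Rintegral_ge0 => s _; exact: expR_ge0.
have powE z w : expfun z t w ^ (- n%:Z) = expfun z t w `^ (- n%:R).
  by rewrite -powR_intmul // rmorphN.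
apply: (ge0_integral_off_null mN N0).
- apply/measurable_EFinP; apply: (measurableT_comp (measurable_powR _)).
  exact: measurable_expfun (rs_mono rs) (rs_measurable rs) _ (ltW t0).
- by move=> w; rewrite lee_fin powE powR_ge0.
- by move=> w; rewrite lee_fin powR_ge0.
move=> w Nw; rewrite powE; congr (_ `^ _)%:E.
apply: eq_Rintegral => s; rewrite inE /= in_itv /= => /andP[s0 _].
by rewrite xi'E.
Qed.

End Transfer.

Theorem corollary2p16 (R : realType) (d : measure_display)
    (Om : measurableType d) (P : probability Om R)
    (phi : R[i] -> R[i]) (xi : R -> Om -> R)
    (phi_bernstein : bernstein phi)
    (phi_ext : holomorphic_right_of (a_ phi) phi)
    (xi_sub : subordinator P xi)
    (xi_phi : laplace_exponent P xi phi)
    (phi0 : phi 0 = 0)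
    (a_lt0 : (a_ phi < 0)%E)
    (limsup_fin : (limf_esup (fun x : R =>
        (complex.Re (cderive phi x%:C) /
         complex.Re (cderive phi (2 * x)%:C))%:E) +oo%R < +oo)%E)
    (lim_dphi : x ^+ 2 * complex.Re (cderive phi x%:C) @[x --> +oo%R] --> +oo%R)
    (lim_phi : complex.Re (phi x%:C) @[x --> +oo%R] --> +oo%R)
    (l : int) (l_gt : ((-1)%:E + a_ phi < (l%:~R)%:E)%E) (l_lt0 : (l < 0)%R)
    (t : R) (t_gt0 : 0 < t) :
  let E : \bar R := ('E_P[fun w => expfun xi t w ^ l])%E in
  let sum1 : nat -> R[i]^o := fun n => \sum_(1 <= k < n) bterm phi l t k in
  let sum0 : nat -> R[i]^o := fun n => \sum_(0 <= k < n) bterm phi l t k in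
  [/\ cderivable phi 0,
      E \is a fin_num,
      cvgn sum1 /\ cvgn sum0,
      (fine E)%:C =
        cderive phi 0 *
          ((\prod_(1 <= j < `|l|%N) - phi (j%:Z + l)%:~R) / (`|l|.-1)`!%:R)
        + limn sum1 &
      (fine E)%:C = limn sum0].
Proof.
have [xi' [N [rs mN N0 xi'E]]] := regularize xi_sub.
have lap := regularized_laplace xi_phi rs mN N0 xi'E.
have [n lE] : exists n : nat, l = - (n.+1)%:Z.
  by case: l l_lt0 {l_gt} => // n _; exists n; rewrite NegzE.
(* With n = -l - 1, the condition -1 + a < l says that phi(-1), ..., phi(-n) are all defined. *)
have an : (a_ phi < (- n%:R)%:E)%E.
  have lR : l%:~R = - n%:R - 1 :> R by rewrite lE rmorphN /= -pmulrn -natr1 opprD.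
  move: l_gt; rewrite lR; case: (a_ phi) => [a| |].
  - by rewrite -EFinD !lte_fin; clear; move: (n%:R : R) => x; lra.
  - by rewrite addey.
  - by move=> _; rewrite ltNyr.
have [coef0 mom] := inv_moment_series rs phi_ext lap phi0 a_lt0 lim_phi an.
have [momt momt_fin] := mom t t_gt0.
have phi_exponent := phiE rs phi_ext lap phi0 a_lt0.
have cderive_real (x : R) : (a_ phi < x%:E)%E ->
    cderive phi x%:C = (complex.Re (cderive phi x%:C))%:C.
  move=> /(cderive_cvg rs phi_ext lap phi0 a_lt0)[_].
  by case: (cderive phi x%:C) => u v /= ->.
pose T k : R := moment_coef phi n k * expR (- (exponent phi k%:R * t)).
have T0 k : 0 <= T k by rewrite mulr_ge0 ?expR_ge0.
have termE k : bterm phi l t k = (T k)%:C by rewrite lE (bterm_real a_lt0).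
rewrite /=.
have EE : ('E_P[fun w => expfun xi t w ^ l] = \sum_(k <oo) (T k)%:E)%E.
  by rewrite lE (regularized_inv_moment rs mN N0 xi'E) // momt.
have Efin : ('E_P[fun w => expfun xi t w ^ l])%E \is a fin_num.
  rewrite EE ge0_fin_numE //; apply: nneseries_ge0 => k _ _; exact: T0.
set e := fine _.
have T_cvg : \sum_(0 <= k < m) T k @[m --> \oo] --> e.
  have := @is_cvg_nneseries R (fun k => (T k)%:E) xpredT 0%N (fun k _ _ => T0 k).
  have TE : (fun m => \sum_(0 <= k < m) (T k)%:E)%E = EFin \o (fun m => \sum_(0 <= k < m) T k).
    by apply/funext => m; rewrite /= sumEFin.
  move=> /cvg_ex[/= L LP]; have LE : L = e%:E.
    by rewrite /e fineK // EE; apply/esym/cvg_lim.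
  by move: LP; rewrite LE TE => /fine_cvg.
pose s0 : nat -> R[i]^o := fun m => \sum_(0 <= k < m) bterm phi l t k.
pose s1 : nat -> R[i]^o := fun m => \sum_(1 <= k < m) bterm phi l t k.
have s0E m : s0 m = (\sum_(0 <= k < m) T k)%:C.
  by rewrite /s0 rmorph_sum; apply: eq_bigr => k _; rewrite termE.
have s0_cvg : s0 m @[m --> \oo] --> (e%:C : R[i]^o).
  apply/cvg_complexP; split.
    by under eq_fun do rewrite s0E /=.
  by under eq_fun do rewrite s0E /=; exact: cvg_cst.
(* The series from k = 1 is the full series without its term k = 0. *)
have s1_cvg : s1 m @[m --> \oo] --> (e%:C - bterm phi l t 0 : R[i]^o).
  rewrite -(cvg_shiftS s1).
  have -> : (fun m => s1 m.+1) = (fun m => s0 m.+1 - bterm phi l t 0).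
    by apply/funext => m; rewrite /s0 /s1 [in RHS]big_nat_recl //= big_add1 addrAC subrr add0r.
  apply: (@cvgB _ (R[i]^o)); last exact: cvg_cst.
  by rewrite (cvg_shiftS s0).
have hausC := @norm_hausdorff _ (R[i]^o).
split.
- by apply: phi_ext.
- exact: Efin.
- by split; [exact: cvgP s1_cvg|exact: cvgP s0_cvg].
- rewrite -/s1 (cvg_lim hausC s1_cvg) addrC -[LHS](subrK (bterm phi l t 0)).
  (* In the term k = 0, phi(0) = 0 turns the exponential into 1 and each factor phi(0) - phi(j + l)
     into - phi(j + l). *)
  congr (_ + _); rewrite /bterm phi0 mul0r oppr0 cexp0 mulr1 mulrC; congr (_ * (_ / _)).
  by apply: eq_bigr => j _; rewrite sub0r.
- by rewrite -/s0 (cvg_lim hausC s0_cvg).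
Qed.
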